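(* Let $\Lambda_0\subset\mathbb{R}^d$ be an aperiodic and repetitive Delone set of finite local complexity with pattern space $\Omega$, and assume that the action of $\mathbb{R}^d$ on $\Omega$ by translations is uniquely ergodic with unique invariant probability measure $\mu$. For each $k=0,1,2,\dots$: (1) the Sobolev space $\mathcal{W}^{k,2}(\Omega,\mu)$ is a Hilbert space equipped with the norm $\|f\|_{\mathcal{W}^{k,2}(\Omega,\mu)}=\big(\sum_{|\alpha|\le k}\|D^\alpha f\|^2_{L^2(\Omega,\mu)}\big)^{1/2}$; (2) for any $|\alpha|\le k$, the distributional derivative $D^\alpha$ is a bounded local linear operator $D^\alpha:\mathcal{W}^{k,2}(\Omega,\mu)\to\mathcal{W}^{k-|\alpha|,2}(\Omega,\mu)$ which can be intertwined with the orbit homeomorphisms $h_\Lambda$ as follows: for every $f\in\mathcal{W}^{k,2}(\Omega,\mu)$ and $\mu$-almost every $\Lambda\in\Omega$, $$\left(h_\Lambda^*D^\alpha f\right)(\vec t)=\left(D^\alpha_{\mathbb{R}^d}h_\Lambda^*f\right)(\vec t)\qquad\text{for }\lambda^d\text{-a.e. }\vec t\in\mathbb{R}^d,$$ in the sense of distributional derivatives on both sides; (3) the space $C^\infty_{tlc}(\Omega)$ is dense in $\mathcal{W}^{k,2}(\Omega,\mu)$ with respect to the norm $\|f\|_{\mathcal{W}^{k,2}(\Omega,\mu)}=\big(\sum_{|\alpha|\le k}\|D^\alpha f\|^2_{L^2(\Omega,\mu)}\big)^{1/2}$.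
   Context: Delone sets. $\Lambda\subset\mathbb{R}^d$ is a Delone set if it is uniformly discrete (there is $\varepsilon>0$ with $|\vec x-\vec y|>\varepsilon$ for all distinct $\vec x,\vec y\in\Lambda$) and relatively dense (there is $R>0$ with $\Lambda\cap B_R(\vec x)\ne\varnothing$ for all $\vec x\in\mathbb{R}^d$). A cluster is a finite subset of $\Lambda$. $\Lambda$ has finite local complexity if for every $R>0$ there are finitely many clusters $P_1,\dots,P_n$ such that for each $\vec x\in\mathbb{R}^d$ the set $B_R(\vec x)\cap\Lambda$ is a translate of some $P_i$. It is aperiodic if $\Lambda-\vec t=\Lambda$ implies $\vec t=\vec 0$. It is repetitive if for every cluster $P\subset\Lambda$ there is $R_P>0$ such that for every $\vec x\in\mathbb{R}^d$ the set $B_{R_P}(\vec x)\cap\Lambda$ contains a translate of $P$. Pattern space. Write $\varphi_{\vec t}(\Lambda)=\Lambda-\vec t$. Put $\varrho(\Lambda_1,\Lambda_2)=\min\{\bar\varrho(\Lambda_1,\Lambda_2),2^{-1/2}\}$, where $\bar\varrho(\Lambda_1,\Lambda_2)$ is the infimum of all $\varepsilon>0$ such that there exist $\vec s,\vec t\in B_\varepsilon(\vec 0)$ with $B_{1/\varepsilon}(\vec 0)\cap\varphi_{\vec s}(\Lambda_1)=B_{1/\varepsilon}(\vec 0)\cap\varphi_{\vec t}(\Lambda_2)$. The pattern space $\Omega$ of $\Lambda_0$ is the closure of $\{\varphi_{\vec t}(\Lambda_0):\vec t\in\mathbb{R}^d\}$ with respect to the metric $\varrho$; it is a compact metric space of Delone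 sets on which $\mathbb{R}^d$ acts continuously by $\varphi$. Unique ergodicity means there is exactly one Borel probability measure $\mu$ on $\Omega$ invariant under all $\varphi_{\vec t}$. For $\Lambda\in\Omega$, $h_\Lambda(\vec t)=\varphi_{\vec t}(\Lambda)$ and $h_\Lambda^*f=f\circ h_\Lambda$, a function on $\mathbb{R}^d$. $\lambda^d$ is Lebesgue measure. Smooth functions. $f:\Omega\to\mathbb{R}$ is differentiable if for all $\Lambda\in\Omega$ and $\vec t\in\mathbb{R}^d$ the limit $\frac{\partial f}{\partial\vec t}(\Lambda)=\lim_{s\to0}\frac{f(\varphi_{s\vec t}(\Lambda))-f(\Lambda)}{s}$ exists; higher derivatives are defined iteratively, and $D^\alpha f=\frac{\partial^{|\alpha|}f}{\partial\vec e_1^{\,\alpha_1}\cdots\partial\vec e_d^{\,\alpha_d}}$ for a multiindex $\alpha$, with $\vec e_i$ the standard unit vectors. $C^\infty(\Omega)$ is the space of continuous functions all of whose derivatives exist and are continuous on $(\Omega,\varrho)$. $f\in C(\Omega)$ is transversally locally constant if for every $\Lambda\in\Omega$ there is $\varepsilon>0$ such that $f(\Lambda')=f(\Lambda)$ for all $\Lambda'\in\Omega$ with $B_{1/\varepsilon}(\vec 0)\cap\Lambda'=B_{1/\varepsilon}(\vec 0)\cap\Lambda$; $C^\infty_{tlc}(\Omega)$ is the set of such functions in $C^\infty(\Omega)$. Sobolev spaces. For $f\in L^1(\Omega,\mu)$ the distributional derivative $D^\alpha f$ is the functional $\varphi\mapsto(-1)^{|\alpha|}\int_\Omega f\,D^\alpha\varphi\,d\mu$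 on $C^\infty(\Omega)$. One writes $D^\alpha f\in L^2(\Omega,\mu)$ if this functional is $\varphi\mapsto\langle g,\varphi\rangle_{L^2(\Omega,\mu)}$ for some $g\in L^2(\Omega,\mu)$, which is then also denoted $D^\alpha f$. $\mathcal{W}^{k,2}(\Omega,\mu)=\{f\in L^2(\Omega,\mu): D^\alpha f\in L^2(\Omega,\mu)\text{ for all }|\alpha|\le k\}$. $D^\alpha_{\mathbb{R}^d}$ is the usual distributional derivative on $\mathbb{R}^d$. Local means: if $f=g$ $\mu$-a.e. on an open set $O\subset\Omega$ then $D^\alpha f=D^\alpha g$ $\mu$-a.e. on $O$. *)

(* Defs.v *)
From HB Require Import structures.
From mathcomp Require Import all_boot all_order all_algebra.
From mathcomp Require Import all_classical all_reals all_analysis.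
From mathcomp Require Import lra ring.

Set Implicit Arguments.
Unset Strict Implicit.
Unset Printing Implicit Defensive.
Import Order.TTheory GRing.Theory Num.Theory.
Import numFieldNormedType.Exports.

Local Open Scope classical_set_scope.
Local Open Scope ring_scope.

Section Euclidean.
Context {R : realType} {d : nat}.
Implicit Types (x y z t : 'rV[R]_d) (L : set 'rV[R]_d).

(* The library norm on ['rV_d] is the sup norm; it induces the same topology. *)
Definition enorm x : R := Num.sqrt (\sum_(i < d) x ord0 i ^+ 2).

Definition eball x (r : R) : set 'rV[R]_d := [set y | enorm (y - x) < r].

Definition vshift t L : set 'rV[R]_d := [set x - t | x in L].

Lemma sumsq_ge0 x : 0 <= \sum_(i < d) x ord0 i ^+ 2.
Proof. by apply: sumr_ge0 => i _; exact: sqr_ge0. Qed.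

Lemma enorm_ge0 x : 0 <= enorm x. Proof. exact: sqrtr_ge0. Qed.

Lemma enorm0 : enorm 0 = 0.
Proof.
rewrite /enorm big1 ?sqrtr0// => i _; by rewrite mxE expr0n.
Qed.

Lemma enormN x : enorm (- x) = enorm x.
Proof. by rewrite /enorm; under eq_bigr do rewrite mxE sqrrN. Qed.

Lemma enormB x y : enorm (x - y) = enorm (y - x).
Proof. by rewrite -enormN opprB. Qed.

Lemma enorm_eq0 x : enorm x = 0 -> x = 0.
Proof.
move=> /eqP; rewrite /enorm sqrtr_eq0 => s0.
have /eqP : \sum_(i < d) x ord0 i ^+ 2 = 0.
  by apply/eqP; rewrite eq_le s0 sumsq_ge0.
rewrite psumr_eq0 => [/allP xi0|i _]; last exact: sqr_ge0.
apply/rowP => i; rewrite mxE; apply/eqP.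
by have := xi0 i (mem_index_enum i); rewrite /= sqrf_eq0.
Qed.

Lemma cauchy_schwarz x y :
  \sum_(i < d) x ord0 i * y ord0 i <= enorm x * enorm y.
Proof.
have [x0|xn0] := eqVneq (enorm x) 0.
  rewrite x0 mul0r big1// => i _.
  by rewrite (enorm_eq0 x0) mxE mul0r.
have [y0|yn0] := eqVneq (enorm y) 0.
  rewrite y0 mulr0 big1// => i _.
  by rewrite (enorm_eq0 y0) mxE mulr0.
have xp : 0 < enorm x by rewrite lt_def xn0 enorm_ge0.
have yp : 0 < enorm y by rewrite lt_def yn0 enorm_ge0.
have := @sumr_ge0 R _ (index_enum 'I_d) xpredT
  (fun i => (enorm y * x ord0 i - enorm x * y ord0 i) ^+ 2)
  (fun i _ => sqr_ge0 _).
have -> : \sum_(i < d) (enorm y * x ord0 i - enorm x * y ord0 i) ^+ 2 =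
  enorm y ^+ 2 * (\sum_(i < d) x ord0 i ^+ 2)
  - 2 * (enorm x * enorm y) * (\sum_(i < d) x ord0 i * y ord0 i)
  + enorm x ^+ 2 * (\sum_(i < d) y ord0 i ^+ 2).
  rewrite !big_distrr/= -sumrB -big_split/=; apply: eq_bigr => i _; ring.
rewrite /= -(sqr_sqrtr (sumsq_ge0 x)) -(sqr_sqrtr (sumsq_ge0 y)).
rewrite -/(enorm x) -/(enorm y).
set S := \sum_(i < d) _; move: xp yp; move: (enorm x) (enorm y) S => a b S.
move=> a0 b0 h; have ab0 : 0 < a * b by rewrite mulr_gt0.
rewrite -subr_ge0 -(pmulr_rge0 _ ab0); lra.
Qed.

Lemma ler_enormD x y : enorm (x + y) <= enorm x + enorm y.
Proof.
rewrite -(@ler_pXn2r _ 2)// ?nnegrE ?addr_ge0 ?enorm_ge0//.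
rewrite sqrrD {1 2 4}/enorm !sqr_sqrtr ?sumsq_ge0//.
have -> : \sum_(i < d) (x + y) ord0 i ^+ 2 = \sum_(i < d) x ord0 i ^+ 2
   + (\sum_(i < d) x ord0 i * y ord0 i) *+ 2 + \sum_(i < d) y ord0 i ^+ 2.
  rewrite -sumrMnl -!big_split/=; apply: eq_bigr => i _.
  by rewrite mxE sqrrD.
by rewrite lerD2r lerD2l lerMn2r/= cauchy_schwarz.
Qed.

Lemma vshiftE t L x : vshift t L x <-> L (x + t).
Proof.
split; first by move=> [y Ly <-]; rewrite subrK.
by move=> Lx; exists (x + t) => //; rewrite addrK.
Qed.

Lemma vshift0 L : vshift 0 L = L.
Proof. by apply/seteqP; split => x /=; rewrite vshiftE addr0. Qed.

Lemma vshiftD s t L : vshift s (vshift t L) = vshift (s + t) L.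
Proof. by apply/seteqP; split => x /=; rewrite !vshiftE addrA. Qed.

Definition uniformly_discrete L :=
  exists2 e : R, 0 < e & forall x y, L x -> L y -> x <> y -> e < enorm (x - y).

Definition relatively_dense L :=
  exists2 r : R, 0 < r & forall x, L `&` eball x r !=set0.

Definition is_delone L := uniformly_discrete L /\ relatively_dense L.

Lemma is_delone_vshift t L : is_delone L -> is_delone (vshift t L).
Proof.
move=> [[e e0 Le] [r r0 Lr]]; split.
  exists e => // x y /vshiftE Lx /vshiftE Ly xy.
  rewrite (_ : x - y = x + t - (y + t)); last by rewrite opprD addrACA subrr addr0.
  by apply: Le => // /addIr.
exists r => // x; have [y [Ly yx]] := Lr (x + t).
exists (y - t); split; first by exists y.
by move: yx; rewrite /eball/= (_ : y - t - x = y - (x + t))// opprD addrA addrAC.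
Qed.

End Euclidean.

Record deloneSet (R : realType) (d : nat) := DeloneSet {
  delone_pts :> set 'rV[R]_d ;
  deloneP : is_delone delone_pts }.

HB.instance Definition _ (R : realType) (d : nat) :=
  gen_eqMixin (deloneSet R d).
HB.instance Definition _ (R : realType) (d : nat) :=
  gen_choiceMixin (deloneSet R d).

Section DeloneMetric.
Context {R : realType} {d : nat}.
Implicit Types (L M K : deloneSet R d) (t : 'rV[R]_d) (e : R).

Lemma delone_eq L M : L = M :> set 'rV[R]_d -> L = M.
Proof.
case: L M => [A pA] [B pB] /= AB; subst B.
by rewrite (Prop_irrelevance pA pB).
Qed.

Definition translate t L : deloneSet R d :=
  DeloneSet (is_delone_vshift t (deloneP L)).

Definition agree e L M := 0 < e /\ exists s t, [/\ enorm s < e, enorm t < e &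
  eball 0 e^-1 `&` translate s L = eball 0 e^-1 `&` translate t M].

(* [rho_bar] is extended-real-valued so that the infimum of an empty set is
   [+oo]. *)
Definition rho_bar L M : \bar R := ereal_inf [set e%:E | e in [set e | agree e L M]].

Definition rho L M : R := fine (mine (rho_bar L M) ((Num.sqrt 2)^-1)%:E).

Let c : R := (Num.sqrt 2)^-1.

Let c_gt0 : 0 < c. Proof. by rewrite /c invr_gt0 sqrtr_gt0. Qed.

Let c_sq : c * c = 2^-1.
Proof. by rewrite /c -invfM -expr2 sqr_sqrtr. Qed.

Lemma agreeP e L M s t : 0 < e -> enorm s < e -> enorm t < e ->
  (forall x, enorm x < e^-1 -> delone_pts L (x + s) <-> delone_pts M (x + t)) -> agree e L M.
Proof.
move=> e0 se te LM; split => //; exists s, t; split => //.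
apply/seteqP; split => x [] xe /= /vshiftE h; split => //; apply/vshiftE;
  by apply/(LM x) => //; move: xe; rewrite /eball/= subr0.
Qed.

Lemma agreeE e L M : agree e L M -> 0 < e /\ exists s t,
  [/\ enorm s < e, enorm t < e &
     forall x, enorm x < e^-1 -> delone_pts L (x + s) <-> delone_pts M (x + t)].
Proof.
move=> [e0 [s [t [se te /seteqP[LM ML]]]]]; split => //; exists s, t; split => //.
move=> x xe; have xb : eball 0 e^-1 x by rewrite /eball/= subr0.
split => h.
- by have [|_ /vshiftE] := LM x; first by split => //; apply/vshiftE.
- by have [|_ /vshiftE] := ML x; first by split => //; apply/vshiftE.
Qed.

Lemma agree_refl e L : 0 < e -> agree e L L.
Proof. by move=> e0; apply: (@agreeP _ _ _ 0 0); rewrite ?enorm0. Qed.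

Lemma agree_sym e L M : agree e L M -> agree e M L.
Proof.
move=> /agreeE[e0 [s [t [se te LM]]]]; apply: (@agreeP _ _ _ t s) => // x xe.
by rewrite LM.
Qed.

Lemma agree_le e e' L M : e <= e' -> agree e L M -> agree e' L M.
Proof.
move=> ee' /agreeE[e0 [s [t [se te LM]]]].
have e'0 : 0 < e' by exact: lt_le_trans ee'.
apply: (@agreeP _ _ _ s t) => //; [exact: lt_le_trans ee'|exact: lt_le_trans ee'|].
by move=> x xe; apply: LM; rewrite (lt_le_trans xe)// lef_pV2.
Qed.

Lemma agree_trans e e' L M K : e + e' <= c ->
  agree e L M -> agree e' M K -> agree (e + e') L K.
Proof.
move=> eec /agreeE[e0 [s [t [se te LM]]]] /agreeE[e'0 [s' [t' [se' te' MK]]]].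
have ee0 : 0 < e + e' by exact: addr_gt0.
have eesq : (e + e') * (e + e') <= 1.
  apply: (@le_trans _ _ (c * c)); first by rewrite ler_pM// ltW.
  by rewrite c_sq; lra.
have inv_le a b : 0 < a -> 0 < b -> a + b = e + e' -> (a + b)^-1 + b <= a^-1.
  move=> a0 b0 ab; rewrite -lerBrDr.
  rewrite -[(a + b)^-1]mul1r ler_pdivrMr ?ab//.
  have -> : (a^-1 - b) * (e + e') = 1 + b * (a^-1 - (e + e')).
    rewrite -ab; field; exact: lt0r_neq0.
  rewrite lerDl mulr_ge0 ?ltW// subr_gt0.
  have aee : a < e + e' by rewrite -ab ltrDl.
  rewrite -[a^-1]mulr1 ltr_pdivlMl//.
  by apply: (lt_le_trans _ eesq); rewrite ltr_pM2r.
apply: (@agreeP _ _ _ (s + s') (t + t')) => //.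
- by rewrite (le_lt_trans (ler_enormD _ _))// ltrD.
- by rewrite (le_lt_trans (ler_enormD _ _))// ltrD.
move=> x xee.
have -> : x + (s + s') = x + s' + s by rewrite [s + s']addrC addrA.
rewrite LM; last first.
  rewrite (le_lt_trans (ler_enormD _ _))//.
  by apply: lt_le_trans (inv_le e e' e0 e'0 erefl); rewrite ltrD.
have -> : x + s' + t = x + t + s' by rewrite addrAC.
rewrite MK ?addrA//.
rewrite (le_lt_trans (ler_enormD _ _))//.
apply: lt_le_trans (inv_le e' e e'0 e0 (addrC _ _)).
by rewrite ltrD// addrC.
Qed.

Lemma rho_bar_ge0 L M : (0 <= rho_bar L M)%E.
Proof.
by apply: le_ereal_inf_tmp => _ [e /= [e0 _] <-]; rewrite lee_fin ltW.
Qed.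

Lemma rho_fin L M : (mine (rho_bar L M) c%:E)%E = (rho L M)%:E.
Proof.
rewrite /rho -/c fineK// ge0_fin_numE; last first.
  by rewrite le_min rho_bar_ge0 lee_fin ltW.
by rewrite gt_min ltry orbT.
Qed.

Lemma rho_ge0 L M : 0 <= rho L M.
Proof. by rewrite -lee_fin -rho_fin le_min rho_bar_ge0 lee_fin ltW. Qed.

Lemma rho_le_c L M : rho L M <= c.
Proof. by rewrite -lee_fin -rho_fin ge_min lexx orbT. Qed.

Lemma agree_rho e L M : agree e L M -> rho L M <= e.
Proof.
move=> LM; rewrite -lee_fin -rho_fin ge_min; apply/orP; left.
by apply: ereal_inf_lbound; exists e.
Qed.

Lemma rho_agree e L M : e <= c -> rho L M < e -> agree e L M.
Proof.
move=> ec; rewrite -lte_fin -rho_fin gt_min => /orP[|]; last first.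
  by rewrite lte_fin ltNge ec.
by move=> /ereal_inf_lt[_ /= [e' LM <-]]; rewrite lte_fin => /ltW/agree_le; exact.
Qed.

Lemma rhoxx L : rho L L = 0.
Proof.
apply/eqP; rewrite eq_le rho_ge0 andbT; apply/ler_addgt0Pl => e e0.
by rewrite addr0; apply: agree_rho; exact: agree_refl.
Qed.

Lemma rho_sym L M : rho L M = rho M L.
Proof.
suff h L' M' : rho_bar L' M' = rho_bar M' L' by rewrite /rho h.
by rewrite /rho_bar; congr (ereal_inf (image _ _)); apply/seteqP; split => e /agree_sym.
Qed.

Lemma rho_triangle M L K : rho L K <= rho L M + rho M K.
Proof.
have [cle|] := leP c (rho L M + rho M K); first exact: le_trans (rho_le_c _ _) cle.
move=> ltc; apply/ler_addgt0Pl => e e0.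
pose h := Num.min (e / 2) ((c - (rho L M + rho M K)) / 2).
have h0 : 0 < h by rewrite /h lt_min !divr_gt0//= subr_gt0.
have he : h <= e / 2 by rewrite /h ge_min lexx.
have hc : h <= (c - (rho L M + rho M K)) / 2 by rewrite /h ge_min lexx orbT.
have LM0 := rho_ge0 L M; have MK0 := rho_ge0 M K.
have aLM : agree (rho L M + h) L M by apply: rho_agree; lra.
have aMK : agree (rho M K + h) M K by apply: rho_agree; lra.
suff : rho L K <= (rho L M + h) + (rho M K + h) by lra.
by apply/agree_rho/(agree_trans _ aLM aMK); lra.
Qed.

Lemma rho_eq0 L M : rho L M = 0 -> L = M.
Proof.
suff h L' M' : rho L' M' = 0 -> L' `<=` M'.
  by move=> LM; apply: delone_eq; apply/seteqP; split; apply: h; rewrite // rho_sym.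
move=> LM0 p Lp.
have [[e0 e0_gt0 Mdisc] _] := deloneP M'.
have near_p (e : R) : 0 < e -> exists2 q, delone_pts M' q & enorm (q - p) < e.
  move=> e_gt0.
  have n1_gt0 : 0 < enorm p + 2.
    by rewrite (lt_le_trans (ltr0n _ 2))// lerDr enorm_ge0.
  pose r := Num.min (Num.min (e / 2) c) (Num.min 1 (enorm p + 2)^-1).
  have r0 : 0 < r by rewrite /r !lt_min c_gt0 divr_gt0//= ltr01 invr_gt0.
  have re : r <= e / 2 by rewrite /r !ge_min lexx.
  have rc : r <= c by rewrite /r !ge_min lexx orbT.
  have r1 : r <= 1 by rewrite /r !ge_min lexx !orbT.
  have rp : r <= (enorm p + 2)^-1 by rewrite /r !ge_min lexx !orbT.
  have /agreeE[_ [s [t [sr tr LM]]]] : agree r L' M' by apply: rho_agree; rewrite ?LM0.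
  exists (p - s + t); last first.
    have -> : p - s + t - p = t - s by rewrite addrAC [p - s]addrC addrK addrC.
    rewrite (le_lt_trans (ler_enormD _ _))// enormN; lra.
  apply/LM; last by rewrite subrK.
  rewrite (le_lt_trans (ler_enormD _ _))// enormN.
  apply: (@lt_le_trans _ _ (enorm p + 2)); first by lra.
  by rewrite -[leLHS]invrK lef_pV2// posrE invr_gt0.
have [q1 Mq1 q1p] := near_p (e0 / 2) (divr_gt0 e0_gt0 (ltr0n _ 2)).
have [<-//|/eqP q1Np] := eqVneq q1 p.
have n0 : 0 < enorm (q1 - p).
  rewrite lt_def enorm_ge0 andbT; apply/eqP => /enorm_eq0 /eqP.
  by rewrite subr_eq0 => /eqP.
have [q2 Mq2 q2p] := near_p (Num.min (enorm (q1 - p)) (e0 / 2))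
  ltac:(by rewrite lt_min n0 divr_gt0).
move: q2p; rewrite lt_min => /andP[q21 q2p].
have /(Mdisc _ _ Mq1 Mq2) : q1 <> q2 by move=> q12; move: q21; rewrite q12 ltxx.
have -> : q1 - q2 = (q1 - p) + (p - q2) by rewrite addrA subrK.
have := ler_enormD (q1 - p) (p - q2); rewrite (enormB p q2); lra.
Qed.

HB.instance Definition _ := @isMetric.Build R (deloneSet R d)
  rho rhoxx rho_eq0 rho_sym rho_triangle.

Lemma continuous_translate t : continuous (translate t).
Proof.
move=> L B /nbhs_ballP[e /= e0 eB].
pose e' := Num.min (e / 2) c.
have e'0 : 0 < e' by rewrite lt_min divr_gt0//=.
have t0 := enorm_ge0 t.
have p0 : 0 < e'^-1 + enorm t by rewrite ltr_wpDr// invr_gt0.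
pose r := (e'^-1 + enorm t)^-1.
have r0 : 0 < r by rewrite invr_gt0.
have re' : r <= e' by rewrite -[leRHS]invrK lef_pV2 ?posrE ?invr_gt0// lerDl.
have e'c : e' <= c by rewrite ge_min lexx orbT.
have e'e : e' < e by rewrite gt_min ltr_pdivrMr// mulr2n mulrDr !mulr1 ltrDl e0.
apply/nbhs_ballP; exists r => //= M.
rewrite ballEmdist/= => /(rho_agree (le_trans re' e'c)).
move=> /agreeE[_ [s [s' [sr s'r LM]]]].
apply: eB; rewrite ballEmdist/=.
apply: (@le_lt_trans _ _ e') => //; apply: agree_rho.
apply: (@agreeP _ _ _ s s') => //; [exact: lt_le_trans re'|exact: lt_le_trans re'|].
move=> x xe /=; rewrite !vshiftE ![x + _ + t]addrAC; apply: LM.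
by rewrite (le_lt_trans (ler_enormD _ _))// /r invrK ltrD2r.
Qed.

(* The closure is taken in the space of Delone sets; nothing is lost, since every
   limit for [rho] of translates of a Delone set is Delone. *)
Definition orbit_closure L : set (deloneSet R d) :=
  closure [set translate t L | t in [set: 'rV[R]_d]].

Lemma orbit_closure_self L : orbit_closure L L.
Proof.
apply: subset_closure; exists 0 => //.
by apply: delone_eq; rewrite /= vshift0.
Qed.

Lemma orbit_closure_translate t L M :
  orbit_closure L M -> orbit_closure L (translate t M).
Proof.
move=> LM B /continuous_translate /LM[_ [[s _ <-] Bs]].
exists (translate t (translate s L)); split => //; exists (t + s) => //.
by apply: delone_eq; rewrite /= vshiftD.
Qed.

Definition aperiodic L := forall t, translate t L = L -> t = 0.

Definition is_cluster L (P : set 'rV[R]_d) := finite_set P /\ P `<=` L.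

Definition finite_local_complexity L := forall r : R, 0 < r ->
  exists (n : nat) (P : 'I_n -> set 'rV[R]_d), (forall i, is_cluster L (P i)) /\
    forall x, exists i t, eball x r `&` L = vshift t (P i).

Definition repetitive L := forall P, is_cluster L P ->
  exists2 r : R, 0 < r & forall x, exists t, vshift t P `<=` eball x r `&` L.

End DeloneMetric.

Definition pattern_space (R : realType) (d : nat) (L0 : deloneSet R d) : Type :=
  set_type (orbit_closure L0).

Section PatternSpace.
Context {R : realType} {d : nat} (L0 : deloneSet R d).
Local Notation Omega := (pattern_space L0).

HB.instance Definition _ := PseudoMetric.copy Omega (set_type (orbit_closure L0)).

HB.instance Definition _ := isPointed.Build Omega
  (exist _ L0 (mem_set (@orbit_closure_self R d L0))).

HB.instance Definition _ := @isMeasurable.Build (sigma_display (@open Omega))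
  Omega <<s @open Omega >> (@sigma_algebra0 _ setT _) (@sigma_algebraC Omega _)
  (@sigma_algebra_bigcup _ setT _).

Definition phi (t : 'rV[R]_d) (L : Omega) : Omega :=
  exist _ (translate t (val L))
    (mem_set (@orbit_closure_translate R d t L0 (val L) (set_mem (valP L)))).

Definition translation_invariant (mu : probability Omega R) :=
  forall t (A : set Omega), measurable A -> mu (phi t @^-1` A) = mu A.

Definition uniquely_ergodic (mu : probability Omega R) := translation_invariant mu /\
  forall nu : probability Omega R, translation_invariant nu ->
    forall A : set Omega, measurable A -> nu A = mu A.

End PatternSpace.

Section RowMeasurable.
Context {R : realType} (n : nat).

Definition rV_coord (i : 'I_n) (x : 'rV[R]_n) : R := x ord0 i.

Let rV_measurable0 : g_sigma_preimage rV_coord set0.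
Proof. exact: sigma_algebra0. Qed.

Let rV_measurableC A : g_sigma_preimage rV_coord A -> g_sigma_preimage rV_coord (~` A).
Proof. exact: sigma_algebraC. Qed.

Let rV_measurable_bigcup (F : (set 'rV[R]_n)^nat) :
  (forall i, g_sigma_preimage rV_coord (F i)) ->
  g_sigma_preimage rV_coord (\bigcup_i (F i)).
Proof. exact: sigma_algebra_bigcup. Qed.

(* The product sigma-algebra, which is the Borel sigma-algebra of R^n. *)
HB.instance Definition _ := @isMeasurable.Build
  (measure_tuple_display default_measure_display) 'rV[R]_n
  (g_sigma_preimage rV_coord) rV_measurable0 rV_measurableC rV_measurable_bigcup.

Lemma measurable_coord i : measurable_fun [set: 'rV[R]_n] (rV_coord i).
Proof.
move=> _ Y mY; rewrite setTI; apply: sub_sigma_algebra => /=.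
rewrite -bigcup_seq/=; exists i => /=; first by rewrite mem_index_enum.
by exists Y => //; rewrite setTI.
Qed.

Lemma measurable_fun_rV d' (T : measurableType d') (f : T -> 'rV[R]_n) :
  (forall i, measurable_fun [set: T] (rV_coord i \o f)) ->
  measurable_fun [set: T] f.
Proof.
move=> mf _ A mA; rewrite setTI.
have : preimage_set_system [set: T] f (g_sigma_preimage rV_coord) (f @^-1` A).
  by exists A => //; rewrite setTI.
rewrite -g_sigma_preimage_comp; move: (f @^-1` A).
apply: smallest_sub; first exact: sigma_algebra_measurable.
rewrite -bigcup_seq => B [i _ [C mC <-]].
exact: mf.
Qed.

End RowMeasurable.

Section RowCons.
Context {R : realType} {n : nat}.

Definition rV_cons (p : measurableTypeR R * 'rV[R]_n) : 'rV[R]_n.+1 :=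
  row_mx (p.1 : R)%:M p.2.

Definition rV_uncons (x : 'rV[R]_n.+1) : measurableTypeR R * 'rV[R]_n :=
  (rV_coord ord0 x, \row_j rV_coord (lift ord0 j) x).

Lemma coord_cons0 p : rV_coord ord0 (rV_cons p) = p.1.
Proof.
rewrite /rV_coord /rV_cons (_ : @ord0 n = lshift n (@ord0 0)); last exact: val_inj.
by rewrite [LHS](row_mxEl (p.1 : R)%:M p.2) mxE eqxx mulr1n.
Qed.

Lemma coord_consS p j : rV_coord (lift ord0 j) (rV_cons p) = rV_coord j p.2.
Proof.
rewrite /rV_coord /rV_cons (_ : lift ord0 j = rshift 1 j); last exact: val_inj.
exact: (row_mxEr (p.1 : R)%:M p.2).
Qed.

Lemma rV_consK : cancel rV_cons rV_uncons.
Proof.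
move=> p; rewrite /rV_uncons coord_cons0.
case: p => a v; congr pair; apply/rowP => j.
by rewrite mxE coord_consS.
Qed.

Lemma measurable_rV_cons : measurable_fun setT rV_cons.
Proof.
apply: measurable_fun_rV => i.
have [j ->|->] := unliftP ord0 i.
- rewrite (_ : _ \o _ = rV_coord j \o snd); last first.
    by apply/funext => p; rewrite /= coord_consS.
  apply: measurableT_comp; [exact: measurable_coord|exact: measurable_snd].
- rewrite (_ : _ \o _ = fst); last by apply/funext => p; rewrite /= coord_cons0.
  exact: measurable_fst.
Qed.

Lemma measurable_rV_uncons : measurable_fun setT rV_uncons.
Proof.
apply/measurable_fun_pairP; split; first exact: measurable_coord.
apply: measurable_fun_rV => i.
rewrite (_ : _ \o _ = rV_coord (lift ord0 i)); first exact: measurable_coord.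
by apply/funext => x; rewrite /= /rV_coord mxE.
Qed.

Variable mu : {sigma_finite_measure set 'rV[R]_n -> \bar R}.

Definition rV_prod : set 'rV[R]_n.+1 -> \bar R :=
  pushforward (@lebesgue_measure R \x mu)%E rV_cons.

Let rV_prod0 : rV_prod set0 = 0%E.
Proof. by rewrite /rV_prod /pushforward preimage_set0 measure0. Qed.

Let rV_prod_ge0 A : (0 <= rV_prod A)%E.
Proof. by rewrite /rV_prod /pushforward measure_ge0. Qed.

Let rV_prod_sigma_additive : semi_sigma_additive rV_prod.
Proof.
move=> F mF tF mUF; rewrite /rV_prod /pushforward preimage_bigcup.
have mpre A : measurable A -> measurable (rV_cons @^-1` A).
  by move=> mA; rewrite -[X in measurable X]setTI; exact: measurable_rV_cons.
apply: measure_semi_sigma_additive.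
- by move=> i; exact: mpre.
- apply/trivIsetP => /= i j _ _ ij; rewrite -preimage_setI.
  by move/trivIsetP : tF => /(_ _ _ _ _ ij) ->//; rewrite preimage_set0.
- by rewrite -preimage_bigcup; exact: mpre.
Qed.

HB.instance Definition _ := isMeasure.Build _ _ _ rV_prod
  rV_prod0 rV_prod_ge0 rV_prod_sigma_additive.

Let rV_prod_sigma_finite : sigma_finite setT rV_prod.
Proof.
have /sigma_finiteP[A [AT Atr Afin]] := sigma_finiteT (@lebesgue_measure R).
have /sigma_finiteP[B [BT Btr Bfin]] := sigma_finiteT mu.
have [F FT Ffin] : sigma_finite setT (@lebesgue_measure R \x mu)%E.
  exists (fun n => A n `*` B n).
    rewrite -setXTT AT BT predeqE => -[x y]; split.
      move=> [/= [i _ Aix] [k _ Bky]]; exists (maxn i k) => //; split.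
      - by move: x Aix; exact/subsetPset/Atr/leq_maxl.
      - by move: y Bky; exact/subsetPset/Btr/leq_maxr.
    by move=> [i _ []/= ? ?]; split; exists i.
  move=> k; have [? ?] := Afin k; have [? ?] := Bfin k.
  split; first exact: measurableX.
  by rewrite product_measure1E// lte_mul_pinfty// ge0_fin_numE.
exists (fun k => rV_uncons @^-1` F k).
  by rewrite -preimage_bigcup -FT preimage_setT.
move=> k; have [mF Fk] := Ffin k; split.
  by rewrite -[X in measurable X]setTI; exact: measurable_rV_uncons.
rewrite /rV_prod /pushforward -comp_preimage.
by rewrite (_ : rV_uncons \o rV_cons = id)//; apply/funext => p; exact: rV_consK.
Qed.

HB.instance Definition _ := Measure_isSigmaFinite.Build _ _ _
  rV_prod rV_prod_sigma_finite.

End RowCons.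

Fixpoint lebesgue_rV (R : realType) (n : nat) :
    {sigma_finite_measure set 'rV[R]_n -> \bar R} :=
  match n with
  | 0 => dirac (0 : 'rV[R]_0)
  | m.+1 => rV_prod (lebesgue_rV R m)
  end.

Definition mi_size (d : nat) (a : 'I_d -> nat) : nat := (\sum_(i < d) a i)%N.

Definition basis_vec (R : realType) (d : nat) (i : 'I_d) : 'rV[R]_d :=
  delta_mx ord0 i.

Definition mi_of (d k : nat) (a : {ffun 'I_d -> 'I_k.+1}) : 'I_d -> nat :=
  fun i => a i.

(* [iter_partial D a f] is d_1^(a_1) (... (d_d^(a_d) f)), where d_i is [D e_i]. *)
Definition iter_partial (R : realType) (d : nat) (X : Type)
    (D : 'rV[R]_d -> (X -> R) -> X -> R) (a : 'I_d -> nat) (f : X -> R) : X -> R :=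
  foldr (fun i g => iter (a i) (D (basis_vec R i)) g) f (enum 'I_d).

Section EuclideanDistributions.
Context {R : realType} {d : nat}.
Implicit Types (u v f : 'rV[R]_d -> R) (a : 'I_d -> nat).

Fixpoint Ck_rV (k : nat) f : Prop :=
  continuous f /\
  if k is k'.+1 then forall i : 'I_d,
    (forall x, derivable f x (basis_vec R i)) /\
    Ck_rV k' (fun x => 'D_(basis_vec R i) f x)
  else True.

Definition test_function f :=
  (forall k, Ck_rV k f) /\ compact (closure [set x | f x != 0]).

Definition D_rV a f : 'rV[R]_d -> R := iter_partial (fun t g x => 'D_t g x) a f.

Definition locally_integrable_rV u := measurable_fun [set: 'rV[R]_d] u /\
  forall K : set 'rV[R]_d, compact K ->
    (\int[lebesgue_rV R d]_(x in K) `|u x|%:E < +oo)%E.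

Definition distr_deriv_rV a u v :=
  [/\ locally_integrable_rV u, locally_integrable_rV v &
    forall psi, test_function psi ->
      \int[lebesgue_rV R d]_x (v x * psi x) =
      (-1) ^+ mi_size a * \int[lebesgue_rV R d]_x (u x * D_rV a psi x)].

End EuclideanDistributions.

Section SmoothFunctions.
Context {R : realType} {d : nat} {L0 : deloneSet R d}.
Local Notation Omega := (pattern_space L0).
Implicit Types (f : Omega -> R) (t : 'rV[R]_d) (a : 'I_d -> nat).

Definition diff_quot t f (L : Omega) (s : R) : R := (f (phi (s *: t) L) - f L) / s.

Definition differentiable_hull f :=
  forall (L : Omega) t, cvg (diff_quot t f L s @[s --> 0^']).

Definition dir_deriv t f (L : Omega) : R := lim (diff_quot t f L s @[s --> 0^']).

Definition D_hull a f : Omega -> R := iter_partial dir_deriv a f.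

Fixpoint Ck_hull (k : nat) f : Prop :=
  continuous f /\
  if k is k'.+1 then
    differentiable_hull f /\ forall t, Ck_hull k' (dir_deriv t f)
  else True.

Definition smooth f := forall k, Ck_hull k f.

Definition transversally_locally_constant f :=
  continuous f /\ forall L : Omega, exists2 e : R, 0 < e & forall L' : Omega,
    eball 0 e^-1 `&` val L' = eball 0 e^-1 `&` val L -> f L' = f L.

Definition smooth_tlc : set (Omega -> R) :=
  [set f | smooth f /\ transversally_locally_constant f].

End SmoothFunctions.

(* Elements of L^2 and of the Sobolev spaces are represented by functions;
   equality in these spaces is equality [mu]-almost everywhere. *)
Section Sobolev.
Context {R : realType} {d : nat} {L0 : deloneSet R d}.
Local Notation Omega := (pattern_space L0).
Variable mu : probability Omega R.
Implicit Types (f g : Omega -> R) (a : 'I_d -> nat) (k : nat).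

Definition L2 : set (Omega -> R) := [set f | f \in Lfun mu 2%:E].

Definition L2norm f : R := fine ('N[mu]_2%:E[EFin \o f])%E.

Definition ae_null : set (Omega -> R) :=
  [set f : Omega -> R | measurable_fun [set: Omega] f /\ {ae mu, forall L, f L = 0}].

Definition distr_deriv a f g := forall psi : Omega -> R, smooth psi ->
  (-1) ^+ mi_size a * \int[mu]_L (f L * D_hull a psi L) = \int[mu]_L (g L * psi L).

Definition sobolev k : set (Omega -> R) := [set f | L2 f /\
  forall a, (mi_size a <= k)%N -> exists2 g, L2 g & distr_deriv a f g].

(* Under finite local complexity any two choices agree [mu]-a.e., as smooth
   functions are then dense in L^2. *)
Definition weakD a f : Omega -> R :=
  xget (cst 0) [set g | L2 g /\ distr_deriv a f g].

Definition sobolev_norm k f : R := Num.sqrt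
  (\sum_(a : {ffun 'I_d -> 'I_k.+1} | (mi_size (mi_of a) <= k)%N)
     L2norm (weakD (mi_of a) f) ^+ 2).

End Sobolev.

Section Hilbert.
Context {R : realType} {V : lmodType R}.
Implicit Types (W Z : set V) (N : V -> R).

Definition subspace_of W := W 0 /\ forall (c : R) f g, W f -> W g -> W (c *: f + g).

Definition norm_complete W N := forall u : nat -> V, (forall n, W (u n)) ->
  (forall e : R, 0 < e -> exists n0 : nat, forall m n : nat,
     (n0 <= m)%N -> (n0 <= n)%N -> N (u m - u n) < e) ->
  exists2 l, W l & N (u n - l) @[n --> \oo] --> (0 : R).

(* The quotient [W / Z] is a Hilbert space for the norm induced by [N];
   [ip f f = 0 <-> Z f] makes [ip] descend to it, by Cauchy-Schwarz. *)
Definition hilbert_quotient W Z N :=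
  [/\ subspace_of W, subspace_of Z /\ Z `<=` W,
    exists ip : V -> V -> R,
      [/\ forall f g, W f -> W g -> ip f g = ip g f,
          forall (c : R) f g h, W f -> W g -> W h ->
            ip (c *: f + g) h = c * ip f h + ip g h,
          forall f, W f -> 0 <= ip f f,
          forall f, W f -> ip f f = 0 <-> Z f &
          forall f, W f -> N f = Num.sqrt (ip f f)] &
    norm_complete W N].

End Hilbert.

(* Main.v *)
Require Import Defs.
From mathcomp Require Import all_boot all_order all_algebra.
From mathcomp Require Import all_classical all_reals all_analysis.
From mathcomp Require Import measurable_realfun lra ring.

(** All the analysis takes place along the orbits, and its tool is convolution: for a
    weight [chi] on [R^d], [orbit_conv chi f A] is the integral of
    [f (phi x A) * chi x] over [x]. Three facts about it carry the proof.

    It smooths. A bounded Borel function whose value at a pattern only depends on the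
    points of the pattern in a fixed ball ([local_bounded]) need not be continuous. Its
    convolution with a smooth kernel of compact support nevertheless is smooth and
    transversally locally constant ([conv_smooth_tlc]): derivatives fall on the kernel
    ([conv_Dseq]), and transversally the function is constant anyway. The kernels are
    taken in an algebra generated by the functions [x ^- n * exp (- 1 / x)], whose
    closure under differentiation is visible ([flat_algebra_derive]).

    It has enough functions to act on. Local functions are dense in [L^2]
    ([local_bounded_dense]). By the pi-lambda theorem it suffices to approximate the
    indicator of an open set [U], and [U] is the increasing union of its parts that are
    determined by the points in larger and larger balls. These parts are open
    ([open_local_part]) because the pattern space is compact
    ([pattern_space_compact]), a consequence of finite local complexity.

    It is compatible with weak derivatives. By invariance of the measure, convolution
    is bounded on [L^2] ([conv_young]), mollifiers converge strongly to the identity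
    ([conv_eta_cvg]), and convolution commutes with weak derivatives
    ([conv_distr_deriv]). Moreover a derivative of the convolution is the convolution
    with the derivative of the kernel ([kernel_weak_deriv]), first for local functions
    and then by density, as weak derivatives are closed ([distr_deriv_closed]).

    The three parts of the theorem follow. Smooth functions are dense in [L^2], so weak
    derivatives are unique; as they are closed, Sobolev spaces inherit completeness from
    [L^2] ([sobolev_hilbert]). To approximate [f] together with its derivatives, mollify
    [f], and then replace [f] under the convolution by a local function
    ([sobolev_dense]). If [f] vanishes on an open set, then so does, slightly inside,
    the mollified derivative, being a convolution of [f] with a derivative of the
    mollifier ([weakD_local]). Finally, integration by parts along an orbit is clear for
    smooth functions; a fast sequence of smooth functions that converges to [f] in the
    Sobolev norm converges with its derivatives locally in mean on almost every orbit,
    by Fubini and invariance, so that the identity passes to the limit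
    ([orbit_distr_deriv]). *)

Set Implicit Arguments.
Unset Strict Implicit.
Unset Printing Implicit Defensive.
Import Order.TTheory GRing.Theory Num.Theory.
Import numFieldNormedType.Exports.

Local Open Scope classical_set_scope.
Local Open Scope ring_scope.

(** * Real integrals and square-integrable functions *)

Section RealIntegrals.
Context {dT : measure_display} {T : measurableType dT} {R : realType}.
Variable m : {measure set T -> \bar R}.
Implicit Types f g h : T -> R.

Definition Rintegrable f := m.-integrable [set: T] (EFin \o f).

Lemma Rintegrable_meas f : Rintegrable f -> measurable_fun setT f.
Proof. by move=> /integrableP[/measurable_EFinP]. Qed.

Lemma Rintegrable_le f g : measurable_fun setT f ->
  (forall x, `|f x| <= `|g x|) -> Rintegrable g -> Rintegrable f.
Proof.
move=> mf fg ig; apply: le_integrable ig => //; first exact/measurable_EFinP.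
by move=> x _; rewrite lee_fin; exact: fg.
Qed.

Lemma RintegrableD f g : Rintegrable f -> Rintegrable g ->
  Rintegrable (fun x => f x + g x).
Proof. by move=> intf intg; apply: eq_integrable (integrableD measurableT intf intg). Qed.

Lemma RintegrableZ c f : Rintegrable f -> Rintegrable (fun x => c * f x).
Proof. by move=> intf; apply: eq_integrable (integrableZl measurableT c intf). Qed.

Lemma RintegrableN f : Rintegrable f -> Rintegrable (fun x => - f x).
Proof.
move=> /(RintegrableZ (-1)); congr Rintegrable.
by apply/funext => x; rewrite mulN1r.
Qed.

Lemma RintegrableB f g : Rintegrable f -> Rintegrable g ->
  Rintegrable (fun x => f x - g x).
Proof. by move=> ? /RintegrableN; exact: RintegrableD. Qed.

Lemma Rintegrable0 : Rintegrable (fun=> 0).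
Proof. exact: integrable0. Qed.

Lemma norm_indic_le1 (U : set T) x : `|\1_U x : R| <= 1.
Proof. by rewrite indicE; case: (_ \in _); rewrite ?normr1 ?normr0. Qed.

Lemma Rintegrable_abs f : Rintegrable f -> Rintegrable (fun x => `|f x|).
Proof. exact: integrable_norm. Qed.

Lemma Rint_cst0 : \int[m]_x (0 : R) = 0.
Proof. by rewrite /Rintegral integral0. Qed.

Lemma RintD f g : Rintegrable f -> Rintegrable g ->
  \int[m]_x (f x + g x) = \int[m]_x f x + \int[m]_x g x.
Proof. by move=> ? ?; rewrite RintegralD. Qed.

Lemma RintB f g : Rintegrable f -> Rintegrable g ->
  \int[m]_x (f x - g x) = \int[m]_x f x - \int[m]_x g x.
Proof. by move=> ? ?; rewrite RintegralB. Qed.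

Lemma RintZ c f : Rintegrable f -> \int[m]_x (c * f x) = c * \int[m]_x f x.
Proof. by move=> ?; rewrite RintegralZl. Qed.

Lemma RintN f : Rintegrable f -> \int[m]_x (- f x) = - \int[m]_x f x.
Proof.
by move=> intf; under eq_Rintegral do rewrite -mulN1r; rewrite RintZ// mulN1r.
Qed.

Lemma eq_Rint f g : f =1 g -> \int[m]_x f x = \int[m]_x g x.
Proof. by move=> /funext ->. Qed.

Lemma Rint_ge0 f : (forall x, 0 <= f x) -> 0 <= \int[m]_x f x.
Proof. by move=> f0; apply: Rintegral_ge0. Qed.

Lemma Rint_le f g : Rintegrable f -> Rintegrable g -> (forall x, f x <= g x) ->
  \int[m]_x f x <= \int[m]_x g x.
Proof. by move=> ? ? fg; apply: le_Rintegral. Qed.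

Lemma Rint_abs f : Rintegrable f -> `|\int[m]_x f x| <= \int[m]_x `|f x|.
Proof. by move=> ?; apply: le_normr_Rintegral. Qed.

Lemma Rint_EFin f : Rintegrable f -> (\int[m]_x (f x)%:E)%E = (\int[m]_x f x)%:E.
Proof. by move=> intf; rewrite /Rintegral fineK//; apply: integrable_fin_num. Qed.

Lemma Rint_ae_eq f g : measurable_fun setT f -> measurable_fun setT g ->
  {ae m, forall x, f x = g x} -> \int[m]_x f x = \int[m]_x g x.
Proof.
move=> mf mg fg; rewrite /Rintegral; congr fine; apply: ae_eq_integral => //.
- exact/measurable_EFinP.
- exact/measurable_EFinP.
- by apply: filterS fg => x /= -> _.
Qed.

Lemma Rintegrable_ae_eq f g : measurable_fun setT g ->
  {ae m, forall x, f x = g x} -> Rintegrable f -> Rintegrable g.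
Proof.
move=> mg fg /[dup] intf /integrableP[mf foo]; apply/integrableP; split.
  exact/measurable_EFinP.
rewrite (_ : (\int[m]_x _)%E = (\int[m]_x `|(EFin \o f) x|)%E)//.
apply: ae_eq_integral => //.
- by apply: measurableT_comp => //; exact/measurable_EFinP.
- exact: measurableT_comp.
- by apply: filterS fg => x /= -> _.
Qed.

Lemma Rint_eq0_ae f : Rintegrable f -> (forall x, 0 <= f x) ->
  \int[m]_x f x = 0 -> {ae m, forall x, f x = 0}.
Proof.
move=> intf f0 f00.
have /(ae_eq_integral_abs m measurableT) : measurable_fun setT (EFin \o f).
  exact/measurable_EFinP/Rintegrable_meas.
case=> + _.
have -> : (\int[m]_x `|(EFin \o f) x|)%E = (\int[m]_x (f x)%:E)%E.
  by apply: eq_integral => x _ /=; rewrite ger0_norm.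
rewrite Rint_EFin// f00 => /(_ erefl).
by apply: filterS => x /= /(_ I)[].
Qed.

Lemma Rintegrable_fin f : measurable_fun setT f ->
  (\int[m]_x `|(f x)%:E| < +oo)%E -> Rintegrable f.
Proof. by move=> mf foo; apply/integrableP; split => //; exact/measurable_EFinP. Qed.

Lemma Rint_ae_le f g : Rintegrable f -> Rintegrable g ->
  {ae m, forall x, f x <= g x} -> \int[m]_x f x <= \int[m]_x g x.
Proof.
move=> intf intg fg; have mf := Rintegrable_meas intf; have mg := Rintegrable_meas intg.
have mM : measurable_fun setT (fun x => Num.max (f x) (g x)) by exact: measurable_maxr.
have gM : {ae m, forall x, g x = Num.max (f x) (g x)}.
  by apply: filterS fg => x fgx; rewrite max_r.
rewrite (Rint_ae_eq mg mM gM); apply: Rint_le => //; last by move=> x; rewrite le_max lexx.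
exact: Rintegrable_ae_eq gM intg.
Qed.

Lemma Rintegrable_ae_le f g : measurable_fun setT f ->
  {ae m, forall x, `|f x| <= g x} -> Rintegrable g -> Rintegrable f.
Proof.
move=> mf fg intg; have mg := Rintegrable_meas intg.
have mM : measurable_fun setT (fun x => Num.max `|f x| (g x)).
  by apply: measurable_maxr => //; exact: measurableT_comp.
have gM : {ae m, forall x, g x = Num.max `|f x| (g x)}.
  by apply: filterS fg => x fgx; rewrite max_r.
apply: Rintegrable_le (Rintegrable_ae_eq mM gM intg) => // x.
by rewrite (le_trans _ (ler_norm _))// le_max lexx.
Qed.

Lemma Rint_dominated_cvg (u : nat -> T -> R) f g :
  (forall n, measurable_fun setT (u n)) -> Rintegrable g ->
  (forall n x, `|u n x| <= g x) -> (forall x, u n x @[n --> \oo] --> f x) ->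
  Rintegrable f /\ \int[m]_x u n x @[n --> \oo] --> \int[m]_x f x.
Proof.
move=> mu ig ug uf.
have mf : measurable_fun setT f.
  by apply: (@measurable_fun_cvg _ _ _ setT u f) => // x _; exact: uf.
have [] := @dominated_convergence _ T R m setT measurableT
   (fun n => EFin \o u n) (EFin \o f) (EFin \o g).
- by move=> n; exact/measurable_EFinP.
- exact/measurable_EFinP.
- by apply: aeW => x _; apply: cvg_EFin; [exact: nearW|exact: uf].
- exact: ig.
- by apply: aeW => x n _; rewrite lee_fin; exact: ug.
move=> intf _ cv; split => //.
have intu n : Rintegrable (u n).
  by apply: Rintegrable_le ig => // x; rewrite (le_trans (ug n x))// ler_norm.
apply: fine_cvg; rewrite -/(Rintegral _ _ _) -Rint_EFin//.
Qed.

End RealIntegrals.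

Lemma discriminant_le (R : realType) (A B C : R) : 0 <= A -> 0 <= C ->
  (forall a b, 0 <= a ^+ 2 * A - 2 * a * b * B + b ^+ 2 * C) -> B ^+ 2 <= A * C.
Proof.
move=> A0 C0 quad.
(* for [A = 0] the form is affine in [a], hence not bounded below unless [B = 0] *)
have [A00|A_neq0] := eqVneq A 0; last first.
  have Ap : 0 < A by rewrite lt_def A_neq0.
  rewrite -(ler_pM2l Ap) -subr_ge0.
  by have := quad B A; congr (_ <= _); ring.
have [->|B0] := eqVneq B 0; first by rewrite expr0n mulr_ge0.
have := quad ((C + 1) / B) 1; rewrite A00.
rewrite (_ : _ + _ = - 2 * (C + 1) + C); last by field.
by move: C0; lra.
Qed.

Section SquareIntegrable.
Context {dT : measure_display} {T : measurableType dT} {R : realType}.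
Variable m : {measure set T -> \bar R}.
Implicit Types f g h : T -> R.

Definition sq_integrable f :=
  measurable_fun setT f /\ Rintegrable m (fun x => f x ^+ 2).

Definition norm2 f : R := Num.sqrt (\int[m]_x (f x ^+ 2)).

Lemma measurable_funX2 f : measurable_fun setT f ->
  measurable_fun setT (fun x => f x ^+ 2).
Proof. exact: measurable_funX. Qed.

Lemma sq_integrableM f g : sq_integrable f -> sq_integrable g ->
  Rintegrable m (fun x => f x * g x).
Proof.
move=> [mf if2] [mg ig2]; apply: Rintegrable_le (RintegrableD if2 ig2) => [|x].
  exact: measurable_funM.
rewrite normrM [leRHS]ger0_norm ?addr_ge0 ?sqr_ge0//.
rewrite -[f x ^+ 2]real_normK ?num_real// -[g x ^+ 2]real_normK ?num_real//.
have := normr_ge0 (f x); have := normr_ge0 (g x).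
move: `|f x| `|g x| => a b b0 a0; nra.
Qed.

Lemma sq_integrableD f g : sq_integrable f -> sq_integrable g ->
  sq_integrable (fun x => f x + g x).
Proof.
move=> sf sg; have fg := sq_integrableM sf sg; move: sf sg => [mf if2] [mg ig2].
split; first exact: measurable_funD.
have := RintegrableD (RintegrableD if2 (RintegrableZ 2 fg)) ig2.
by congr Rintegrable; apply/funext => x; ring.
Qed.

Lemma sq_integrableZ c f : sq_integrable f -> sq_integrable (fun x => c * f x).
Proof.
move=> [mf if2]; split; first exact: measurable_funM.
have := RintegrableZ (c ^+ 2) if2.
by congr Rintegrable; apply/funext => x; ring.
Qed.

Lemma sq_integrableN f : sq_integrable f -> sq_integrable (fun x => - f x).
Proof.
move=> /(sq_integrableZ (-1)); congr sq_integrable.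
by apply/funext => x; ring.
Qed.

Lemma sq_integrableB f g : sq_integrable f -> sq_integrable g ->
  sq_integrable (fun x => f x - g x).
Proof. by move=> ? /sq_integrableN; exact: sq_integrableD. Qed.

Lemma sq_integrable0 : sq_integrable (fun=> 0).
Proof.
split; first exact: measurable_cst.
by have := Rintegrable0 m; congr Rintegrable; apply/funext => x; ring.
Qed.

Lemma sq_integrable_abs f : sq_integrable f -> sq_integrable (fun x => `|f x|).
Proof.
move=> [mf if2]; split; first exact: measurableT_comp.
by have := if2; congr Rintegrable; apply/funext => x; rewrite real_normK ?num_real.
Qed.

Lemma sq_integrable_ae_eq f g : measurable_fun setT g ->
  {ae m, forall x, f x = g x} -> sq_integrable f -> sq_integrable g.
Proof.
move=> mg fg [mf if2]; split => //; apply: Rintegrable_ae_eq if2.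
  exact: measurable_funX2.
by apply: filterS fg => x ->.
Qed.

Lemma norm2_ge0 f : 0 <= norm2 f. Proof. exact: sqrtr_ge0. Qed.

Lemma norm2_sqr f : norm2 f ^+ 2 = \int[m]_x (f x ^+ 2).
Proof. by rewrite sqr_sqrtr// Rint_ge0// => x; exact: sqr_ge0. Qed.

Lemma Rint_cauchy_schwarz f g : sq_integrable f -> sq_integrable g ->
  (\int[m]_x (f x * g x)) ^+ 2 <= \int[m]_x (f x ^+ 2) * \int[m]_x (g x ^+ 2).
Proof.
move=> sf sg; have fg := sq_integrableM sf sg.
have [mf if2] := sf; have [mg ig2] := sg.
have quad (a b : R) : 0 <= a ^+ 2 * \int[m]_x (f x ^+ 2)
    - 2 * a * b * \int[m]_x (f x * g x) + b ^+ 2 * \int[m]_x (g x ^+ 2).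
  have := @Rint_ge0 _ _ _ m (fun x => (a * f x - b * g x) ^+ 2) (fun x => sqr_ge0 _).
  rewrite (_ : (fun x => _) = fun x => (a ^+ 2 * f x ^+ 2 - 2 * a * b * (f x * g x))
      + b ^+ 2 * g x ^+ 2); last by apply/funext => x; ring.
  rewrite RintD; [|by apply: RintegrableB; exact: RintegrableZ|exact: RintegrableZ].
  by rewrite RintB ?RintZ//; exact: RintegrableZ.
have := @Rint_ge0 _ _ _ m (fun x => f x ^+ 2) (fun x => sqr_ge0 _).
have := @Rint_ge0 _ _ _ m (fun x => g x ^+ 2) (fun x => sqr_ge0 _).
by move=> A0 C0; apply: discriminant_le.
Qed.

(** The Cauchy-Schwarz inequality for a measure with density [w]. *)
Lemma Rint_weighted_sqr (u w : T -> R) : (forall x, 0 <= w x) -> Rintegrable m w ->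
  Rintegrable m (fun x => u x * w x) -> Rintegrable m (fun x => u x ^+ 2 * w x) ->
  (\int[m]_x (u x * w x)) ^+ 2 <= \int[m]_x w x * \int[m]_x (u x ^+ 2 * w x).
Proof.
move=> w0 iw iuw iu2w; apply: discriminant_le.
- exact: Rint_ge0.
- by apply: Rint_ge0 => x; rewrite mulr_ge0// sqr_ge0.
move=> a b.
have := @Rint_ge0 _ _ _ m (fun x => (b * u x - a) ^+ 2 * w x)
  (fun x => mulr_ge0 (sqr_ge0 _) (w0 x)).
rewrite (_ : (fun x => _) = fun x => (a ^+ 2 * w x - 2 * a * b * (u x * w x))
    + b ^+ 2 * (u x ^+ 2 * w x)); last by apply/funext => x; ring.
rewrite RintD; [|by apply: RintegrableB; exact: RintegrableZ|exact: RintegrableZ].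
by rewrite RintB ?RintZ//; exact: RintegrableZ.
Qed.

Lemma norm2_cauchy_schwarz f g : sq_integrable f -> sq_integrable g ->
  `|\int[m]_x (f x * g x)| <= norm2 f * norm2 g.
Proof.
move=> sf sg; rewrite -ler_sqr ?nnegrE ?mulr_ge0 ?norm2_ge0//.
by rewrite exprMn !norm2_sqr real_normK ?num_real// Rint_cauchy_schwarz.
Qed.

Lemma ler_norm2D f g : sq_integrable f -> sq_integrable g ->
  norm2 (fun x => f x + g x) <= norm2 f + norm2 g.
Proof.
move=> sf sg; rewrite -ler_sqr ?nnegrE ?addr_ge0 ?norm2_ge0//.
have fg := sq_integrableM sf sg.
rewrite sqrrD !norm2_sqr.
rewrite (_ : (fun x => _) = fun x => (f x ^+ 2 + 2 * (f x * g x)) + g x ^+ 2);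
  last by apply/funext => x; ring.
have [_ if2] := sf; have [_ ig2] := sg.
rewrite RintD ?RintD ?RintZ//; [|exact: RintegrableZ
  |by apply: RintegrableD => //; exact: RintegrableZ].
rewrite lerD2r lerD2l -[leRHS]mulr_natl ler_pM2l//.
exact: le_trans (ler_norm _) (norm2_cauchy_schwarz sf sg).
Qed.

Lemma norm2N f : norm2 (fun x => - f x) = norm2 f.
Proof. by rewrite /norm2; congr Num.sqrt; apply: eq_Rint => x; rewrite sqrrN. Qed.

Lemma norm2Z c f : sq_integrable f -> norm2 (fun x => c * f x) = `|c| * norm2 f.
Proof.
move=> [_ if2]; rewrite /norm2 -sqrtr_sqr -sqrtrM ?sqr_ge0//; congr Num.sqrt.
by rewrite -RintZ//; apply: eq_Rint => x; rewrite exprMn.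
Qed.

Lemma norm2C f g : norm2 (fun x => f x - g x) = norm2 (fun x => g x - f x).
Proof. by rewrite -norm2N; congr norm2; apply/funext => x; rewrite opprB. Qed.

Lemma ler_norm2_add f g h : sq_integrable f -> sq_integrable g -> sq_integrable h ->
  norm2 (fun x => f x - h x) <=
  norm2 (fun x => f x - g x) + norm2 (fun x => g x - h x).
Proof.
move=> sf sg sh.
have := ler_norm2D (sq_integrableB sf sg) (sq_integrableB sg sh).
by congr (norm2 _ <= _); apply/funext => x; ring.
Qed.

Lemma norm2_ae_eq f g : measurable_fun setT f -> measurable_fun setT g ->
  {ae m, forall x, f x = g x} -> norm2 f = norm2 g.
Proof.
move=> mf mg fg; congr Num.sqrt; apply: Rint_ae_eq.
- exact: measurable_funX2.
- exact: measurable_funX2.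
- by apply: filterS fg => x ->.
Qed.

Lemma norm2_eq0_ae f : sq_integrable f -> norm2 f = 0 -> {ae m, forall x, f x = 0}.
Proof.
move=> [mf if2] f0.
have := @Rint_eq0_ae _ _ _ m (fun x => f x ^+ 2) if2 (fun x => sqr_ge0 _).
rewrite -norm2_sqr f0 expr0n => /(_ erefl).
by apply: filterS => x /eqP; rewrite sqrf_eq0 => /eqP.
Qed.

(** The sum of the series of the [F n] has a finite integral, hence is finite almost
    everywhere. *)
Lemma fast_cvg_ae (F : nat -> T -> R) :
  (forall n, measurable_fun setT (F n)) -> (forall n x, 0 <= F n x) ->
  (forall n, (\int[m]_x (F n x)%:E <= (2^-1 ^+ n)%:E)%E) ->
  {ae m, forall x, F n x @[n --> \oo] --> (0 : R)}.
Proof.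
move=> mF F0 Fle.
pose S x := (\sum_(0 <= n <oo) (F n x)%:E)%E.
have mS : measurable_fun setT S.
  apply: ge0_emeasurable_sum => //.
  - by move=> n x _ _; rewrite lee_fin.
  - by move=> n _; exact/measurable_EFinP.
have S0 x : (0 <= S x)%E by apply: nneseries_ge0 => n _ _; rewrite lee_fin.
have intS : m.-integrable setT S.
  apply/integrableP; split => //.
  under eq_integral => x _ do rewrite gee0_abs//.
  rewrite integral_nneseries//; [|by move=> n; exact/measurable_EFinP
    |by move=> n x _; rewrite lee_fin].
  apply: (@le_lt_trans _ _ (\sum_(0 <= n <oo) (2^-1 ^+ n)%:E)%E).
    apply: lee_nneseries => [n _ _|n _ //].
    by apply: integral_ge0 => x _; rewrite lee_fin.
  have -> : (\sum_(0 <= n <oo) (2^-1 ^+ n)%:E)%E = (2%:E : \bar R).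
    have := @cvg_geometric_series R 1 2^-1; rewrite ger0_norm//.
    move=> /(_ ltac:(by rewrite invf_lt1//; lra)).
    rewrite (_ : 1 - 2^-1 = 2^-1 :> R); last by lra.
    rewrite div1r invrK.
    move=> cv; apply/cvg_lim => //.
    rewrite (_ : (fun n => _) = EFin \o [series geometric 1 2^-1 n]_n).
      by apply: cvg_EFin; [exact: nearW|exact: cv].
    apply/funext => n; rewrite /= /series/= -sumEFin.
    by apply: eq_bigr => i _; rewrite /geometric/= mul1r.
  by rewrite ltry.
have := integrable_ae measurableT intS.
apply: filterS => x /(_ I) Sfin.
apply: cvg_series_cvg_0; apply: nondecreasing_is_cvgn.
  by apply/nondecreasing_seqP => n; rewrite /series/= big_nat_recr//= lerDl.
exists (fine (S x)) => _ [n _ <-]; rewrite -lee_fin fineK// /series/= -sumEFin.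
by apply: nneseries_lim_ge => i _ _; rewrite lee_fin.
Qed.

End SquareIntegrable.

(** * Completeness of the space of square-integrable functions *)

Section Completeness.
Context {dT : measure_display} {T : measurableType dT} {R : realType}.
Variable m : {measure set T -> \bar R}.
Implicit Types f g h : T -> R.
Local Notation norm2 := (norm2 m).
Local Notation sq_integrable := (sq_integrable m).

Lemma limn_einf_le (u : nat -> \bar R) c : (forall k, (u k <= c)%E) -> (limn_einf u <= c)%E.
Proof.
move=> uc; rewrite limn_einf_lim; apply: lime_le; first exact: is_cvg_einfs.
by apply: nearW => n; apply: le_trans (uc n); apply: ereal_inf_lbound; exists n => /=.
Qed.

(** Lower semicontinuity of the norm, a form of Fatou's lemma. *)
Lemma norm2_le_lim (v : nat -> T -> R) f (e : R) : 0 <= e ->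
  (forall k, sq_integrable (v k)) -> measurable_fun setT f ->
  (forall k, norm2 (v k) <= e) ->
  {ae m, forall x, v k x @[k --> \oo] --> f x} ->
  sq_integrable f /\ norm2 f <= e.
Proof.
move=> e0 sv mf ve vf.
have mv2 k : measurable_fun setT (fun x => (v k x ^+ 2)%:E).
  by apply/measurable_EFinP/measurable_funX2; case: (sv k).
have mf2 : measurable_fun setT (fun x => f x ^+ 2) by exact: measurable_funX2.
have fle : (\int[m]_x (f x ^+ 2)%:E <= (e ^+ 2)%:E)%E.
  rewrite (_ : (\int[m]_x _)%E =
      (\int[m]_x limn_einf (fun k => (v k x ^+ 2)%:E))%E); last first.
    apply: ae_eq_integral => //.
    - exact/measurable_EFinP.
    - by apply: measurableT_comp => //; apply: measurable_fun_limn_esup => k; apply: measurableT_comp.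
    - apply: filterS vf => x vx _.
      have cv : (v k x ^+ 2)%:E @[k --> \oo] --> (f x ^+ 2)%:E.
        by apply: cvg_EFin; [exact: nearW|rewrite expr2; exact: cvgM].
      by rewrite is_cvg_limn_einfE; [rewrite (cvg_lim _ cv)|apply/cvg_ex; eexists; exact: cv].
  apply: le_trans (fatou m measurableT mv2 _) _.
    by move=> k x _; rewrite lee_fin sqr_ge0.
  apply: limn_einf_le.
  move=> k; by rewrite Rint_EFin ?lee_fin -?norm2_sqr ?ler_sqr ?nnegrE ?norm2_ge0//; case: (sv k).
have if2 : Rintegrable m (fun x => f x ^+ 2).
  apply: Rintegrable_fin => //.
  under eq_integral => x _ do rewrite gee0_abs ?lee_fin ?sqr_ge0//.
  by apply: le_lt_trans fle _; rewrite ltry.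
split => //.
by rewrite -ler_sqr ?nnegrE ?norm2_ge0// norm2_sqr -lee_fin -Rint_EFin.
Qed.

(** The consecutive differences are dominated by a geometric sequence of
    ratio [1/2]. *)
Lemma geometric_cvg (v : nat -> R) :
  (fun k => 4 ^+ k * (v k.+1 - v k) ^+ 2) @ \oo --> (0 : R) ->
  cvgn v.
Proof.
move=> F0.
have [C [_ CF]] : bounded_fun (fun k => 4 ^+ k * (v k.+1 - v k) ^+ 2).
  by apply: cvg_seq_bounded; apply/cvg_ex; exists 0.
pose C1 := `|C| + 1.
have C10 : 0 < C1 by rewrite ltr_wpDl.
have dv k : `|v k.+1 - v k| <= (C1 + 1) * 2^-1 ^+ k.
  have p4 : (4 ^+ k : R) = (2 ^+ k) ^+ 2
    by rewrite -exprM mulnC exprM; congr (_ ^+ _); rewrite -natrX.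
  have p2 : 0 < (2 : R) ^+ k by rewrite exprn_gt0.
  have : 4 ^+ k * (v k.+1 - v k) ^+ 2 <= C1.
    apply: le_trans (ler_norm _) _; apply: CF => //.
    by rewrite /C1 (le_lt_trans (ler_norm C))// ltrDl.
  rewrite p4 -exprMn -[leLHS]real_normK ?num_real// normrM (gtr0_norm p2) => h.
  rewrite exprVn ler_pdivlMr// mulrC.
  have : 0 <= 2 ^+ k * `|v k.+1 - v k| by rewrite mulr_ge0// ltW.
  move: h; move: (2 ^+ k * _) => y h y0; nra.
have sc : cvgn (series (telescope v)).
  apply: normed_cvg; apply: (series_le_cvg _ _ dv).
  - by move=> k; exact: normr_ge0.
  - by move=> k; rewrite mulr_ge0 ?exprn_ge0 ?invr_ge0// ltW// addr_gt0.
  - apply: is_cvg_geometric_series; rewrite ger0_norm ?invr_ge0//.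
    by rewrite invf_lt1// ltr1n.
have -> : v = (series (telescope v) \+ cst (v 0%N)).
  by apply/funext => k; rewrite telescopeK/= subrK.
exact: is_cvgD sc (is_cvg_cst _).
Qed.

(** The Riesz-Fischer theorem: a subsequence with fast decreasing differences
    converges almost everywhere, and its limit is a limit in norm by Fatou's lemma. *)
Lemma sq_integrable_complete (u : nat -> T -> R) :
  (forall n, sq_integrable (u n)) ->
  (forall e : R, 0 < e -> exists n0 : nat, forall p q : nat, (n0 <= p)%N -> (n0 <= q)%N ->
     norm2 (fun x => u p x - u q x) < e) ->
  exists2 l, sq_integrable l & forall e : R, 0 < e -> exists n0 : nat, forall n : nat,
    (n0 <= n)%N -> norm2 (fun x => u n x - l x) <= e.
Proof.
move=> su cau.
have pos8 k : 0 < 8^-1 ^+ k :> R by rewrite exprn_gt0// invr_gt0.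
have [N NP] := choice (fun k => cau _ (pos8 k)).
(* [M k] is at least [k] and at least each rank [N i] with [i <= k] *)
pose M k := (k + \sum_(i < k.+1) N i)%N.
have MN k j : (k <= j)%N -> (N k <= M j)%N.
  move=> kj; rewrite /M (bigD1 (inord k))//= inordK ?ltnS//.
  by rewrite addnCA leq_addr.
have Mk k : (k <= M k)%N by exact: leq_addr.
pose v k := u (M k).
(* the integral of the square of the difference is at most [64 ^- k], which leaves
   room for the factor [4 ^+ k] *)
have vF : {ae m, forall x, 4 ^+ k * (v k.+1 x - v k x) ^+ 2 @[k --> \oo] --> (0 : R)}.
  apply: fast_cvg_ae.
  - move=> k; apply: measurable_funM => //; apply: measurable_funX2.
    by apply: measurable_funB; case: (su (M k)); case: (su (M k.+1)).
  - by move=> k x; rewrite mulr_ge0 ?sqr_ge0// exprn_ge0.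
  - move=> k.
    have sd : sq_integrable (fun x => v k.+1 x - v k x).
      exact: (sq_integrableB (su _) (su _)).
    rewrite Rint_EFin; last by apply: RintegrableZ; case: sd.
    rewrite lee_fin RintZ; last by case: sd.
    rewrite -norm2_sqr.
    have := NP k (M k.+1) (M k) (MN _ _ (leqnSn k)) (MN _ _ (leqnn k)).
    rewrite -/(v k) -/(v k.+1); have := norm2_ge0 m (fun x => v k.+1 x - v k x).
    move: (norm2 _) => y y0 y8.
    apply: (@le_trans _ _ (4 ^+ k * (8^-1 ^+ k))); last first.
      by rewrite -exprMn; apply: lerXn2r; rewrite ?nnegrE; lra.
    rewrite ler_pM2l ?exprn_gt0//.
    have : (8^-1 ^+ k <= 1 :> R) by rewrite exprn_ile1//; lra.
    nra.
pose l x := fine (limn_esup (fun k => (v k x)%:E)).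
have ml : measurable_fun setT l.
  apply: measurableT_comp; first exact: fine_measurable.
  apply: measurable_fun_limn_esup => k; apply/measurable_EFinP.
  by case: (su (M k)).
have vl : {ae m, forall x, v k x @[k --> \oo] --> l x}.
  apply: filterS vF => x /geometric_cvg /cvg_ex[y vy].
  have vyE : (v k x)%:E @[k --> \oo] --> y%:E by apply: cvg_EFin => //; exact: nearW.
  have [_ ly] := cvg_limn_einf_sup vyE.
  by rewrite /l ly.
have main n (e : R) (e0 : 0 < e) (n0 : nat) : (forall p q : nat, (n0 <= p)%N -> (n0 <= q)%N ->
     norm2 (fun x => u p x - u q x) < e) -> (n0 <= n)%N ->
  sq_integrable (fun x => u n x - l x) /\ norm2 (fun x => u n x - l x) <= e.
  move=> ne n0n.
  apply: (@norm2_le_lim (fun k x => u n x - v (k + n0)%N x)) => //.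
  - exact: ltW.
  - by move=> k; exact: (sq_integrableB (su _) (su _)).
  - by apply: measurable_funB => //; case: (su n).
  - by move=> k; apply/ltW/ne => //; rewrite (leq_trans _ (Mk _))// leq_addl.
  - apply: filterS vl => x vx; apply: cvgB; first exact: cvg_cst.
    by rewrite (cvg_shiftn n0 (v ^~ x)).
exists l; last by move=> e e0; have [n0 ne] := cau e e0; exists n0 => n /(main n e e0 n0 ne)[].
have [n0 ne] := cau 1 ltr01.
have [/(sq_integrableB (su n0)) + _] := main n0 1 ltr01 n0 ne (leqnn _).
by congr sq_integrable; apply/funext => x; ring.
Qed.

(** The approximating functions [h] can be chosen in a sequence that converges
    almost everywhere. *)
Lemma norm2_approx_ae0 (Q : T -> Prop) w : sq_integrable w ->
  (forall e : R, 0 < e -> exists h, [/\ sq_integrable h, norm2 (fun x => h x - w x) <= e &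
     {ae m, forall x, Q x -> h x = 0}]) ->
  {ae m, forall x, Q x -> w x = 0}.
Proof.
move=> sw hw.
have pos8 k : 0 < 2^-1 ^+ k :> R by rewrite exprn_gt0// invr_gt0.
have [h hP] := choice (fun k => hw _ (pos8 k)).
have hQ : {ae m, forall x k, Q x -> h k x = 0}.
  by apply: ae_foralln => k; case: (hP k).
have : {ae m, forall x, (h k x - w x) ^+ 2 @[k --> \oo] --> (0 : R)}.
  apply: fast_cvg_ae.
  - by move=> k; apply: measurable_funX2; case: (sq_integrableB (let: And3 sh _ _ := hP k in sh) sw).
  - by move=> k x; exact: sqr_ge0.
  - move=> k; have [sh he _] := hP k; have [_ id2] := sq_integrableB sh sw.
    rewrite Rint_EFin// lee_fin -norm2_sqr.
    have := norm2_ge0 m (fun x => h k x - w x).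
    have : (2^-1 ^+ k <= 1 :> R) by rewrite exprn_ile1//; lra.
    have := pos8 k; move: he; move: (norm2 _) (2^-1 ^+ k) => y p; nra.
apply: filterS2 hQ => x hx cv Qx; apply/eqP; rewrite -sqrf_eq0; apply/eqP.
have cw : (h k x - w x) ^+ 2 @[k --> \oo] --> w x ^+ 2.
  rewrite (_ : (fun k => _) = fun=> w x ^+ 2); first exact: cvg_cst.
  by apply/funext => k; rewrite hx// sub0r sqrrN.
by rewrite -(cvg_lim _ cw)// (cvg_lim _ cv).
Qed.

End Completeness.

(** * Measure-preserving maps and Lebesgue measure *)

Section MeasurePreserving.
Context {dT : measure_display} {T : measurableType dT} {R : realType}.
Variables (m : {measure set T -> \bar R}) (tau : T -> T).

Definition measure_preserving :=
  measurable_fun setT tau /\ forall A, measurable A -> m (tau @^-1` A) = m A.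

Hypothesis tauP : measure_preserving.

Lemma measure_preserving_integral (f : T -> \bar R) : measurable_fun setT f ->
  (forall x, (0 <= f x)%E) -> (\int[m]_x f (tau x) = \int[m]_x f x)%E.
Proof.
move=> mf f0; have [mtau mA] := tauP.
have := @ge0_integral_pushforward _ _ T T R tau mtau m setT f measurableT mf
  (fun y _ => f0 y).
rewrite preimage_setT => <-.
pose mt : {measure set T -> \bar R} := pushforward m tau.
by apply: (@eq_measure_integral _ _ _ setT m (mt mtau) f) => A mA' _; exact: mA.
Qed.

Lemma measure_preserving_Rintegrable (f : T -> R) : Rintegrable m f ->
  Rintegrable m (f \o tau).
Proof.
move=> /[dup] /Rintegrable_meas mf /integrableP[_ foo].
have [mtau mA] := tauP.
apply: Rintegrable_fin; first exact: measurableT_comp.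
rewrite (measure_preserving_integral (f := fun x => `|(f x)%:E|%E))//.
by apply: measurableT_comp => //; exact/measurable_EFinP.
Qed.

Lemma measure_preserving_Rint (f : T -> R) : measurable_fun setT f ->
  \int[m]_x f (tau x) = \int[m]_x f x.
Proof.
move=> mf; rewrite /Rintegral; congr fine; rewrite [LHS]integralE [RHS]integralE.
have mfE : measurable_fun setT (EFin \o f) by exact/measurable_EFinP.
congr (_ - _)%E.
- have := measure_preserving_integral (measurable_funepos mfE) (fun=> funepos_ge0 _ _).
  by rewrite !unlock.
- have := measure_preserving_integral (measurable_funeneg mfE) (fun=> funeneg_ge0 _ _).
  by rewrite !unlock.
Qed.

End MeasurePreserving.

Section RowSpaceBorel.
Context {R : realType} {d : nat}.
Implicit Types (x y t : 'rV[R]_d).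

(** Rational boxes form a countable base of the topology and are measurable for the
    product sigma-algebra, which is therefore the Borel one. *)
Definition rat_ball (p : 'rV[rat]_d * nat) : set 'rV[R]_d :=
  [set x | forall i, `|x ord0 i - ratr (p.1 ord0 i)| < p.2.+1%:R^-1].

Lemma ball_rVP x y (e : R) : 0 < e -> ball x e y <-> forall i, `|x ord0 i - y ord0 i| < e.
Proof.
move=> e0; split => [xy i|xy]; first by case: xy => _; exact.
by split=> // i j; rewrite (ord1 i); exact: xy.
Qed.

Lemma measurable_rat_ball p : measurable (rat_ball p).
Proof.
rewrite (_ : rat_ball p = \bigcap_(i in [set: 'I_d])
   [set x | `|x ord0 i - ratr (p.1 ord0 i)| < p.2.+1%:R^-1]); last first.
  by apply/seteqP; split => [x px i _|x px i]; exact: px.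
apply: fin_bigcap_measurable => // i _.
rewrite -[X in measurable X]setTI.
have mf : measurable_fun setT (fun x : 'rV[R]_d => `|x ord0 i - ratr (p.1 ord0 i)|).
  apply: measurableT_comp => //; apply: measurable_funB => //.
  exact: measurable_coord.
by have := mf measurableT _ (measurable_itv `]-oo, p.2.+1%:R^-1[); rewrite set_itvE.
Qed.

Lemma rat_ball_base x (U : set 'rV[R]_d) : nbhs x U ->
  exists p, rat_ball p x /\ rat_ball p `<=` U.
Proof.
move=> /nbhs_ballP[e /= e0 xU].
pose n := Num.truncn (2 / e).
have ne : 2 * n.+1%:R^-1 < e.
  rewrite -ltr_pdivlMl// -[ltRHS]invrK ltf_pV2 ?posrE ?invr_gt0 ?divr_gt0 ?mulr_gt0//.
  by rewrite invfM invrK; exact: truncnS_gt.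
have n0 : 0 < n.+1%:R^-1 :> R by rewrite invr_gt0.
have /choice[q qP] : forall i, exists q : rat, `|x ord0 i - ratr q| < n.+1%:R^-1 :> R.
  move=> i; have [|q] := @rat_in_itvoo R (x ord0 i) (x ord0 i + n.+1%:R^-1).
    by rewrite ltrDl.
  rewrite in_itv/= => /andP[xq qx]; exists q; rewrite distrC gtr0_norm ?subr_gt0//.
  by rewrite ltrBlDl.
exists (\row_i q i, n); split => [i|y py].
  by rewrite mxE.
apply/xU/ball_rVP => // i; rewrite -(subrK (ratr (q i)) (x ord0 i)) -addrA.
rewrite (le_lt_trans (ler_normD _ _))// (lt_trans _ ne)// mulrDl mul1r.
rewrite ltrD//; have := py i; rewrite mxE distrC//.
Qed.

Lemma open_measurable_rV (U : set 'rV[R]_d) : open U -> measurable U.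
Proof.
move=> oU; rewrite (_ : U = \bigcup_(p in [set p | rat_ball p `<=` U]) rat_ball p).
  rewrite (_ : \bigcup_(p in _) _ = \bigcup_p (if pselect (rat_ball p `<=` U) then rat_ball p else set0)).
    apply: countable_bigcupT_measurable => // p.
    by case: pselect => pU //=; exact: measurable_rat_ball.
  apply/seteqP; split => x [p].
    by move=> pU px; exists p => //; case: pselect => ?.
  by move=> _; case: pselect => pU //= px; exists p.
apply/seteqP; split => [x Ux|x [p pU px]]; last exact: pU.
have [p [px pU]] := rat_ball_base (open_nbhs_nbhs (conj oU Ux)).
by exists p.
Qed.

End RowSpaceBorel.

Section Lebesgue.
Context {R : realType}.

Lemma lebesgue_measure_preserving (a : R) :
  measure_preserving (@lebesgue_measure R) (fun x : measurableTypeR R => (x + a)%R).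
Proof.
have mt : measurable_fun setT (fun x : measurableTypeR R => (x + a)%R : measurableTypeR R).
  exact: measurable_funD.
split=> // A mA.
pose mm : {measure set (measurableTypeR R) -> \bar R} :=
  pushforward (@lebesgue_measure R) (fun x : measurableTypeR R => (x + a)%R : measurableTypeR R).
apply/esym; apply: (@lebesgue_measure_unique R (mm mt)) => // X [[x y] /= xy <-].
rewrite /mm/= /pushforward.
rewrite (_ : _ @^-1` _ = `](x - a), (y - a)]%classic); last first.
  by apply/seteqP; split => z /=; rewrite !in_itv/= ltrBlDr lerBrDr.
rewrite !lebesgue_measure_itv/= !lte_fin ltrD2r.
by case: ifP => // _; rewrite -!EFinB; congr (_%:E); ring.
Qed.

Definition cube d (r : R) : set 'rV[R]_d := [set x | forall i, `|x ord0 i| < r].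

Lemma measurable_cube d r : measurable (@cube d r).
Proof.
rewrite (_ : cube r = \bigcap_(i in [set: 'I_d]) [set x | `|x ord0 i| < r]); last first.
  by apply/seteqP; split => [x px i _|x px i]; exact: px.
apply: fin_bigcap_measurable => // i _.
rewrite -[X in measurable X]setTI.
have mf : measurable_fun setT (fun x : 'rV[R]_d => `|x ord0 i|).
  by apply: measurableT_comp => //; exact: measurable_coord.
by have := mf measurableT _ (measurable_itv `]-oo, r[); rewrite set_itvE.
Qed.

Lemma lebesgue_rV_cube d r : 0 < r -> lebesgue_rV R d (cube r) = ((2 * r) ^+ d)%:E.
Proof.
move=> r0; elim: d => [|d IH].
  rewrite /= diracE (_ : 0 \in _) ?expr0//.
  by apply/mem_set => -[].
rewrite /= /rV_prod /pushforward.
rewrite (_ : _ @^-1` _ = `]-r, r[%classic `*` cube r); last first.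
  apply/seteqP; split => [p /= cp|p /= [p1 p2] i].
    split; last by move=> i; rewrite -[_ ord0 i]/(rV_coord i _) -coord_consS; exact: cp.
    rewrite /= in_itv/= -ltr_norml; have := cp ord0.
    by rewrite -[rV_cons p ord0 ord0]/(rV_coord ord0 _) coord_cons0.
  rewrite -[rV_cons p ord0 i]/(rV_coord i _).
  have [j ->|->] := unliftP ord0 i; first by rewrite coord_consS; exact: p2.
  by rewrite coord_cons0; move: p1; rewrite in_itv/= -ltr_norml.
rewrite product_measure1E//; last exact: measurable_cube.
rewrite IH exprS EFinM; congr (_ * _)%E.
rewrite -[LHS]/(lebesgue_measure _) lebesgue_measure_itv/= lte_fin ifT; last by lra.
by rewrite -EFinB; congr (_%:E); ring.
Qed.

(** One coordinate at a time, by Fubini. *)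
Lemma lebesgue_rV_preserving d (t : 'rV[R]_d) :
  measure_preserving (lebesgue_rV R d) (fun x => x + t).
Proof.
have mt n (s : 'rV[R]_n) : measurable_fun setT (fun x : 'rV[R]_n => x + s).
  apply: measurable_fun_rV => i.
  rewrite (_ : _ \o _ = fun x => rV_coord i x + rV_coord i s); last first.
    by apply/funext => x; rewrite /rV_coord /= mxE.
  by apply: measurable_funD => //; exact: measurable_coord.
split; first exact: mt.
elim: d t => [|d IH] t A mA.
  by congr (lebesgue_rV R 0 _); apply/seteqP; split => x /=; rewrite (thinmx0 (x + t)) (thinmx0 x).
pose t' : 'rV[R]_d := \row_j t ord0 (lift ord0 j).
pose B := rV_cons @^-1` A.
have mB : measurable B by rewrite -[B]setTI; exact: measurable_rV_cons.
have consD p : rV_cons p + t = rV_cons (p.1 + t ord0 ord0, p.2 + t').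
  apply/rowP => i; rewrite mxE -![_ ord0 i]/(rV_coord i _).
  have [j ->|->] := unliftP ord0 i; last by rewrite !coord_cons0.
  by rewrite !coord_consS /rV_coord !mxE.
rewrite /= /rV_prod /pushforward -/B.
transitivity (\int[lebesgue_measure]_x
    (fun z => lebesgue_rV R d (xsection B z)) ((x : measurableTypeR R) + t ord0 ord0)%R)%E.
  apply: eq_integral => x _ /=.
  rewrite -[RHS](IH t'); last exact: measurable_xsection.
  congr (lebesgue_rV R d _); apply/seteqP; split => y;
    by rewrite /xsection/= !inE /= consD.
apply: (measure_preserving_integral (lebesgue_measure_preserving _)) => //.
exact: measurable_fun_xsection.
Qed.

End Lebesgue.

Lemma open_preimage_measurable {dT} {T : measurableType dT} {R : realType} (f : T -> R) :
  (forall U, open U -> measurable (f @^-1` U)) -> measurable_fun setT f.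
Proof.
move=> fU mD; apply: (measurability _ (RGenOInfty.measurableE R)) => //.
move=> _ [_ [a ->] <-]; rewrite setTI; apply: fU.
by rewrite set_itvE; exact: open_gt.
Qed.

Section RowIntegrals.
Context {R : realType} {d : nat}.
Local Notation leb := (lebesgue_rV R d).
Implicit Types (x y t : 'rV[R]_d) (f g : 'rV[R]_d -> R).

Lemma continuous_measurable_rV f : continuous f -> measurable_fun setT f.
Proof.
move=> cf; apply: open_preimage_measurable => U oU; apply: open_measurable_rV.
by apply: open_comp => // x _; exact: cf.
Qed.

Lemma Rintegrable_cube r : 0 < r -> Rintegrable leb (\1_(cube r)).
Proof.
move=> r0; apply: Rintegrable_fin; first by apply: measurable_indic; exact: measurable_cube.
under eq_integral => x _ do rewrite gee0_abs ?lee_fin//.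
rewrite integral_indic//; last exact: measurable_cube.
by rewrite setIT (le_lt_trans _ (ltry ((2 * r) ^+ d)))// -(lebesgue_rV_cube d r0).
Qed.

Lemma Rintegrable_supported f r (M : R) : 0 < r -> measurable_fun setT f ->
  (forall x, ~ cube r x -> f x = 0) -> (forall x, `|f x| <= M) -> Rintegrable leb f.
Proof.
move=> r0 mf sf fM; apply: Rintegrable_le mf _ (RintegrableZ M (Rintegrable_cube r0)).
move=> x; rewrite indicE; case: (boolP (x \in _)) => [_|xr].
  by rewrite mulr1 (le_trans (fM x))// ler_norm.
by rewrite sf ?normr0 ?mulr0//; by move: xr; rewrite notin_setE.
Qed.

Lemma compact_cube (K : set 'rV[R]_d) : compact K ->
  exists2 r : R, 0 < r & K `<=` cube r.
Proof.
move=> /compact_bounded[M [_ KM]].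
exists (`|M| + 2); first by rewrite ltr_wpDl.
move=> x Kx i.
have : `|x| <= `|M| + 1.
  by apply: KM => //; rewrite (le_lt_trans (ler_norm M))// ltrDl.
rewrite [`|x|]mx_normrE => h.
apply: (@le_lt_trans _ _ (`|M| + 1)); last by lra.
apply: le_trans h.
by apply: (le_trans _ (le_bigmax _ _ (ord0, i))).
Qed.

Lemma cube_le r s : r <= s -> cube r `<=` @cube R d s.
Proof. by move=> rs x xr i; apply: lt_le_trans rs. Qed.

Lemma measurable_translate t : measurable_fun setT (fun x => x + t).
Proof. by have [] := @lebesgue_rV_preserving R d t. Qed.

End RowIntegrals.

(** * Smooth kernels of compact support *)

Section FlatExponential.
Context {R : realType}.
Implicit Types (n : nat) (x y : R).

(** The functions vanishing on the negative half-line and equal to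
    [x ^- n * exp (- 1 / x)] on the positive one: a family of smooth functions,
    flat at 0, that is closed under differentiation up to linear combinations. *)
Definition flat_exp n x : R := if 0 < x then x ^- n * expR (- x^-1) else 0.

Lemma flat_exp_ge0 n x : 0 <= flat_exp n x.
Proof.
rewrite /flat_exp; case: ifPn => // x0.
by rewrite mulr_ge0 ?expR_ge0// invr_ge0 exprn_ge0// ltW.
Qed.

Lemma flat_exp_gt0 n x : 0 < x -> 0 < flat_exp n x.
Proof.
by move=> x0; rewrite /flat_exp x0 mulr_gt0 ?expR_gt0// invr_gt0 exprn_gt0.
Qed.

Lemma flat_exp_le0 n x : x <= 0 -> flat_exp n x = 0.
Proof. by rewrite /flat_exp leNgt => /negbTE ->. Qed.

(** Bounds of this kind follow from [expR y >= y ^+ n.+1 / n.+1`!] at [y = x^-1]. *)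
Lemma flat_exp_le n x : flat_exp n x <= n.+1`!%:R * `|x|.
Proof.
rewrite /flat_exp; case: ifPn => [x0|_]; last by rewrite mulr_ge0.
have y0 : 0 < x^-1 by rewrite invr_gt0.
rewrite gtr0_norm// expRN -exprVn.
rewrite ler_pdivrMr ?expR_gt0//.
have := expR_ge1Dxn n (ltW y0).
move/(le_trans (ler_wpDl (@ler01 R) (lexx _))).
have f0 : 0 < n.+1`!%:R :> R by rewrite ltr0n fact_gt0.
rewrite ler_pdivrMr// exprS => h.
rewrite -(ler_pM2l y0) (le_trans h)// le_eqVlt; apply/orP; left; apply/eqP.
by field; rewrite gt_eqF.
Qed.

Lemma flat_exp_bounded n x : flat_exp n x <= n.+1`!%:R.
Proof.
have [x1|x1] := leP `|x| 1.
  by rewrite (le_trans (flat_exp_le n x))// ler_piMr.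
rewrite /flat_exp; case: ifPn => // x0.
rewrite (le_trans (_ : _ <= 1))//; last by rewrite ler1n fact_gt0.
rewrite -[leRHS]mulr1 ler_pM ?invr_ge0 ?exprn_ge0 ?expR_ge0 ?(ltW x0)//.
  rewrite gtr0_norm// in x1.
  by rewrite invf_le1 ?exprn_ege1 ?exprn_gt0// ltW.
by rewrite -[leRHS]expR0 ler_expR oppr_le0 invr_ge0 ltW.
Qed.

Definition flat_exp' n x : R := (- n%:R) * flat_exp n.+1 x + flat_exp n.+2 x.

Lemma is_derive_flat_exp n x : is_derive x 1 (flat_exp n) (flat_exp' n x).
Proof.
have [x0|x0|->] := ltgtP x 0.
- have -> : flat_exp' n x = 0 by rewrite /flat_exp' !flat_exp_le0 ?ltW//; ring.
  have near0 : {near x, cst 0 =1 flat_exp n}.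
    near=> y; rewrite flat_exp_le0//; apply/ltW.
    by near: y; exact: lt_nbhsl.
  apply: DeriveDef; first exact: near_eq_derivable near0 (@derivable_cst _ _ _ _ _ _).
  by rewrite -(near_eq_derive (1 : R) near0) derive_cst.
- have nearf : {near x, (fun y => y ^- n * expR (- y^-1)) =1 flat_exp n}.
    near=> y; rewrite /flat_exp ifT//.
    by near: y; apply: open_nbhs_nbhs; split => //; exact: open_gt.
  have xn0 : x != 0 by rewrite gt_eqF.
  have d1 : is_derive x 1 (fun y : R => y^-1) (- x ^- 2 *: 1) by apply: is_deriveV.
  have d2 : is_derive x 1 (fun y : R => expR (- y^-1)) (expR (- x^-1) * (- (- x ^- 2 *: 1))).
    exact: (is_derive1_comp (f := expR) (g := fun y => - y^-1)).
  have d3 : is_derive x 1 (fun y : R => (y^-1) ^+ n) ((n%:R * (x^-1) ^+ n.-1) *: (- x ^- 2 *: 1)).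
    have -> : (fun y : R => (y^-1) ^+ n) = (fun y : R => y^-1) ^+ n.
      elim: n {nearf} => [|k IH]; first by apply/funext => y; rewrite !expr0.
      by rewrite exprS -IH; apply/funext => y; rewrite exprS.
    exact: (is_deriveX n d1).
  have d4 : is_derive x 1 (fun y => y ^- n * expR (- y^-1)) (flat_exp' n x).
    have -> : (fun y : R => y ^- n * expR (- y^-1)) =
      (fun y => (y^-1) ^+ n) * (fun y => expR (- y^-1)).
      by apply/funext => y; rewrite -exprVn.
    apply: is_derive_eq (is_deriveM d3 d2) _.
    rewrite /flat_exp' /flat_exp x0 /GRing.scale/= mulr1.
    move: (expR _) => E; case: n {nearf d3} => [|n] /=.
      by field.
    by rewrite !exprVn !exprS; field; rewrite xn0 expf_neq0.
  apply: DeriveDef.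
    by apply: near_eq_derivable nearf _; case: d4.
  by rewrite -(near_eq_derive (1 : R) nearf); case: d4.
- have -> : flat_exp' n 0 = 0 by rewrite /flat_exp' !flat_exp_le0//; ring.
  have cv : h^-1 *: ((flat_exp n \o shift 0) (h *: 1) - flat_exp n 0) @[h --> 0^'] --> (0 : R).
    have bnd (h : R) : h != 0 ->
        `|h^-1 *: ((flat_exp n \o shift 0) (h *: 1) - flat_exp n 0)| <= n.+2`!%:R * `|h|.
      move=> h0; rewrite /= addr0 [h *: 1]mulr1 [flat_exp n 0]flat_exp_le0// subr0.
      have [hp|hn|/eqP] := ltgtP h 0; last by rewrite (negbTE h0).
        by rewrite (flat_exp_le0 _ (ltW hp)) scaler0 normr0 mulr_ge0.
      rewrite (_ : h^-1 *: _ = flat_exp n.+1 h).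
        by rewrite ger0_norm ?flat_exp_ge0// flat_exp_le.
      rewrite /flat_exp hn /GRing.scale/= exprS; field.
      by rewrite expf_neq0// gt_eqF.
    apply/cvgr0Pnorm_lt => e e0.
    have k0 : 0 < n.+2`!%:R :> R by rewrite ltr0n fact_gt0.
    near=> h.
    have h0 : h != 0 by near: h; exact: nbhs_dnbhs_neq.
    rewrite (le_lt_trans (bnd h h0))// -ltr_pdivlMl//.
    near: h; apply: dnbhs0_lt; by rewrite mulr_gt0// invr_gt0.
  apply: DeriveDef; first by apply/cvg_ex; exists 0.
  by apply/cvg_lim.
Unshelve. all: by end_near. Qed.

Lemma flat_exp'_bounded n x : `|flat_exp' n x| <= n%:R * n.+2`!%:R + n.+3`!%:R.
Proof.
rewrite (le_trans (ler_normD _ _))// normrM normrN !ger0_norm ?flat_exp_ge0//.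
by rewrite lerD ?flat_exp_bounded// ler_wpM2l ?flat_exp_bounded.
Qed.

Lemma bounded_derive_lipschitz (f f' : R -> R) M :
  (forall x, is_derive x 1 f (f' x)) -> (forall x, `|f' x| <= M) ->
  forall x y, `|f x - f y| <= M * `|x - y|.
Proof.
move=> df fM.
have cf : continuous f by move=> x; apply: differentiable_continuous; apply/derivable1_diffP; case: (df x).
have main x y : x < y -> `|f x - f y| <= M * `|x - y|.
  move=> xy; have [c _ E] := @MVT R f f' x y xy (fun x _ => df x) (continuous_subspaceT cf).
  by rewrite distrC E normrM distrC ler_wpM2r.
move=> x y; have [xy|xy|->] := ltgtP x y; first exact: main.
  by rewrite distrC [`|x - y|]distrC main.
by rewrite !subrr normr0 mulr0.
Qed.

End FlatExponential.

Section Kernels.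
Context {R : realType} {d : nat}.
Implicit Types (x t : 'rV[R]_d) (f g : 'rV[R]_d -> R).

Lemma is_derive_line f x t l :
  is_derive (0 : R) 1 (fun h => f (h *: t + x)) l -> is_derive x t f l.
Proof.
move=> [dl El]; have E : (fun h : R => h^-1 *: (((fun h => f (h *: t + x)) \o shift 0) (h *: 1)
     - f (0 *: t + x))) = (fun h => h^-1 *: ((f \o shift x) (h *: t) - f x)).
  by apply/funext => h; rewrite /= addr0 [h *: 1]mulr1 scale0r add0r.
apply: DeriveDef; first by move: dl; rewrite /derivable E.
by move: El; rewrite /derive E.
Qed.

(** The algebra of functions generated by the flat exponentials of the
    coordinates: it consists of smooth functions since it is closed under
    differentiation. *)
Inductive flat_algebra : ('rV[R]_d -> R) -> Prop :=
| flat_gen n c s i : flat_algebra (fun x => flat_exp n (c + s * x ord0 i))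
| flat_cst c : flat_algebra (fun=> c)
| flat_add f g : flat_algebra f -> flat_algebra g -> flat_algebra (fun x => f x + g x)
| flat_mul f g : flat_algebra f -> flat_algebra g -> flat_algebra (fun x => f x * g x).

Lemma flat_algebra_derive f t : flat_algebra f ->
  exists2 f', flat_algebra f' & forall x, is_derive x t f (f' x).
Proof.
elim=> {f} [n c s i|c|f g _ [f' af df] _ [g' ag dg]|f g af0 [f' af df] ag0 [g' ag dg]].
- exists (fun x => (s * t ord0 i) * (- n%:R * flat_exp n.+1 (c + s * x ord0 i)
       + flat_exp n.+2 (c + s * x ord0 i))).
    apply: (flat_mul (flat_cst _)); apply: flat_add; last exact: flat_gen.
    by apply: (flat_mul (flat_cst _)); exact: flat_gen.
  move=> x; apply: is_derive_line.
  have -> : (fun h : R => flat_exp n (c + s * (h *: t + x) ord0 i)) =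
      flat_exp n \o (fun h => h * (s * t ord0 i) + (c + s * x ord0 i)).
    by apply/funext => h /=; rewrite !mxE; congr flat_exp; ring.
  have dl : is_derive (0 : R) 1 (fun h => h * (s * t ord0 i) + (c + s * x ord0 i)) (s * t ord0 i).
    have -> : (fun h : R => h * (s * t ord0 i) + (c + s * x ord0 i)) =
      (s * t ord0 i) \*: (@id R) + cst (c + s * x ord0 i).
      by apply/funext => h /=; rewrite fctE/= mulrC.
    have := @is_deriveD _ _ _ _ (cst (c + s * x ord0 i)) (0 : R) 1 _ 0
      (is_deriveZ (s * t ord0 i) (is_derive_id (0 : R) 1)) (is_derive_cst _ _ _).
    by move/is_derive_eq; apply; rewrite addr0 [_ *: _]mulr1.
  have := is_derive1_comp (f := flat_exp n)
    (g := fun h => h * (s * t ord0 i) + (c + s * x ord0 i)) (is_derive_flat_exp n _) dl.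
  by move/is_derive_eq; apply; rewrite /flat_exp' mul0r add0r mulrC.
- exists (fun=> 0); first exact: flat_cst.
  by move=> x; exact: is_derive_cst.
- exists (fun x => f' x + g' x); first exact: flat_add.
  by move=> x; exact: is_deriveD.
- exists (fun x => f x * g' x + g x * f' x).
    by apply: flat_add; exact: flat_mul.
  by move=> x; exact: is_deriveM.
Qed.

Lemma normr_coord x i : `|x ord0 i| <= `|x|.
Proof. by rewrite [`|x|]mx_normrE; apply: (le_trans _ (le_bigmax _ _ (ord0, i))). Qed.

Lemma flat_algebra_lipschitz f : flat_algebra f -> exists2 M : R, 0 < M &
  (forall x, `|f x| <= M) /\ forall x y, `|f x - f y| <= M * `|x - y|.
Proof.
elim=> {f} [n c s i|c|f g _ [M M0 [fM lM]] _ [N N0 [gN lN]]|f g _ [M M0 [fM lM]] _ [N N0 [gN lN]]].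
- pose M : R := n.+1`!%:R + `|s| * (n%:R * n.+2`!%:R + n.+3`!%:R).
  have fn k : 0 < k`!%:R :> R by rewrite ltr0n fact_gt0.
  have M1 : 0 <= n%:R * n.+2`!%:R + n.+3`!%:R :> R by rewrite addr_ge0 ?mulr_ge0// ltW.
  exists M; first by rewrite ltr_wpDr ?mulr_ge0.
  split=> [x|x y].
    rewrite ger0_norm ?flat_exp_ge0// (le_trans (flat_exp_bounded _ _))//.
    by rewrite lerDl mulr_ge0.
  rewrite (le_trans (bounded_derive_lipschitz (is_derive_flat_exp n) (flat_exp'_bounded n) _ _))//.
  rewrite opprD addrACA subrr add0r -mulrBr normrM mulrA ler_pM ?mulr_ge0//.
    by rewrite mulrC lerDr ltW.
  by have := normr_coord (x - y) i; rewrite !mxE.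
- exists (`|c| + 1); first by rewrite ltr_wpDl.
  split=> [x|x y]; first by rewrite lerDl.
  by rewrite subrr normr0 mulr_ge0// addr_ge0.
- exists (M + N); first exact: addr_gt0.
  split=> [x|x y]; first by rewrite (le_trans (ler_normD _ _))// lerD.
  rewrite opprD addrACA (le_trans (ler_normD _ _))// mulrDl lerD//.
- exists (M * N + 2 * (M * N)); first by rewrite addr_gt0// mulr_gt0// mulr_gt0.
  split=> [x|x y].
    rewrite normrM (le_trans (ler_pM _ _ (fM x) (gN x)))// lerDl.
    by rewrite ltW// mulr_gt0// mulr_gt0.
  have -> : f x * g x - f y * g y = (f x - f y) * g x + f y * (g x - g y) by ring.
  rewrite (le_trans (ler_normD _ _))// !normrM.
  apply: (@le_trans _ _ (M * `|x - y| * N + M * (N * `|x - y|))).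
    by apply: lerD; apply: ler_pM.
  have -> : M * `|x - y| * N + M * (N * `|x - y|) = 2 * (M * N) * `|x - y| by ring.
  by rewrite [leRHS]mulrDl lerDr mulr_ge0// ltW// mulr_gt0.
Qed.

Definition supported_in (r : R) f := forall x i, r < `|x ord0 i| -> f x = 0.

Lemma supported_in_norm (r : R) f x : 0 <= r -> supported_in r f -> f x != 0 -> `|x| <= r.
Proof.
move=> r0 sf fx; rewrite [`|x|]mx_normrE; apply: bigmax_le => // -[i j] _.
by rewrite (ord1 i) leNgt; apply/negP => /sf h; rewrite h eqxx in fx.
Qed.

Lemma supported_in_derive r f f' t : supported_in r f ->
  (forall x, is_derive x t f (f' x)) -> supported_in r f'.
Proof.
move=> sf df x i ri; have [_ <-] := df x.
have near0 : {near x, f =1 cst 0}.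
  near=> y; apply: (sf y i); near: y.
  have : open ((fun y : 'rV[R]_d => y ord0 i) @^-1` [set z : R | r < `|z|]).
    apply: open_comp => [y _|]; first exact: coord_continuous.
    apply: (@open_comp _ _ (@Num.norm R R) [set z | r < z]) => [z _|]; last exact: open_gt.
    exact: norm_continuous.
  by move=> o; apply: open_nbhs_nbhs; split.
by rewrite (near_eq_derive t near0) derive_cst.
Unshelve. all: by end_near. Qed.

(** Membership in the flat algebra is a convenient certificate of smoothness: it is
    stable under differentiation and implies Lipschitz bounds. *)
Definition smooth_kernel (r : R) f := flat_algebra f /\ supported_in r f.

Lemma kernel_derive r f t : smooth_kernel r f -> exists2 f', smooth_kernel r f' &
  forall x, is_derive x t f (f' x).
Proof.
move=> [/(flat_algebra_derive t)[f' af' df] sf]; exists f' => //.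
by split => //; exact: supported_in_derive df.
Qed.

(** A nonnegative kernel supported in a given cube, as a product of
    one-dimensional bumps. *)
Definition cube_bump (r : R) x : R :=
  \prod_(i < d) (flat_exp 0 (r + 1 * x ord0 i) * flat_exp 0 (r + (-1) * x ord0 i)).

Lemma bump_ge0 r x : 0 <= cube_bump r x.
Proof. by apply: prodr_ge0 => i _; rewrite mulr_ge0 ?flat_exp_ge0. Qed.

Lemma bump_gt0 r x : cube r x -> 0 < cube_bump r x.
Proof.
move=> xr; apply: prodr_gt0 => i _; have := xr i; rewrite ltr_norml => /andP[h1 h2].
by rewrite mulr_gt0// flat_exp_gt0//; lra.
Qed.

Lemma kernel_bump r : smooth_kernel r (cube_bump r).
Proof.
split.
  rewrite /cube_bump; elim: (index_enum _) => [|i s IH].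
    rewrite (_ : (fun x => _) = fun=> 1); first exact: flat_cst.
    by apply/funext => x; rewrite big_nil.
  rewrite (_ : (fun x => _) = fun x =>
    flat_exp 0 (r + 1 * x ord0 i) * flat_exp 0 (r + (-1) * x ord0 i) *
    \prod_(i <- s) (flat_exp 0 (r + 1 * x ord0 i) * flat_exp 0 (r + (-1) * x ord0 i))).
    by apply: flat_mul => //; apply: flat_mul; exact: flat_gen.
  by apply/funext => x; rewrite big_cons.
move=> x i; rewrite ltr_normr /cube_bump (bigD1 i)//= => /orP[h|h].
  by rewrite [flat_exp 0 (r + -1 * _)]flat_exp_le0 ?mulr0 ?mul0r//; lra.
by rewrite flat_exp_le0 ?mul0r//; lra.
Qed.

End Kernels.

(** * Topology of the pattern space *)

Ltac vec_ring := apply/rowP => ?; rewrite !mxE; ring.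

Section PatternSpaceTopology.
Context {R : realType} {d : nat}.
Implicit Types (x y s t w : 'rV[R]_d) (L M K : deloneSet R d).

Lemma ler_coord_enorm x i : `|x ord0 i| <= enorm x.
Proof.
rewrite -sqrtr_sqr ler_wsqrtr// (bigD1 i)//= lerDl.
by apply: sumr_ge0 => j _; exact: sqr_ge0.
Qed.

Lemma enorm_lt_coord x (e : R) : 0 < e ->
  (forall i, `|x ord0 i| < e / d.+1%:R) -> enorm x < e.
Proof.
move=> e0 xe; rewrite -ltr_sqr ?nnegrE ?enorm_ge0 ?(ltW e0)// sqr_sqrtr ?sumsq_ge0//.
have d0 : 0 < d.+1%:R :> R by [].
apply: (@le_lt_trans _ _ (\sum_(i < d) (e / d.+1%:R) ^+ 2)).
  apply: ler_sum => i _; rewrite -[leLHS]real_normK ?num_real//.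
  by rewrite lerXn2r ?nnegrE ?divr_ge0 ?(ltW e0)// ltW.
rewrite sumr_const card_ord -[ltLHS]mulr_natr exprMn -mulrA -[ltRHS]mulr1 ltr_pM2l ?exprn_gt0//.
rewrite exprVn mulrC ltr_pdivrMr ?exprn_gt0// mul1r.
rewrite expr2 -natrM ltr_nat.
by rewrite mulSn (leq_trans (ltnSn d))// leq_addr.
Qed.

Lemma near_enorm x (U : set 'rV[R]_d) (e : R) : 0 < e ->
  (forall y, enorm (y - x) < e -> U y) -> nbhs x U.
Proof.
move=> e0 xU; apply/nbhs_ballP; exists (e / d.+1%:R) => /=; first by rewrite divr_gt0.
move=> y /ball_rVP xy; apply: xU; apply: enorm_lt_coord => // i.
by rewrite !mxE distrC; apply: xy; rewrite divr_gt0.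
Qed.

(** The difference of the two shifts is absorbed by the small vectors that the
    definition of closeness allows. *)
Lemma agree_translate (e e' : R) L M t t' : agree e L M -> enorm (t' - t) < e ->
  e + e <= e' -> e'^-1 + enorm t' <= e^-1 -> agree e' (translate t L) (translate t' M).
Proof.
move=> /agreeE[e0 [s [s' [se s'e LM]]]] tt ee te.
have e'0 : 0 < e' by apply: lt_le_trans ee; rewrite addr_gt0.
apply: (@agreeP _ _ _ _ _ (s + (t' - t)) s') => //.
- by rewrite (le_lt_trans (ler_enormD _ _))// (lt_le_trans _ ee)// ltrD.
- by rewrite (lt_le_trans s'e)// (le_trans _ ee)// lerDl ltW.
move=> x xe /=; rewrite !vshiftE.
rewrite (_ : x + (s + (t' - t)) + t = x + t' + s); last by vec_ring.
rewrite (_ : x + s' + t' = x + t' + s'); last by vec_ring.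
apply: LM; rewrite (lt_le_trans _ te)// (le_lt_trans (ler_enormD _ _))// ltrD2r//.
Qed.

Lemma delone_closed L x : (forall e : R, 0 < e -> exists2 y, delone_pts L y & enorm (y - x) < e) ->
  delone_pts L x.
Proof.
move=> Lx; have [[e0 e0_gt0 disc] _] := deloneP L.
have [y Ly yx] := Lx (e0 / 2) (divr_gt0 e0_gt0 (ltr0n _ 2)).
have [<-//|/eqP yNx] := eqVneq y x.
have yx0 : 0 < enorm (y - x).
  by rewrite lt_def enorm_ge0 andbT; apply/eqP => /enorm_eq0 /eqP; rewrite subr_eq0 => /eqP.
have [z Lz] := Lx (Num.min (enorm (y - x)) (e0 / 2)) ltac:(by rewrite lt_min yx0 divr_gt0).
rewrite lt_min => /andP[zy zx].
have /(disc _ _ Ly Lz) : y <> z by move=> yz; rewrite yz ltxx in zy.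
rewrite (_ : y - z = (y - x) + (x - z)); last by rewrite addrA subrK.
have := ler_enormD (y - x) (x - z); rewrite (enormB x z); lra.
Qed.

Variable L0 : deloneSet R d.
Local Notation Omega := (pattern_space L0).
Implicit Types (A B : Omega).

Definition pts A : set 'rV[R]_d := delone_pts (val A).

Definition near_pattern (e : R) A B := agree e (val A) (val B).

Lemma nbhs_pattern A (U : set Omega) : nbhs A U <->
  exists2 e : R, 0 < e & forall B, near_pattern e A B -> U B.
Proof.
split=> [/nbhs_ballP[e /= e0 AU]|[e e0 AU]].
  exists (e / 2); first by rewrite divr_gt0.
  move=> B AB; apply: AU.
  have : rho (val A) (val B) < e by apply: le_lt_trans (agree_rho AB) _; lra.
  by move=> AB'; rewrite /ball/=.
have c0 : 0 < (Num.sqrt 2)^-1 :> R by rewrite invr_gt0 sqrtr_gt0.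
apply/nbhs_ballP; exists (Num.min e (Num.sqrt 2)^-1) => /=; first by rewrite lt_min e0.
move=> B AB; apply: AU.
have {}AB : rho (val A) (val B) < Num.min e (Num.sqrt 2)^-1 by [].
by apply: agree_le (rho_agree _ AB); rewrite ge_min lexx ?orbT.
Qed.

End PatternSpaceTopology.

Section Compactness.
Context {R : realType} {d : nat} (L0 : deloneSet R d).
Local Notation Omega := (pattern_space L0).
Implicit Types (A B M : Omega) (x y t w : 'rV[R]_d).

Lemma orbit_approx A (e : R) : 0 < e -> exists t, agree e (val A) (translate t L0).
Proof.
move=> e0; have cA : orbit_closure L0 (val A) := set_mem (valP A).
have c0 : 0 < (Num.sqrt 2)^-1 :> R by rewrite invr_gt0 sqrtr_gt0.
have m0 : 0 < Num.min e (Num.sqrt 2)^-1 by rewrite lt_min e0.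
have [_ [[t _ <-] /= At]] := cA _ (nbhsx_ballx (val A) _ m0).
exists t; apply: agree_le (rho_agree _ At); by rewrite ge_min lexx ?orbT.
Qed.

(** This is how uniform discreteness and relative density pass from the generating
    set to all patterns, with the same constants. *)
Lemma orbit_patch A (r : R) : 0 < r -> exists w, forall x, enorm x < r ->
  pts A x <-> delone_pts L0 (x + w).
Proof.
move=> r0.
have r10 : 0 < r + 1 by rewrite addr_gt0.
have e0 : 0 < (r + 1)^-1 by rewrite invr_gt0.
have [t /agreeE[_ [s [s' [se s'e As]]]]] := orbit_approx A e0.
exists (s' - s + t) => x xr.
have se1 : enorm s < 1 by rewrite (lt_le_trans se)// invf_le1// lerDr ltW.
rewrite /pts -[x in delone_pts (val A) x](subrK s) As /= ?vshiftE.
  by rewrite (_ : x - s + s' + t = x + (s' - s + t))//; vec_ring.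
by rewrite invrK (le_lt_trans (ler_enormD _ _))// enormN ltrD.
Qed.

Lemma pattern_discrete : exists2 e0 : R, 0 < e0 &
  forall A x y, pts A x -> pts A y -> x <> y -> e0 < enorm (x - y).
Proof.
have [[e0 e0_gt0 disc] _] := deloneP L0.
exists e0 => // A x y Ax Ay xy.
have r0 : 0 < enorm x + enorm y + 1 by rewrite ltr_wpDl// addr_ge0 ?enorm_ge0.
have [w Aw] := orbit_patch A r0.
have -> : x - y = (x + w) - (y + w) by vec_ring.
apply: disc.
- by apply/Aw => //; rewrite -addrA ltrDl ltr_wpDl// enorm_ge0.
- by apply/Aw => //; rewrite addrAC ltrDr ltr_wpDl// enorm_ge0.
- by move/addIr.
Qed.

Lemma pattern_dense : exists2 r : R, 0 < r &
  forall A x, exists2 y, pts A y & enorm (y - x) < r.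
Proof.
have [_ [r r0 dense]] := deloneP L0.
exists r => // A x.
have R0 : 0 < enorm x + r by rewrite ltr_wpDl// enorm_ge0.
have [w Aw] := orbit_patch A R0.
have [y [Ly yx]] := dense (x + w).
have yr : enorm (y - w - x) < r.
  by move: yx; rewrite /eball/= (_ : y - (x + w) = y - w - x)//; vec_ring.
exists (y - w) => //; apply/Aw; last by rewrite subrK.
rewrite (_ : y - w = x + (y - w - x)); last by vec_ring.
by rewrite (le_lt_trans (ler_enormD _ _))// ltrD2l.
Qed.

Lemma finite_set_far (Q : set 'rV[R]_d) x : finite_set Q -> ~ Q x ->
  exists2 e : R, 0 < e & forall q, Q q -> e <= enorm (q - x).
Proof.
move=> /finite_seqP[s ->]; elim: s => [_|q s IH]; first by exists 1.
move=> /= qsx.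
have [|e e0 es] := IH; first by move=> sx; apply: qsx; rewrite inE sx orbT.
have qx0 : 0 < enorm (q - x).
  rewrite lt_def enorm_ge0 andbT; apply/eqP => /enorm_eq0 /eqP; rewrite subr_eq0 => /eqP qx.
  by apply: qsx; rewrite inE qx eqxx.
exists (Num.min e (enorm (q - x))); first by rewrite lt_min e0.
move=> p; rewrite inE => /orP[/eqP->|/es ep]; first by rewrite ge_min lexx orbT.
by rewrite ge_min ep.
Qed.

Hypothesis hflc : finite_local_complexity L0.

Section UltrafilterLimit.
Variables (F : set_system Omega).
Hypothesis FU : UltraFilter F.
Let FF : ProperFilter F. Proof. exact: ultra_proper. Qed.

Definition limit_pts : set 'rV[R]_d := [set x | forall e : R, 0 < e ->
  F [set A | exists2 y, pts A y & enorm (y - x) < e]].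

(** By finite local complexity, almost all patterns have on a given ball the
    same patch up to a shift; the shifts converge along the ultrafilter. *)
Lemma ultra_patch (r : R) : 0 < r -> exists Q : set 'rV[R]_d,
  [/\ finite_set Q,
      (forall e : R, 0 < e -> F [set A | exists2 w, enorm w < e &
         forall x, enorm x < r -> pts A x <-> Q (x + w)]) &
      forall x, enorm x < r -> limit_pts x <-> Q x].
Proof.
move=> r0.
have [r1 r10 dense] := pattern_dense.
(* a ball of radius [r1] contains a point of every pattern; this point confines the
   shifts to a compact set *)
wlog rr : r r0 / r1 <= r.
  move=> /(_ (r + r1)) []; [by rewrite addr_gt0|by rewrite lerDr ltW|].
  have rr x : enorm x < r -> enorm x < r + r1 by move=> h; rewrite (lt_trans h)// ltrDl.
  move=> Q [fQ FQ lQ]; exists Q; split => // [e e0|x xr]; last by apply: lQ; exact: rr.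
  apply: filterS (FQ e e0) => A [w we AQ]; exists w => // x xr; apply: AQ; exact: rr.
have [n [P [Pfin Ppatch]]] := hflc r0.
have shiftP A : exists it : 'I_n * 'rV[R]_d, (forall x, enorm x < r ->
    pts A x <-> P it.1 (x + it.2)) /\ forall q, P it.1 q -> enorm (q - it.2) < r.
  have [w Aw] := orbit_patch A r0.
  have [i [t Pit]] := Ppatch w.
  exists (i, t + w); split => [x xr|q Pq] /=.
    rewrite Aw//=.
    have -> : delone_pts L0 (x + w) <-> vshift t (P i) (x + w).
      rewrite -Pit; split => [Lx|[_ Lx]//]; split => //.
      by rewrite /eball/= addrK.
    by rewrite vshiftE (_ : x + w + t = x + (t + w))//; vec_ring.
  have : vshift t (P i) (q - t) by apply/vshiftE; rewrite subrK.
  rewrite -Pit /eball/= => -[].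
  by rewrite (_ : q - t - w = q - (t + w))//; vec_ring.
have [it itP] := choice shiftP.
have [i Fi] : exists i, F [set A | (it A).1 = i].
  apply: contrapT => /forallNP nF.
  have : F [set A | forall i : 'I_n, ~ (it A).1 = i].
    apply: filter_forall => i.
    by have [/nF//|] := in_ultra_setVsetC [set A | (it A).1 = i] FU.
  by move=> /filter_ex[A /(_ (it A).1)].
have [[p Pp]|Pempty] := pselect (exists p, P i p); last first.
  have [A Ai] := @filter_ex _ _ FF _ Fi.
  have [y Ay] := dense A 0; rewrite subr0 => yr.
  exfalso; apply: Pempty; exists (y + (it A).2).
  by rewrite -Ai; apply/(itP A).1 => //; exact: lt_le_trans rr.
pose K : set 'rV[R]_d := [set t | forall i, `[p ord0 i - r, p ord0 i + r]%classic (t ord0 i)].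
have cK : compact K
  by apply: (@rV_compact R d (fun i => `[p ord0 i - r, p ord0 i + r]%classic)) => j; exact: segment_compact.
have FK : F [set A | K (it A).2].
  apply: filterS Fi => A Ai j /=.
  have := (itP A).2 p; rewrite Ai => /(_ Pp) h.
  have := le_lt_trans (ler_coord_enorm _ j) h; rewrite !mxE ltr_norml => /andP[h1 h2].
  by rewrite in_itv/=; apply/andP; split; lra.
have [t [_ tcl]] := cK ((fun A => (it A).2) @ F) _ FK.
have Ft (e : R) : 0 < e -> F [set A | enorm ((it A).2 - t) < e].
  move=> e0; have [//|FC] := in_ultra_setVsetC [set A | enorm ((it A).2 - t) < e] FU.
  have nt : nbhs t [set s | enorm (s - t) < e] by exact: (near_enorm e0).
  have Fim : ((fun A => (it A).2) @ F)
      [set (it A).2 | A in ~` [set A | enorm ((it A).2 - t) < e]].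
    by apply: (@filterS _ F _ _ _ _ FC) => A nA; exists A.
  have [_ [[A nA <-] /= tA]] := tcl _ _ Fim nt.
  by exfalso; exact: nA.
have shiftFe (e : R) : 0 < e -> F [set A | exists2 w, enorm w < e &
     forall x, enorm x < r -> pts A x <-> vshift t (P i) (x + w)].
  move=> e0; apply: filterS2 (Ft e e0) Fi => A /= tA Ai.
  exists ((it A).2 - t) => // x xr.
  by rewrite (itP A).1// Ai vshiftE (_ : x + _ + t = x + (it A).2)//; vec_ring.
have fin : finite_set (vshift t (P i)) by apply: finite_image; case: (Pfin i).
exists (vshift t (P i)); split => // x xr; split => [lx|Qx e e0].
  apply: contrapT => nQx; have [e e0 eQ] := finite_set_far fin nQx.
  pose dl := Num.min (e / 2) (r - enorm x).
  have dl0 : 0 < dl by rewrite lt_min divr_gt0//= subr_gt0.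
  have [A [[y Ay yx] [w wd AQ]]] := filter_ex (filterI (lx dl dl0) (shiftFe dl dl0)).
  move: yx wd; rewrite !lt_min => /andP[yx1 yx2] /andP[w1 w2].
  have yr : enorm y < r.
    rewrite -(subrK x y) (le_lt_trans (ler_enormD _ _))//; lra.
  have := eQ _ ((AQ y yr).1 Ay).
  have -> : y + w - x = (y - x) + w by vec_ring.
  have := ler_enormD (y - x) w; lra.
pose dl := Num.min e (r - enorm x).
have dl0 : 0 < dl by rewrite lt_min e0 subr_gt0.
apply: filterS (shiftFe dl dl0) => A [w]; rewrite lt_min => /andP[w1 w2] AQ.
exists (x - w); last by rewrite addrAC subrr add0r enormN.
apply/AQ; last by rewrite subrK.
by rewrite (le_lt_trans (ler_enormD _ _))// enormN; lra.
Qed.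

Lemma limit_pts_delone : is_delone limit_pts.
Proof.
split.
  have [[e0 e0_gt0 disc] _] := deloneP L0.
  have [e e_gt0 edisc] := pattern_discrete.
  exists (e / 2); first by rewrite divr_gt0.
  move=> x y lx ly xy.
  have xy0 : 0 < enorm (x - y).
    by rewrite lt_def enorm_ge0 andbT; apply/eqP => /enorm_eq0 /eqP; rewrite subr_eq0 => /eqP.
  pose dl := Num.min (e / 4) (enorm (x - y) / 4).
  have dl0 : 0 < dl by rewrite lt_min !divr_gt0.
  have [A [[u Au ux] [v Av vy]]] := filter_ex (filterI (lx dl dl0) (ly dl dl0)).
  move: ux vy; rewrite !lt_min => /andP[ux1 ux2] /andP[vy1 vy2].
  have uv : u <> v.
    move=> uv; move: ux2 vy2; rewrite -uv (enormB u x).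
    have := ler_enormD (x - u) (u - y).
    rewrite (_ : x - u + (u - y) = x - y); last by vec_ring.
    lra.
  have := edisc A u v Au Av uv.
  have -> : u - v = (u - x) + ((x - y) + (y - v)) by vec_ring.
  have := ler_enormD (u - x) ((x - y) + (y - v)).
  have := ler_enormD (x - y) (y - v).
  rewrite (enormB y v); lra.
have [r r0 dense] := pattern_dense.
exists (r + 1); first by rewrite addr_gt0.
move=> x.
have R0 : 0 < enorm x + r + 1 by rewrite ltr_wpDl// addr_ge0 ?enorm_ge0// ltW.
have [Q [_ FQ lQ]] := ultra_patch R0.
have [A [w w1 AQ]] := filter_ex (FQ 1 ltr01).
have [y Ay yx] := dense A x.
have yr : enorm y < enorm x + r.
  by rewrite -(subrK x y) addrC (le_lt_trans (ler_enormD _ _))// ltrD2l.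
exists (y + w); split.
  apply/lQ; last by apply/AQ => //; rewrite (lt_trans yr)// ltrDl.
  by rewrite (le_lt_trans (ler_enormD _ _))// ltrD.
rewrite /eball/= (_ : y + w - x = y - x + w); last by vec_ring.
by rewrite (le_lt_trans (ler_enormD _ _))// ltrD.
Qed.

Definition limit_delone : deloneSet R d := DeloneSet limit_pts_delone.

Lemma limit_agree (e : R) : 0 < e -> F [set A | agree e limit_delone (val A)].
Proof.
move=> e0.
have r0 : 0 < e^-1 + e by rewrite addr_gt0// invr_gt0.
have [Q [_ FQ lQ]] := ultra_patch r0.
apply: filterS (FQ e e0) => A [w we AQ] /=.
apply: (@agreeP _ _ _ _ _ w 0) => //; first by rewrite enorm0.
move=> x xe; rewrite addr0; apply: iff_trans (iff_sym (AQ x _)).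
  by apply: lQ; rewrite (le_lt_trans (ler_enormD _ _))// ltrD.
by rewrite (lt_trans xe)// ltrDl.
Qed.

Lemma limit_in_orbit_closure : orbit_closure L0 limit_delone.
Proof.
rewrite /orbit_closure (iffLR (closure_id _) (@closed_closure _ _)).
move=> B /nbhs_ballP[e /= e0 eB].
have [A AF] := filter_ex (limit_agree (divr_gt0 e0 (ltr0n R 2))).
exists (val A); split; first exact: set_mem (valP A).
apply: eB; rewrite ballEmdist/=.
by apply: le_lt_trans (agree_rho AF) _; lra.
Qed.

End UltrafilterLimit.

(** Every ultrafilter converges, to the set of the points that are approached by
    points of almost all patterns. *)
Theorem pattern_space_compact : compact [set: Omega].
Proof.
rewrite compact_ultra => F FU _.
pose L : Omega := exist _ (limit_delone FU) (mem_set (@limit_in_orbit_closure F FU)).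
exists L; split => // U /nbhs_pattern[e e0 LU].
by apply: filterS (limit_agree FU e0) => A; exact: LU.
Qed.

(** The largest part of [U] that is determined by the points in the ball of
    radius [r]. *)
Definition local_part (r : R) (U : set Omega) : set Omega := [set A |
  forall B, (forall x, enorm x < r -> pts A x <-> pts B x) -> U B].

Lemma local_part_sub r U : local_part r U `<=` U.
Proof. by move=> A; apply. Qed.

Lemma local_part_cover U A : open U -> U A -> exists n : nat, local_part n%:R U A.
Proof.
move=> oU UA.
have /nbhs_pattern[e e0 AU] : nbhs A U by exact: open_nbhs_nbhs.
exists (Num.truncn e^-1).+1 => B AB; apply: AU.
apply: (@agreeP _ _ _ _ _ 0 0) => //; rewrite ?enorm0// => x xe.
by rewrite !addr0; apply: AB; rewrite (lt_trans xe)// truncnS_gt.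
Qed.

(** If [A] were not an interior point, there would be patterns outside [U] that agree
    on the ball of radius [r] with patterns arbitrarily close to [A]. By compactness
    they accumulate at a pattern [M] outside [U]; agreement on an open ball survives
    the passage to the limit, so that [M] agrees with [A] there, a contradiction. *)
Lemma open_local_part r U : open U -> open (local_part r U).
Proof.
move=> oU; rewrite openE => A lA; apply: contrapT => nint.
pose G (e : R) : set Omega := [set M | ~ U M /\ exists2 B, near_pattern e A B &
  forall x, enorm x < r -> pts B x <-> pts M x].
have GP (e : R) : 0 < e -> exists M, G e M.
  move=> e0; apply: contrapT => /forallNP nG; apply: nint; apply/nbhs_pattern.
  exists e => // B AB M BM; apply: contrapT => nUM.
  by apply: (nG M); split => //; exists B.
have FG : ProperFilter (filter_from [set e : R | 0 < e] G).
  apply: filter_from_proper; last by move=> e /GP.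
  apply: filter_from_filter; first by exists 1; rewrite /= ltr01.
  move=> e e' /= e0 e'0; exists (Num.min e e'); first by rewrite /= lt_min e0.
  move=> M [nUM [B AB BM]]; split; (split => //; exists B => //);
    by apply: agree_le AB; rewrite ge_min lexx ?orbT.
have GF (e : R) : 0 < e -> (filter_from [set e : R | 0 < e] G) (G e) by move=> e0; exists e.
have cU : compact (~` U).
  by apply: (subclosed_compact _ pattern_space_compact) => //; exact: open_closedC.
have [M [nUM Mcl]] := cU _ FG ltac:(by exists 1; [rewrite /= ltr01|move=> M []]).
have {}Mcl (e : R) : 0 < e -> exists B M', [/\ near_pattern e A B, near_pattern e M M' &
     forall x, enorm x < r -> pts B x <-> pts M' x].
  move=> e0; have nM : nbhs M [set M' | near_pattern e M M'] by apply/nbhs_pattern; exists e.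
  by have [M' [[_ [B AB BM']] MM']] := Mcl _ _ (GF e e0) nM; exists B, M'.
(* points of a pattern move by at most 2e when passing to an e-close one *)
have move_pt (e : R) (B B' : Omega) x : near_pattern e B B' -> enorm x + e < e^-1 -> pts B x ->
    exists2 y, pts B' y & enorm (y - x) < e + e.
  move=> /agreeE[e0 [s [s' [se s'e BB']]]] xe Bx.
  exists (x - s + s').
    apply/BB'; last by rewrite subrK.
    by rewrite (le_lt_trans (ler_enormD _ _))// enormN (lt_trans _ xe)// ltrD2l.
  rewrite (_ : _ - x = s' - s); last by vec_ring.
  by rewrite (le_lt_trans (ler_enormD _ _))// enormN ltrD.
apply: nUM; apply: lA => x xr.
have small (e : R) : 0 < e -> exists e', [/\ 0 < e', e' + e' + (e' + e') < e,
     enorm x + (e' + e') < r & enorm x + (e' + e') + e' < e'^-1].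
  move=> e0; have X0 := enorm_ge0 x.
  pose e' := Num.min (Num.min (e / 8) ((r - enorm x) / 4)) (Num.min 1 (enorm x + 4)^-1).
  have X4 : 0 < enorm x + 4 by rewrite ltr_wpDl.
  have e'0 : 0 < e' by rewrite !lt_min invr_gt0 X4 !divr_gt0 ?subr_gt0 ?ltr01.
  have h1 : e' <= e / 8 by rewrite !ge_min lexx.
  have h2 : e' <= (r - enorm x) / 4 by rewrite !ge_min lexx ?orbT.
  have h3 : e' <= 1 by rewrite !ge_min lexx ?orbT.
  have h4 : enorm x + 4 <= e'^-1.
    by rewrite -[leLHS]invrK lef_pV2 ?posrE ?invr_gt0// !ge_min lexx ?orbT.
  by exists e'; split => //; lra.
split => [Ax|Mx]; apply: delone_closed => e e0.
- have [e' [e'0 h1 h2 h3]] := small e e0.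
  have [B [M' [AB MM' BM']]] := Mcl e' e'0.
  have [y By yx] := move_pt e' A B x AB ltac:(lra) Ax.
  have yr : enorm y < enorm x + (e' + e').
    by rewrite -(subrK x y) addrC (le_lt_trans (ler_enormD _ _))// ltrD2l.
  have M'y : pts M' y by apply/BM' => //; exact: lt_trans h2.
  have [z Mz zy] := move_pt e' M' M y (agree_sym MM') ltac:(lra) M'y.
  exists z => //; rewrite (_ : z - x = (z - y) + (y - x)); last by vec_ring.
  by rewrite (le_lt_trans (ler_enormD _ _))// (lt_trans _ h1)// ltrD.
- have [e' [e'0 h1 h2 h3]] := small e e0.
  have [B [M' [AB MM' BM']]] := Mcl e' e'0.
  have [y M'y yx] := move_pt e' M M' x MM' ltac:(lra) Mx.
  have yr : enorm y < enorm x + (e' + e').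
    by rewrite -(subrK x y) addrC (le_lt_trans (ler_enormD _ _))// ltrD2l.
  have By : pts B y by apply/BM' => //; exact: lt_trans h2.
  have [z Az zy] := move_pt e' B A y (agree_sym AB) ltac:(lra) By.
  exists z => //; rewrite (_ : z - x = (z - y) + (y - x)); last by vec_ring.
  by rewrite (le_lt_trans (ler_enormD _ _))// (lt_trans _ h1)// ltrD.
Qed.

End Compactness.

(** * The translation action *)

Section TranslationAction.
Context {R : realType} {d : nat} {L0 : deloneSet R d}.
Local Notation Omega := (pattern_space L0).
Implicit Types (A B : Omega) (s t x : 'rV[R]_d) (f : Omega -> R).

Lemma pattern_eq A B : pts A = pts B -> A = B.
Proof. by move=> AB; apply: val_inj; exact: delone_eq. Qed.

Lemma pts_phi t A x : pts (phi t A) x <-> pts A (x + t).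
Proof. exact: vshiftE. Qed.

Lemma phi0 A : phi 0 A = A.
Proof. by apply: pattern_eq; exact: vshift0. Qed.

Lemma phiD s t A : phi s (phi t A) = phi (s + t) A.
Proof. by apply: pattern_eq; exact: vshiftD. Qed.

Lemma phi_jointly_continuous t A (U : set Omega) : nbhs (phi t A) U ->
  exists2 e : R, 0 < e & forall t' B, enorm (t' - t) < e -> near_pattern e A B -> U (phi t' B).
Proof.
move=> /nbhs_pattern[e e0 AU].
have X0 : 0 < e^-1 + enorm t + 1 by rewrite ltr_wpDl// addr_ge0 ?enorm_ge0// invr_ge0 ltW.
pose e' := Num.min (e / 2) (Num.min 1 (e^-1 + enorm t + 1)^-1).
have e'0 : 0 < e' by rewrite !lt_min ltr01 invr_gt0 X0 divr_gt0.
have h1 : e' <= e / 2 by rewrite ge_min lexx.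
have h2 : e' <= 1 by rewrite !ge_min lexx ?orbT.
have h3 : e^-1 + enorm t + 1 <= e'^-1.
  by rewrite -[leLHS]invrK lef_pV2 ?posrE ?invr_gt0// !ge_min lexx ?orbT.
exists e' => // t' B tt' AB; apply: AU; apply: (agree_translate AB tt'); first by lra.
rewrite (le_trans _ h3)// -addrA lerD2l -(subrK t t') addrC.
by rewrite (le_trans (ler_enormD _ _))// lerD2r (le_trans (ltW tt')).
Qed.

Lemma continuous_phi t : continuous (phi t : Omega -> Omega).
Proof.
move=> A U /phi_jointly_continuous[e e0 AU]; apply/nbhs_pattern; exists e => // B.
by apply: AU; rewrite subrr enorm0.
Qed.

Lemma continuous_orbit A : continuous (fun t => phi t A).
Proof.
move=> t U /phi_jointly_continuous[e e0 AU]; apply: (near_enorm e0) => t' tt'.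
by apply: AU => //; exact: agree_refl.
Qed.

Lemma open_measurable_pattern (U : set Omega) : open U -> measurable U.
Proof. by move=> oU; exact: sub_sigma_algebra. Qed.

Lemma measurable_fun_pattern {dT} {T : measurableType dT} (g : T -> Omega) :
  (forall U : set Omega, open U -> measurable (g @^-1` U)) -> measurable_fun setT g.
Proof.
move=> gU; apply: (measurability (@open Omega)) => // _ [U oU <-].
by rewrite setTI; exact: gU.
Qed.

Lemma continuous_measurable_pattern f : continuous f -> measurable_fun setT f.
Proof.
move=> cf; apply: open_preimage_measurable => U oU; apply: open_measurable_pattern.
by apply: open_comp => // x _; exact: cf.
Qed.

Lemma measurable_phi t : measurable_fun setT (phi t : Omega -> Omega).
Proof.
apply: measurable_fun_pattern => U oU; apply: open_measurable_pattern.
by apply: open_comp => // x _; exact: continuous_phi.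
Qed.

Lemma measurable_orbit A : measurable_fun setT (fun t => phi t A).
Proof.
apply: measurable_fun_pattern => U oU; apply: open_measurable_rV.
by apply: open_comp => // x _; exact: continuous_orbit.
Qed.

(** The action is jointly Borel: as the group is second countable, the preimage
    of an open set is a countable union of products of open sets. *)
Lemma measurable_action :
  measurable_fun setT (fun p : 'rV[R]_d * Omega => phi p.1 p.2).
Proof.
apply: measurable_fun_pattern => U oU.
pose V p : set Omega := [set A | forall t, rat_ball p t -> U (phi t A)]°.
rewrite (_ : _ @^-1` U = \bigcup_p (rat_ball p `*` V p)).
  apply: countable_bigcupT_measurable => // p; apply: measurableX.
    exact: measurable_rat_ball.
  by apply: open_measurable_pattern; exact: open_interior.
apply/seteqP; split => [[t A] /= UtA|[t A] [p _ [/= pt VA]]]; last first.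
  exact: (interior_subset VA).
have [e e0 UtAe] := @phi_jointly_continuous t A U (open_nbhs_nbhs (conj oU UtA)).
have [p [pt pe]] := rat_ball_base (near_enorm (x := t) e0 (fun y => id)).
exists p => //; split => //=; apply/nbhs_pattern; exists e => // B AB s /pe.
by move=> se; exact: UtAe.
Qed.

Lemma measurable_action_fun f : measurable_fun setT f ->
  measurable_fun setT (fun p : 'rV[R]_d * Omega => f (phi p.1 p.2)).
Proof. by move=> mf; apply: measurableT_comp mf measurable_action. Qed.

Lemma measurable_fun_phi f t : measurable_fun setT f -> measurable_fun setT (f \o phi t).
Proof. by move=> mf; apply: measurableT_comp mf (measurable_phi t). Qed.

Lemma measurable_fun_orbit f A : measurable_fun setT f ->
  measurable_fun setT (fun t => f (phi t A)).
Proof. by move=> mf; apply: measurableT_comp mf (measurable_orbit A). Qed.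

Lemma invariant_phi (mu : probability Omega R) t : translation_invariant mu ->
  measure_preserving mu (phi t).
Proof. by move=> inv; split; [exact: measurable_phi|exact: inv]. Qed.

Lemma continuous_bounded_pattern f : finite_local_complexity L0 -> continuous f ->
  exists2 M : R, 0 < M & forall A, `|f A| <= M.
Proof.
move=> hflc cf; have cfT : compact (f @` [set: Omega]).
  apply: continuous_compact; last exact: pattern_space_compact.
  exact: continuous_subspaceT.
have [M [_ fM]] := compact_bounded cfT.
exists (`|M| + 1); first by rewrite ltr_wpDl.
by move=> A; apply: fM; [rewrite (le_lt_trans (ler_norm M))// ltrDl|exists A].
Qed.

End TranslationAction.

(** * Derivatives along orbits *)

Lemma Rint_dnbhs_cvg {dT} {T : measurableType dT} {R : realType}
    (m : {measure set T -> \bar R}) (F : R -> T -> R) (f H : T -> R) :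
  (forall s, measurable_fun setT (F s)) -> Rintegrable m H ->
  (forall s x, s != 0 -> `|s| <= 1 -> `|F s x| <= H x) ->
  (forall x, F s x @[s --> 0^'] --> f x) ->
  Rintegrable m f /\ \int[m]_x F s x @[s --> 0^'] --> \int[m]_x f x.
Proof.
move=> mF iH FH Ff.
have main (u : nat -> R) : (forall n, u n != 0) -> u n @[n --> \oo] --> (0 : R) ->
    Rintegrable m f /\ \int[m]_x F (u n) x @[n --> \oo] --> \int[m]_x f x.
  move=> u0 ucv.
  have [N _ uN] : \forall n \near \oo, `|u n| <= 1.
    by apply: (cvgr0_norm_le _ ucv).
  have [] := @Rint_dominated_cvg _ _ _ m (fun n => F (u (n + N)%N)) f H.
  - by move=> n; exact: mF.
  - exact: iH.
  - by move=> n x; apply: FH => //; apply: uN; rewrite /= leq_addl.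
  - move=> x; have /cvgr_dnbhsP/(_ u (conj u0 ucv)) := Ff x.
    by rewrite -(cvg_shiftn N).
  move=> fint; rewrite (cvg_shiftn N (fun n => \int[m]_x F (u n) x)) => cv.
  by split.
split; last by apply/cvgr_dnbhsP => u [u0 ucv]; case: (main u u0 ucv).
have [] // := main (fun n => n.+1%:R^-1) _ _.
exact: cvg_harmonic.
Qed.

(** Integration by parts for a measure-preserving flow: by invariance of the measure,
    a difference quotient can be moved from one factor to the other. *)
Lemma flow_by_parts {dT} {T : measurableType dT} {R : realType}
    (m : {measure set T -> \bar R}) (tau : R -> T -> T) (f g f' g' H : T -> R) :
  (forall s, measure_preserving m (tau s)) ->
  (forall s x, tau s (tau (- s) x) = x) ->
  measurable_fun setT f -> measurable_fun setT g ->
  Rintegrable m (fun x => f x * g x) -> Rintegrable m H ->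
  (forall x, (f (tau s x) - f x) / s @[s --> 0^'] --> f' x) ->
  (forall x, (g (tau s x) - g x) / s @[s --> 0^'] --> g' x) ->
  (forall s x, s != 0 -> `|s| <= 1 -> `|(f (tau s x) - f x) / s * g x| <= H x) ->
  (forall s x, s != 0 -> `|s| <= 1 -> `|f x * ((g (tau s x) - g x) / s)| <= H x) ->
  \int[m]_x (f' x * g x) = - \int[m]_x (f x * g' x).
Proof.
move=> mtau tauK mf mg ifg iH df dg Hf Hg.
pose s_ n : R := n.+1%:R^-1.
have s0 n : 0 < s_ n by rewrite invr_gt0.
have sN0 n : s_ n != 0 by rewrite gt_eqF.
have s1 n : `|s_ n| <= 1 by rewrite gtr0_norm// invf_le1// ler1n.
have mft s : measurable_fun setT (fun x => f (tau s x)).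
  by apply: measurableT_comp mf _; case: (mtau s).
have mgt s : measurable_fun setT (fun x => g (tau s x)).
  by apply: measurableT_comp mg _; case: (mtau s).
have scvg : s_ n @[n --> \oo] --> (0 : R) by exact: cvg_harmonic.
have scvgN : - s_ n @[n --> \oo] --> (0 : R) by rewrite -[0]oppr0; exact: cvgN.
have [_ /cvgr_dnbhsP cf] := Rint_dnbhs_cvg
  (F := fun s x => (f (tau s x) - f x) / s * g x) (f := fun x => f' x * g x)
  (fun s => ltac:(by apply: measurable_funM => //; apply: measurable_funM => //; apply: measurable_funB))
  iH Hf (fun x => cvgM (df x) (cvg_cst (g x))).
have {}cf := cf s_ (conj sN0 scvg).
have [_ /cvgr_dnbhsP cg] := Rint_dnbhs_cvg
  (F := fun s x => f x * ((g (tau s x) - g x) / s)) (f := fun x => f x * g' x)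
  (fun s => ltac:(by apply: measurable_funM => //; apply: measurable_funM => //; apply: measurable_funB))
  iH Hg (fun x => cvgM (cvg_cst (f x)) (dg x)).
have sNN0 n : - s_ n != 0 by rewrite oppr_eq0.
have {}cg := cg (fun n => - s_ n) (conj sNN0 scvgN).
(* by invariance, the difference quotient of [f] with step [s] against [g] has the
   opposite integral of [f] against the difference quotient of [g] with step [- s] *)
have E n : \int[m]_x ((f (tau (s_ n) x) - f x) / s_ n * g x) =
    - \int[m]_x (f x * ((g (tau (- s_ n) x) - g x) / (- s_ n))).
  have i1 : Rintegrable m (fun x => (f (tau (s_ n) x) - f x) / s_ n * g x).
    apply: Rintegrable_le iH => [|x]; last by rewrite (le_trans (Hf _ _ (sN0 n) (s1 n)))// ler_norm.
    by apply: measurable_funM => //; apply: measurable_funM => //; apply: measurable_funB.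
  have i2 : Rintegrable m (fun x => f x * ((g (tau (- s_ n) x) - g x) / (- s_ n))).
    apply: Rintegrable_le iH => [|x].
      by apply: measurable_funM => //; apply: measurable_funM => //; apply: measurable_funB.
    rewrite (le_trans (Hg (- s_ n) x _ _)) ?ler_norm ?oppr_eq0//; first by rewrite normrN.
  have e1 : (fun x => f (tau (s_ n) x) * g x) =
      (fun x => s_ n * ((f (tau (s_ n) x) - f x) / s_ n * g x) + f x * g x).
    by apply/funext => x; field.
  have e2 : (fun x => f x * g (tau (- s_ n) x)) =
      (fun x => (- s_ n) * (f x * ((g (tau (- s_ n) x) - g x) / (- s_ n))) + f x * g x).
    by apply/funext => x; field; exact: sN0.
  have := measure_preserving_Rint (mtau (s_ n)) (f := fun x => f x * g (tau (- s_ n) x))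
    (measurable_funM mf (mgt _)).
  rewrite (_ : (fun x => _) = (fun x => f (tau (s_ n) x) * g x)); last first.
    apply/funext => x; congr (_ * g _).
    by have := tauK (- s_ n) x; rewrite opprK.
  rewrite e1 e2 RintD ?RintD//; try exact: RintegrableZ.
  rewrite !RintZ// => /addIr; rewrite mulNr -mulrN.
  by move=> /(mulfI (sN0 n)).
have cg' : (fun n => - \int[m]_x (f x * ((g (tau (- s_ n) x) - g x) / - s_ n))) @ \oo -->
    - \int[m]_x (f x * g' x) by exact: cvgN.
rewrite -(cvg_lim _ cf)// -(cvg_lim _ cg')//; congr (lim (_ @ \oo)).
by apply/funext => n; rewrite E.
Qed.

Section SmoothCalculus.
Context {R : realType} {d : nat} {L0 : deloneSet R d}.
Local Notation Omega := (pattern_space L0).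
Implicit Types (A B : Omega) (s t : 'rV[R]_d) (f g : Omega -> R).

Lemma smooth_continuous f : smooth f -> continuous f.
Proof. by move=> /(_ 0%N)[]. Qed.

Lemma smooth_dir_deriv f t : smooth f -> smooth (dir_deriv t f).
Proof. by move=> sf k; have [_ [_]] := sf k.+1; exact. Qed.

Lemma smooth_cvg f t A : smooth f ->
  diff_quot t f A h @[h --> 0^'] --> dir_deriv t f A.
Proof. by move=> /(_ 1%N)[_ [df _]]; exact: df. Qed.

(** A coinduction principle for smoothness. *)
Lemma smooth_class (P : (Omega -> R) -> Prop) :
  (forall f, P f -> continuous f) ->
  (forall f t, P f -> exists2 f', P f' & forall A, diff_quot t f A h @[h --> 0^'] --> f' A) ->
  forall f, P f -> smooth f.
Proof.
move=> Pcont Pder f Pf k; elim: k f Pf => [|k IH] f Pf; first by split=> //; exact: Pcont.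
split; first exact: Pcont.
split => [A t|t]; have [f' Pf' ff'] := Pder f t Pf.
  by apply/cvg_ex; exists (f' A); exact: ff'.
rewrite (_ : dir_deriv t f = f'); first exact: IH.
by apply/funext => A; exact/cvg_lim.
Qed.

Lemma diff_quot_phi f s t A : diff_quot t (f \o phi s) A = diff_quot t f (phi s A).
Proof. by apply/funext => h; rewrite /diff_quot/= !phiD [s + _]addrC. Qed.

Lemma dir_deriv_phi f s t A : dir_deriv t (f \o phi s) A = dir_deriv t f (phi s A).
Proof.
by rewrite /dir_deriv diff_quot_phi.
Qed.

Lemma smooth_phi f s : smooth f -> smooth (f \o phi s).
Proof.
move=> sf; apply: (@smooth_class (fun g => exists2 f, smooth f & g = f \o phi s)); last by exists f.
  move=> _ [g sg ->] A; apply: continuous_comp; first exact: continuous_phi.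
  exact: smooth_continuous.
move=> _ t [g sg ->]; exists (dir_deriv t g \o phi s).
  by exists (dir_deriv t g) => //; exact: smooth_dir_deriv.
by move=> A; rewrite diff_quot_phi; exact: (smooth_cvg (A := phi s A)).
Qed.

Lemma smoothB f g : smooth f -> smooth g -> smooth (fun A => f A - g A).
Proof.
move=> sf sg; apply: (@smooth_class (fun h => exists f g,
  [/\ smooth f, smooth g & h = fun A => f A - g A])); last by exists f, g.
  by move=> _ [f1 [g1 [sf1 sg1 ->]]] A; exact: (cvgB (@smooth_continuous f1 sf1 A) (@smooth_continuous g1 sg1 A)).
move=> _ t [f1 [g1 [sf1 sg1 ->]]].
exists (fun A => dir_deriv t f1 A - dir_deriv t g1 A).
  by exists (dir_deriv t f1), (dir_deriv t g1); split => //; exact: smooth_dir_deriv.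
move=> A; rewrite (_ : (fun h => _) = fun h => diff_quot t f1 A h - diff_quot t g1 A h).
  by apply: cvgB; exact: smooth_cvg.
by apply/funext => h; rewrite /diff_quot; ring.
Qed.

Lemma is_derive_orbit_line f A s t (x : R) : smooth f ->
  is_derive x 1 (fun h : R => f (phi (h *: t + s) A)) (dir_deriv t f (phi (x *: t + s) A)).
Proof.
move=> sf.
have E : (fun h : R => h^-1 *: (((fun h : R => f (phi (h *: t + s) A)) \o shift x) (h *: 1)
     - f (phi (x *: t + s) A))) = diff_quot t f (phi (x *: t + s) A).
  apply/funext => h; rewrite /diff_quot /= phiD [_ / h]mulrC.
  by rewrite [h *: 1]mulr1 scalerDl addrA.
apply: DeriveDef.
  by rewrite /derivable E; apply/cvg_ex; eexists; exact: smooth_cvg.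
by rewrite /derive E.
Qed.

Lemma mvt_orbit f A s t (h : R) : smooth f -> 0 < h ->
  exists2 c, 0 <= c <= h &
    f (phi (h *: t + s) A) - f (phi s A) = h * dir_deriv t f (phi (c *: t + s) A).
Proof.
move=> sf h0.
have [c] := @MVT R (fun h : R => f (phi (h *: t + s) A)) _ 0 h h0
   (fun x _ => is_derive_orbit_line A s t x sf)
   (continuous_subspaceT (fun x => differentiable_continuous
     ((derivable1_diffP _ _).1 (@ex_derive _ _ _ _ _ _ _ (is_derive_orbit_line A s t x sf))))).
rewrite in_itv/= => /andP[c0 ch] E; exists c; first by rewrite !ltW.
by move: E; rewrite scale0r add0r subr0 mulrC.
Qed.

Lemma smooth_lipschitz f t M : smooth f -> (forall A, `|dir_deriv t f A| <= M) ->
  forall A (h : R), `|f (phi (h *: t) A) - f A| <= M * `|h|.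
Proof.
move=> sf fM A h.
have := bounded_derive_lipschitz (fun x => is_derive_orbit_line A 0 t x sf) (fun x => fM _) h 0.
by rewrite scale0r !addr0 phi0 subr0.
Qed.

(** The second difference is symmetric in [s] and [t], and up to the factor [h * h] it
    is a value of the mixed derivative at a nearby point of the orbit: hence the symmetry
    of mixed derivatives. *)
Lemma mixed_difference f A s t (h : R) : smooth f -> 0 < h -> exists a b,
  [/\ 0 <= a <= h, 0 <= b <= h &
    f (phi (h *: s + h *: t) A) - f (phi (h *: s) A) - f (phi (h *: t) A) + f A =
    h * (h * dir_deriv t (dir_deriv s f) (phi (a *: s + b *: t) A))].
Proof.
move=> sf h0.
pose g := fun B => f (phi (h *: t) B) - f B.
have sg : smooth g by apply: smoothB => //; exact: smooth_phi.
have gE B : dir_deriv s g B = dir_deriv s f (phi (h *: t) B) - dir_deriv s f B.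
  apply/cvg_lim => //; rewrite (_ : diff_quot s g B =
      fun u => diff_quot s f (phi (h *: t) B) u - diff_quot s f B u).
    by apply: cvgB; exact: smooth_cvg.
  apply/funext => u; rewrite /diff_quot /g !phiD.
  by rewrite [h *: t + u *: s]addrC; ring.
have [a a0h Ea] := mvt_orbit A 0 s sg h0.
have [b b0h Eb] := mvt_orbit A (a *: s) t (smooth_dir_deriv s sf) h0.
exists a, b; split => //; rewrite [a *: s + _]addrC -Eb.
move: Ea; rewrite gE !addr0 phi0 /g !phiD => Ea.
by rewrite -Ea addrC [h *: t + h *: s]addrC; ring.
Qed.

Lemma dir_derivC f s t : smooth f ->
  dir_deriv s (dir_deriv t f) = dir_deriv t (dir_deriv s f).
Proof.
move=> sf; apply/funext => A.
have sst := smooth_dir_deriv s (smooth_dir_deriv t sf).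
have sts := smooth_dir_deriv t (smooth_dir_deriv s sf).
apply/eqP; rewrite -subr_eq0; apply/eqP/normr0_eq0; apply/eqP.
rewrite eq_le normr_ge0 andbT; apply/ler_addgt0Pl => e e0; rewrite addr0.
have near2 g : smooth g -> \forall x \near (0 : 'rV[R]_d), `|g A - g (phi x A)| < e / 2.
  move=> sg; have cg : continuous (fun x => g (phi x A)).
    move=> x; apply: continuous_comp; first exact: continuous_orbit.
    exact: smooth_continuous.
  have /cvgrPdist_lt/(_ (e / 2) (divr_gt0 e0 (ltr0n _ 2))) := cg 0.
  by rewrite phi0.
have nb : nbhs (0 : 'rV[R]_d) ([set x | `|dir_deriv s (dir_deriv t f) A -
      dir_deriv s (dir_deriv t f) (phi x A)| < e / 2] `&` [set x |
     `|dir_deriv t (dir_deriv s f) A - dir_deriv t (dir_deriv s f) (phi x A)| < e / 2]).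
  by apply: filterI; exact: near2.
have /nbhs_ballP[r /= r0 rP] := nb.
have [h h0 hr] : exists2 h : R, 0 < h & h * `|s| + h * `|t| < r.
  have S0 : 0 < `|s| + `|t| + 1 by rewrite ltr_wpDl// addr_ge0.
  exists (r / (`|s| + `|t| + 1)); first by rewrite divr_gt0.
  by rewrite -mulrDr mulrAC ltr_pdivrMr// ltr_pM2l// ltrDl.
have small a b : 0 <= a <= h -> 0 <= b <= h -> ball (0 : 'rV[R]_d) r (a *: s + b *: t).
  move=> /andP[a0 ah] /andP[b0 bh]; rewrite -ball_normE /= sub0r normrN.
  rewrite (le_lt_trans (ler_normD _ _))// !normrZ !ger0_norm//.
  by apply: le_lt_trans hr; rewrite lerD// ler_wpM2r.
have [a [b [ha hb E]]] := mixed_difference A s t sf h0.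
have [a' [b' [ha' hb' E']]] := mixed_difference A t s sf h0.
have [_ P1] := rP _ (small _ _ ha hb).
have [P2 _] := rP _ (small _ _ hb' ha').
have EE : dir_deriv t (dir_deriv s f) (phi (a *: s + b *: t) A) =
    dir_deriv s (dir_deriv t f) (phi (b' *: s + a' *: t) A).
  move: E E'; rewrite [a' *: t + _]addrC [h *: t + h *: s]addrC.
  move: (dir_deriv t _ _) (dir_deriv s _ _) => u v.
  move: (f (phi (h *: s + h *: t) A)) (f (phi (h *: s) A)) (f (phi (h *: t) A)) (f A).
  move=> x y z w E E'.
  apply: (mulfI (lt0r_neq0 h0)); apply: (mulfI (lt0r_neq0 h0)).
  by rewrite -E -E'; ring.
move: P1 P2 => /=; rewrite EE; move: (dir_deriv s _ A) (dir_deriv t _ A) (dir_deriv s _ _) => x y z.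
rewrite !ltr_norml => /andP[h1 h2] /andP[h3 h4].
clear -h1 h2 h3 h4.
by rewrite ler_norml; apply/andP; split; lra.
Qed.

End SmoothCalculus.

(** * Multiindices and integration by parts *)

Section MultiIndices.
Context {d : nat}.
Implicit Types (a b : 'I_d -> nat).

(** A multiindex as the sequence of its successive directions, so that equality of
    mixed derivatives becomes invariance under permutation. *)
Definition mi_seq a : seq 'I_d := flatten [seq nseq (a i) i | i <- enum 'I_d].

Lemma mi_size0 : mi_size (fun _ : 'I_d => 0%N) = 0%N.
Proof. by rewrite /mi_size big1. Qed.

Lemma size_mi_seq a : size (mi_seq a) = mi_size a.
Proof.
rewrite /mi_seq /mi_size size_flatten /shape -map_comp sumnE big_map big_enum /=.
by apply: eq_bigr => i _; rewrite size_nseq.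
Qed.

Lemma perm_mi_seqD a b :
  perm_eq (mi_seq a ++ mi_seq b) (mi_seq (fun i => (a i + b i)%N)).
Proof.
rewrite /mi_seq; elim: (enum 'I_d) => [//|i s IH] /=.
apply: perm_trans (_ : perm_eq _ ((nseq (a i) i ++ nseq (b i) i) ++
    (flatten [seq nseq (a i) i | i <- s] ++ flatten [seq nseq (b i) i | i <- s]))) _.
  rewrite -!catA perm_cat2l.
  by rewrite perm_catCA.
by rewrite nseqD perm_cat2l.
Qed.

Lemma iter_partialE (R : realType) (X : Type) (D : 'rV[R]_d -> (X -> R) -> X -> R) a f :
  iter_partial D a f = foldr (fun i g => D (basis_vec R i) g) f (mi_seq a).
Proof.
rewrite /iter_partial /mi_seq; elim: (enum 'I_d) => [//|i s IH] /=.
rewrite foldr_cat -IH; elim: (a i) => [//|n IHn] /=.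
by rewrite IHn.
Qed.

End MultiIndices.

Section HullDerivatives.
Context {R : realType} {d : nat} {L0 : deloneSet R d}.
Local Notation Omega := (pattern_space L0).
Implicit Types (A B : Omega) (s t : 'rV[R]_d) (f g : Omega -> R) (l : seq 'I_d).

Definition Dseq l f : Omega -> R := foldr (fun i g => dir_deriv (basis_vec R i) g) f l.

Lemma D_hullE a f : D_hull a f = Dseq (mi_seq a) f.
Proof. exact: iter_partialE. Qed.

Lemma smooth_Dseq l f : smooth f -> smooth (Dseq l f).
Proof. by move=> sf; elim: l => [//|i l IH] /=; exact: smooth_dir_deriv. Qed.

Lemma smooth_D_hull a f : smooth f -> smooth (D_hull a f).
Proof. by rewrite D_hullE; exact: smooth_Dseq. Qed.

Lemma Dseq_dir_deriv l t f : smooth f -> Dseq l (dir_deriv t f) = dir_deriv t (Dseq l f).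
Proof.
move=> sf; elim: l => [//|i l IH] /=.
by rewrite IH dir_derivC//; exact: smooth_Dseq.
Qed.

Lemma DseqC l l' f : smooth f -> Dseq l (Dseq l' f) = Dseq l' (Dseq l f).
Proof.
move=> sf; elim: l' => [//|i l' IH] /=.
by rewrite Dseq_dir_deriv ?IH//; exact: smooth_Dseq.
Qed.

Lemma Dseq_cat l l' f : Dseq (l ++ l') f = Dseq l (Dseq l' f).
Proof. exact: foldr_cat. Qed.

Lemma Dseq_perm l l' f : smooth f -> perm_eq l l' -> Dseq l f = Dseq l' f.
Proof.
move=> sf pll'; suff : Dseq l f = Dseq l' f by [].
apply: (@catCA_perm_ind _ (fun k => Dseq l f = Dseq k f) _ l l' pll') => //.
move=> s1 s2 s3 ->; rewrite !Dseq_cat DseqC//; exact: smooth_Dseq.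
Qed.

Lemma D_hullD a b f : smooth f ->
  D_hull a (D_hull b f) = D_hull (fun i => (a i + b i)%N) f.
Proof.
move=> sf; rewrite !D_hullE -Dseq_cat; apply: Dseq_perm => //.
exact: perm_mi_seqD.
Qed.

Lemma Dseq_phi l f s : Dseq l (f \o phi s) = Dseq l f \o phi s.
Proof.
elim: l => [//|i l IH] /=; rewrite IH; apply/funext => A.
exact: dir_deriv_phi.
Qed.

Variable mu : probability Omega R.

Lemma Rintegrable_bounded f M : measurable_fun setT f -> (forall A, `|f A| <= M) ->
  Rintegrable mu f.
Proof.
move=> mf fM; apply: (measurable_bounded_integrable measurableT) => //.
  by rewrite (le_lt_trans (probability_le1 mu measurableT))// ltry.
by exists M; split; [exact: num_real|move=> x Mx A _; exact: le_trans (fM A) (ltW Mx)].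
Qed.

Lemma sq_integrable_bounded f M : measurable_fun setT f -> (forall A, `|f A| <= M) ->
  sq_integrable mu f.
Proof.
move=> mf fM; split=> //; apply: (@Rintegrable_bounded _ (M ^+ 2)).
  exact: measurable_funX2.
by move=> A; rewrite normrX lerXn2r// nnegrE// (le_trans _ (fM A)).
Qed.

Lemma sq_integrable_cst c : sq_integrable mu (fun=> c).
Proof. by apply: (@sq_integrable_bounded _ `|c|) => //; exact: measurable_cst. Qed.

Hypothesis hflc : finite_local_complexity L0.

Lemma smooth_measurable f : smooth f -> measurable_fun setT f.
Proof. by move=> sf; apply: continuous_measurable_pattern; exact: smooth_continuous. Qed.

Lemma smooth_bounded f : smooth f -> exists2 M : R, 0 < M & forall A, `|f A| <= M.
Proof. by move=> sf; apply: continuous_bounded_pattern => //; exact: smooth_continuous. Qed.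

Lemma smooth_sq_integrable f : smooth f -> sq_integrable mu f.
Proof.
move=> sf; have [M _ fM] := smooth_bounded sf.
by apply: sq_integrable_bounded fM; exact: smooth_measurable.
Qed.

Hypothesis inv : translation_invariant mu.

Lemma dir_deriv_by_parts f g t : smooth f -> smooth g ->
  \int[mu]_A (dir_deriv t f A * g A) = - \int[mu]_A (f A * dir_deriv t g A).
Proof.
move=> sf sg.
have [Mf Mf0 fM] := smooth_bounded sf; have [Mg Mg0 gM] := smooth_bounded sg.
have [Nf Nf0 fN] := smooth_bounded (smooth_dir_deriv t sf).
have [Ng Ng0 gN] := smooth_bounded (smooth_dir_deriv t sg).
have qf := smooth_lipschitz sf fN; have qg := smooth_lipschitz sg gN.
apply: (@flow_by_parts _ _ _ mu (fun h : R => phi (h *: t)) f g (dir_deriv t f) (dir_deriv t g)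
  (fun=> Nf * Mg + Mf * Ng)).
- by move=> s; exact: invariant_phi.
- by move=> h A; rewrite phiD scaleNr subrr phi0.
- exact: smooth_measurable.
- exact: smooth_measurable.
- by apply: sq_integrableM; exact: smooth_sq_integrable.
- by apply: (@Rintegrable_bounded _ `|Nf * Mg + Mf * Ng|) => //; exact: measurable_cst.
- by move=> A; exact: (smooth_cvg (A := A)).
- by move=> A; exact: (smooth_cvg (A := A)).
- move=> s A s0 _; rewrite normrM normrM normfV.
  rewrite (@le_trans _ _ (Nf * Mg))//; last by rewrite lerDl mulr_ge0// ltW.
  by rewrite ler_pM// ler_pdivrMr ?normr_gt0.
- move=> s A s0 _; rewrite normrM normrM normfV.
  rewrite (@le_trans _ _ (Mf * Ng))//; last by rewrite lerDr mulr_ge0// ltW.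
  by rewrite ler_pM// ler_pdivrMr ?normr_gt0.
Qed.

Lemma Dseq_by_parts l f g : smooth f -> smooth g ->
  \int[mu]_A (Dseq l f A * g A) = (-1) ^+ size l * \int[mu]_A (f A * Dseq l g A).
Proof.
move=> sf; elim: l g => [|i l IH] g sg /=; first by rewrite mul1r.
rewrite dir_deriv_by_parts//; last exact: smooth_Dseq.
rewrite IH; last exact: smooth_dir_deriv.
by rewrite Dseq_dir_deriv// exprS mulN1r mulNr.
Qed.

Lemma smooth_distr_deriv a f : smooth f -> distr_deriv mu a f (D_hull a f).
Proof.
by move=> sf psi spsi; rewrite !D_hullE Dseq_by_parts// size_mi_seq.
Qed.

Lemma L2P f : L2 mu f <-> sq_integrable mu f.
Proof.
split=> [L2f|[mf /integrableP[_ f2]]].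
  split; first by move: L2f; rewrite /L2/= inE => /andP[]; rewrite inE.
  exact: Lfun2_integrable_sqr.
rewrite /L2/= inE; apply/andP; split; first by rewrite inE.
rewrite inE /= /finite_norm unlock /Lnorm.
rewrite poweR_lty//; apply: le_lt_trans f2.
rewrite le_eqVlt; apply/orP; left; apply/eqP; apply: eq_integral => A _ /=.
by rewrite powR_mulrn// real_normK ?num_real// ger0_norm// sqr_ge0.
Qed.

Lemma L2normE f : sq_integrable mu f -> L2norm mu f = norm2 mu f.
Proof.
move=> [mf f2]; rewrite /L2norm unlock /Lnorm.
rewrite (_ : (\int[mu]_x _)%E = (\int[mu]_x (f x ^+ 2))%:E); last first.
  rewrite -Rint_EFin//; apply: eq_integral => A _ /=.
  by rewrite powR_mulrn// real_normK ?num_real.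
by rewrite poweR_EFin/= powR12_sqrt// Rint_ge0// => x; exact: sqr_ge0.
Qed.

End HullDerivatives.

(** * Convolution along orbits *)

Section Convolution.
Context {R : realType} {d : nat} {L0 : deloneSet R d}.
Local Notation Omega := (pattern_space L0).
Local Notation leb := (lebesgue_rV R d).
Variable mu : probability Omega R.
Hypothesis inv : translation_invariant mu.
Implicit Types (A B : Omega) (x t : 'rV[R]_d) (f g : Omega -> R) (chi : 'rV[R]_d -> R).

(** The convolution of [f] with the reflection of [chi], for the action: along the
    orbit of each pattern it is an ordinary convolution on [R^d]. *)
Definition orbit_conv chi f A : R := \int[leb]_x (f (phi x A) * chi x).

Lemma measurable_action_weight f chi g : measurable_fun setT f ->
  measurable_fun setT chi -> measurable_fun setT g ->
  measurable_fun setT (fun p : 'rV[R]_d * Omega => f (phi p.1 p.2) * chi p.1 * g p.2).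
Proof.
move=> mf mchi mg; apply: measurable_funM; last exact: measurableT_comp.
by apply: measurable_funM; [exact: measurable_action_fun|exact: measurableT_comp].
Qed.

(** Integrating first over the pattern space turns [f (phi x A)] into [f A], by
    invariance; this justifies all the exchanges of integrals below. *)
Lemma conv_product_integrable f chi g (G : R) : Rintegrable mu f -> Rintegrable leb chi ->
  measurable_fun setT g -> (forall A, `|g A| <= G) ->
  (leb \x mu)%E.-integrable setT
    (fun p : 'rV[R]_d * Omega => (f (phi p.1 p.2) * chi p.1 * g p.2)%:E).
Proof.
move=> intf ichi mg gG.
have mf := Rintegrable_meas intf; have mchi := Rintegrable_meas ichi.
apply/integrable12ltyP.
  by apply/measurable_EFinP; exact: measurable_action_weight.
apply: (@le_lt_trans _ _ (\int[leb]_x ((\int[mu]_A `|f A|) * G * `|chi x|)%:E)%E).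
  apply: ge0_le_integral => //.
  - by move=> x _; exact: integral_ge0.
  - apply: (measurable_fun_fubini_tonelli_F (m2 := mu)
      (fun p : 'rV[R]_d * Omega => `|(f (phi p.1 p.2) * chi p.1 * g p.2)%:E|%E)) => //.
    apply: measurableT_comp => //; apply/measurable_EFinP; exact: measurable_action_weight.
  - by apply/measurable_EFinP; apply: measurable_funM => //; exact: measurableT_comp.
  - move=> x _ /=.
    have ifx : Rintegrable mu (fun A => `|f (phi x A)|).
      apply: (measure_preserving_Rintegrable (invariant_phi x inv) (f := fun A => `|f A|)).
      exact: Rintegrable_abs.
    apply: (@le_trans _ _ (\int[mu]_A ((G * `|chi x|) * `|f (phi x A)|)%:E)%E).
      apply: ge0_le_integral => //.
      + apply/measurable_EFinP; apply: measurableT_comp => //.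
        apply: measurable_funM => //; apply: measurable_funM => //.
        exact: measurable_fun_phi.
      + apply/measurable_EFinP; apply: measurable_funM => //.
        exact: (Rintegrable_meas ifx).
      + move=> A _; rewrite lee_fin !normrM mulrC -mulrA [`|f _| * _]mulrC.
        by rewrite [leRHS]mulrA mulrA ler_wpM2r// ler_wpM2r.
    rewrite Rint_EFin; last exact: RintegrableZ.
    rewrite RintZ// lee_fin.
    rewrite (measure_preserving_Rint (invariant_phi x inv) (f := fun A => `|f A|)).
      by rewrite le_eqVlt; apply/orP; left; apply/eqP; ring.
    exact: measurableT_comp.
rewrite Rint_EFin ?ltry//; apply: RintegrableZ; exact: Rintegrable_abs.
Qed.

Lemma conv_product_integrable1 f chi : Rintegrable mu f -> Rintegrable leb chi ->
  (leb \x mu)%E.-integrable setT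
    (fun p : 'rV[R]_d * Omega => (f (phi p.1 p.2) * chi p.1)%:E).
Proof.
move=> intf ichi.
have := @conv_product_integrable f chi (fun=> 1) 1 intf ichi (measurable_cst _)
  (fun _ => ltac:(by rewrite normr1)).
by congr (_.-integrable _ _); apply/funext => p /=; rewrite mulr1.
Qed.

Lemma conv_ae_integrable f chi : Rintegrable mu f -> Rintegrable leb chi ->
  {ae mu, forall A, Rintegrable leb (fun x => f (phi x A) * chi x)}.
Proof.
move=> intf ichi; exact: (ae_integrable2 (conv_product_integrable1 intf ichi)).
Qed.

Lemma measurable_conv f chi : Rintegrable mu f -> Rintegrable leb chi ->
  measurable_fun setT (orbit_conv chi f).
Proof.
move=> intf ichi; have := measurable_fubini_G (conv_product_integrable1 intf ichi).
exact: (measurableT_comp (fine_measurable measurableT)).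
Qed.

Lemma Rintegrable_conv f chi : Rintegrable mu f -> Rintegrable leb chi ->
  Rintegrable mu (orbit_conv chi f).
Proof.
move=> intf ichi; have mc := measurable_conv intf ichi.
have /integrable21ltyP := conv_product_integrable1 intf ichi.
have mF : measurable_fun setT (fun p : 'rV[R]_d * Omega => (f (phi p.1 p.2) * chi p.1)%:E).
  by apply/measurable_EFinP; apply: measurable_funM; [exact: measurable_action_fun
    (Rintegrable_meas intf)|exact: measurableT_comp (Rintegrable_meas ichi) _].
move=> /(_ mF) foo; apply: Rintegrable_fin => //; apply: le_lt_trans foo.
apply: ge0_le_integral => //.
- by apply: measurableT_comp => //; exact/measurable_EFinP.
- apply: (measurable_fun_fubini_tonelli_G (m1 := leb)
    (fun p : 'rV[R]_d * Omega => `|(f (phi p.1 p.2) * chi p.1)%:E|%E)) => //.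
  exact: measurableT_comp.
move=> A _ /=.
have mFA : measurable_fun setT (fun x => f (phi x A) * chi x).
  by apply: measurable_funM; [exact: measurable_fun_orbit (Rintegrable_meas intf)
    |exact: Rintegrable_meas ichi].
have [iA|niA] := pselect (Rintegrable leb (fun x => f (phi x A) * chi x)).
  rewrite (Rint_EFin (Rintegrable_abs iA)) lee_fin; exact: Rint_abs.
rewrite (_ : (\int[leb]_x _)%E = +oo%E) ?leey//.
apply/eqP; rewrite eq_le leey /= leNgt; apply/negP => foo; apply: niA.
exact: Rintegrable_fin.
Qed.

Lemma Rint_conv f chi g (G : R) : Rintegrable mu f -> Rintegrable leb chi ->
  measurable_fun setT g -> (forall A, `|g A| <= G) ->
  \int[mu]_A (orbit_conv chi f A * g A) = \int[leb]_x (chi x * \int[mu]_A (f (phi x A) * g A)).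
Proof.
move=> intf ichi mg gG.
have mf := Rintegrable_meas intf; have mchi := Rintegrable_meas ichi.
have /Fubini E := conv_product_integrable intf ichi mg gG.
transitivity (fine (\int[mu]_A \int[leb]_x (f (phi x A) * chi x * g A)%:E)%E).
  rewrite /Rintegral; congr fine; apply: ae_eq_integral => //.
  - by apply/measurable_EFinP/measurable_funM => //; exact: measurable_conv.
  - exact: (measurable_fubini_G (conv_product_integrable intf ichi mg gG)).
  - apply: filterS (conv_ae_integrable intf ichi) => A iA _.
    rewrite (_ : (fun x => (f (phi x A) * chi x * g A)%:E) =
      (fun x => (g A * (f (phi x A) * chi x))%:E)).
      by rewrite Rint_EFin ?RintZ 1?mulrC//; exact: RintegrableZ.
    by apply/funext => x; rewrite mulrC.
rewrite -[X in fine X = _]E /Rintegral; congr fine; apply: eq_integral => x _ /=.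
have ifx : Rintegrable mu (fun A => f (phi x A) * g A).
  apply: (@Rintegrable_le _ _ _ mu _ (fun A => G * f (phi x A))).
  - by apply: measurable_funM => //; exact: measurable_fun_phi.
  - by move=> A; rewrite !normrM mulrC ler_wpM2r// (le_trans (gG A))// ler_norm.
  - apply: RintegrableZ.
    exact: (measure_preserving_Rintegrable (invariant_phi x inv) (f := f)).
rewrite -RintZ// -Rint_EFin; last exact: RintegrableZ.
by apply: eq_integral => A _ /=; congr (_%:E); ring.
Qed.

Lemma sq_integrable_Rintegrable f : sq_integrable mu f -> Rintegrable mu f.
Proof.
move=> sf; have := sq_integrableM sf (sq_integrable_cst mu 1).
by congr Rintegrable; apply/funext => A; rewrite mulr1.
Qed.

Lemma Rint_conv1 f chi : Rintegrable mu f -> Rintegrable leb chi ->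
  \int[mu]_A orbit_conv chi f A = \int[leb]_x chi x * \int[mu]_A f A.
Proof.
move=> intf ichi.
have := @Rint_conv f chi (fun=> 1) 1 intf ichi (measurable_cst _)
  (fun _ => ltac:(by rewrite normr1)).
under eq_Rint do rewrite mulr1.
move=> ->; rewrite mulrC -RintZ//; apply: eq_Rint => x; rewrite mulrC; congr (_ * _).
under eq_Rint do rewrite mulr1.
by rewrite (measure_preserving_Rint (invariant_phi x inv))//; exact: Rintegrable_meas intf.
Qed.

(** Young's inequality, from the Cauchy-Schwarz inequality for the weight. *)
Lemma conv_young f chi : sq_integrable mu f -> Rintegrable leb chi ->
  sq_integrable mu (orbit_conv chi f) /\
  norm2 mu (orbit_conv chi f) <= \int[leb]_x `|chi x| * norm2 mu f.
Proof.
move=> sf ichi; have intf := sq_integrable_Rintegrable sf.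
have [mf if2] := sf.
have ichi1 : Rintegrable leb (fun x => `|chi x|) by exact: Rintegrable_abs.
pose N := \int[leb]_x `|chi x|.
have N0 : 0 <= N by exact: Rint_ge0.
have mconv := measurable_conv intf ichi.
pose f2 A := f A ^+ 2.
have CS : {ae mu, forall A, orbit_conv chi f A ^+ 2 <= N * orbit_conv (fun x => `|chi x|) f2 A}.
  apply: filterS2 (conv_ae_integrable if2 ichi1) (conv_ae_integrable intf ichi) => A i2 i1.
  have i3 : Rintegrable leb (fun x => `|f (phi x A)| * `|chi x|).
    have := Rintegrable_abs i1; congr Rintegrable.
    by apply/funext => x; rewrite normrM.
  have := @Rint_weighted_sqr _ _ _ leb (fun x => `|f (phi x A)|) (fun x => `|chi x|)
    (fun x => normr_ge0 _) ichi1 i3.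
  rewrite (_ : (fun x => `|f (phi x A)| ^+ 2 * `|chi x|) = (fun x => f2 (phi x A) * `|chi x|)).
    move=> /(_ i2); apply: le_trans.
    rewrite -[leLHS]real_normK ?num_real// lerXn2r ?nnegrE//.
      by apply: Rint_ge0 => x; rewrite mulr_ge0.
    rewrite (le_trans (Rint_abs i1))// le_eqVlt; apply/orP; left; apply/eqP.
    by apply: eq_Rint => x; rewrite normrM.
  by apply/funext => x; rewrite real_normK ?num_real.
have iN : Rintegrable mu (fun A => N * orbit_conv (fun x => `|chi x|) f2 A).
  by apply: RintegrableZ; exact: Rintegrable_conv.
have ic : Rintegrable mu (fun A => orbit_conv chi f A ^+ 2).
  apply: Rintegrable_ae_le iN; first exact: measurable_funX2.
  by apply: filterS CS => A; rewrite ger0_norm ?sqr_ge0.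
split => //.
rewrite -ler_sqr ?nnegrE ?mulr_ge0 ?norm2_ge0// exprMn !norm2_sqr.
rewrite (le_trans (Rint_ae_le ic iN CS))// RintZ; last exact: Rintegrable_conv.
by rewrite Rint_conv1// mulrA.
Qed.

Lemma conv_sq_integrable f chi : sq_integrable mu f -> Rintegrable leb chi ->
  sq_integrable mu (orbit_conv chi f).
Proof. by move=> sf ichi; case: (conv_young sf ichi). Qed.

Lemma conv_ae_lin (c : R) f g chi : Rintegrable mu f -> Rintegrable mu g ->
  Rintegrable leb chi -> {ae mu, forall A,
    orbit_conv chi (fun A => c * f A + g A) A = c * orbit_conv chi f A + orbit_conv chi g A}.
Proof.
move=> intf intg ichi.
apply: filterS2 (conv_ae_integrable intf ichi) (conv_ae_integrable intg ichi) => A iA jA.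
rewrite /orbit_conv -RintZ// -RintD//; last exact: RintegrableZ.
by apply: eq_Rint => x; rewrite mulrDl mulrA.
Qed.

Lemma conv_ae_sub f g chi : Rintegrable mu f -> Rintegrable mu g -> Rintegrable leb chi ->
  {ae mu, forall A, orbit_conv chi (fun A => f A - g A) A = orbit_conv chi f A - orbit_conv chi g A}.
Proof.
move=> intf intg ichi; apply: filterS (conv_ae_lin (-1) intg intf ichi) => A.
rewrite mulN1r addrC => <-; apply: eq_Rint => x.
by rewrite mulN1r addrC.
Qed.

Lemma norm2_conv_sub f g chi : sq_integrable mu f -> sq_integrable mu g ->
  Rintegrable leb chi -> norm2 mu (fun A => orbit_conv chi f A - orbit_conv chi g A) <=
  \int[leb]_x `|chi x| * norm2 mu (fun A => f A - g A).
Proof.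
move=> sf sg ichi.
have [sc] := conv_young (sq_integrableB sf sg) ichi; apply: le_trans.
have [mf _] := conv_sq_integrable sf ichi; have [mg _] := conv_sq_integrable sg ichi.
rewrite (norm2_ae_eq (measurable_funB mf mg) (proj1 sc))//.
have := conv_ae_sub (sq_integrable_Rintegrable sf) (sq_integrable_Rintegrable sg) ichi.
by apply: filterS => A ->.
Qed.

End Convolution.

(** * Smoothing of local functions *)

Section KernelConvolution.
Context {R : realType} {d : nat} {L0 : deloneSet R d}.
Local Notation Omega := (pattern_space L0).
Local Notation leb := (lebesgue_rV R d).
Implicit Types (A B : Omega) (x s t : 'rV[R]_d) (b : Omega -> R) (chi : 'rV[R]_d -> R).

Lemma kernel_lipschitz r chi : smooth_kernel r chi -> exists2 L : R, 0 < L &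
  (forall x, `|chi x| <= L) /\ forall x y, `|chi x - chi y| <= L * `|x - y|.
Proof. by move=> [/flat_algebra_lipschitz]. Qed.

Lemma lipschitz_continuous (f : 'rV[R]_d -> R) (L : R) : 0 < L ->
  (forall x y, `|f x - f y| <= L * `|x - y|) -> continuous f.
Proof.
move=> L0' fL x U /nbhs_ballP[e /= e0 eU]; apply/nbhs_ballP.
exists (L^-1 * e) => /=; first by rewrite mulr_gt0// invr_gt0.
move=> y; rewrite -ball_normE /= => xy; apply: eU; rewrite -ball_normE /=.
by rewrite (le_lt_trans (fL x y))// -ltr_pdivlMl.
Qed.

Lemma measurable_kernel r chi : smooth_kernel r chi -> measurable_fun setT chi.
Proof.
move=> /kernel_lipschitz[L L0' [_ lip]].
exact: continuous_measurable_rV (lipschitz_continuous L0' lip).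
Qed.

Lemma supported_in_shift r (tau : R) chi s x : supported_in r chi -> 0 <= tau -> `|s| <= tau ->
  ~ cube (`|r| + tau + 1) x -> chi (x - s) = 0.
Proof.
move=> schi tau0 stau /existsNP[i /negP]; rewrite -leNgt => xi.
apply: (schi _ i); rewrite !mxE.
have := normr_coord s i; have := lerB_dist (x ord0 i) (s ord0 i).
have := ler_norm r; move: xi stau.
move: `|x ord0 i| `|s ord0 i| `|_ - _| `|r| `|s| => a1 a2 a3 a4 a5; lra.
Qed.

Lemma supported_in_cube r chi x : supported_in r chi -> ~ cube (`|r| + 1) x -> chi x = 0.
Proof.
move=> schi xr; rewrite -[x]subr0; apply: (supported_in_shift schi (lexx 0)).
  by rewrite normr0.
by rewrite addr0.
Qed.

Lemma kernel_integrable r chi : smooth_kernel r chi -> Rintegrable leb chi.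
Proof.
move=> k; have [L _ [chiL _]] := kernel_lipschitz k; have [_ schi] := k.
apply: (@Rintegrable_supported _ _ chi (`|r| + 1) L) => //.
- exact: measurable_kernel k.
- by move=> x; exact: supported_in_cube schi.
Qed.

Lemma ler_norm_enorm x : `|x| <= enorm x.
Proof.
rewrite [`|x|]mx_normrE; apply: bigmax_le => [|[i j] _]; first exact: enorm_ge0.
by rewrite (ord1 i); exact: ler_coord_enorm.
Qed.

Lemma conv_translate chi b A s : measurable_fun setT b -> measurable_fun setT chi ->
  orbit_conv chi b (phi s A) = \int[leb]_x (b (phi x A) * chi (x - s)).
Proof.
move=> mb mchi.
have mf : measurable_fun setT (fun x => b (phi x A) * chi (x - s)).
  apply: measurable_funM; first exact: measurable_fun_orbit.
  by apply: measurableT_comp mchi _; exact: measurable_translate.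
rewrite -(measure_preserving_Rint (lebesgue_rV_preserving s) mf).
by apply: eq_Rint => x; rewrite phiD addrK.
Qed.

(** A shift along the orbit can be moved to the kernel, whose Lipschitz bound the
    convolution inherits. *)
Lemma conv_lipschitz chi b (r M : R) : smooth_kernel r chi -> measurable_fun setT b ->
  (forall A, `|b A| <= M) -> exists2 C : R, 0 < C & forall A s, `|s| <= 1 ->
    `|orbit_conv chi b (phi s A) - orbit_conv chi b A| <= C * `|s|.
Proof.
move=> k mb bM; have [L L0' [chiL lip]] := kernel_lipschitz k; have [_ schi] := k.
have mchi := measurable_kernel k.
have rho0 : 0 < `|r| + 1 + 1 by rewrite ltr_wpDl// ltr_wpDl.
have M0 : 0 <= M by rewrite (le_trans _ (bM point)).
pose V : R := \int[leb]_x (\1_(cube (`|r| + 1 + 1)) x).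
have V0 : 0 <= V by apply: Rint_ge0 => x; rewrite indicE.
exists (M * L * V + 1); first by rewrite ltr_wpDl// !mulr_ge0// ltW.
move=> A s s1; rewrite conv_translate//.
have iu : Rintegrable leb (fun x => b (phi x A) * chi (x - s)).
  apply: (@Rintegrable_supported _ _ _ (`|r| + 1 + 1) (M * L)) => //.
  - apply: measurable_funM; first exact: measurable_fun_orbit.
    by apply: measurableT_comp mchi _; exact: measurable_translate.
  - by move=> x xr; rewrite (supported_in_shift schi ler01 s1 xr) mulr0.
  - by move=> x; rewrite normrM ler_pM.
have iv : Rintegrable leb (fun x => b (phi x A) * chi x).
  apply: (@Rintegrable_supported _ _ _ (`|r| + 1) (M * L)) => //.
  - by apply: measurable_funM => //; exact: measurable_fun_orbit.
  - by move=> x xr; rewrite (supported_in_cube schi xr) mulr0.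
  - by move=> x; rewrite normrM ler_pM.
rewrite -RintB// (le_trans (Rint_abs (RintegrableB iu iv)))//.
apply: (@le_trans _ _ (\int[leb]_x ((M * L * `|s|) * \1_(cube (`|r| + 1 + 1)) x))).
  apply: Rint_le.
  - exact: Rintegrable_abs (RintegrableB iu iv).
  - exact: RintegrableZ (Rintegrable_cube rho0).
  - move=> x; rewrite indicE; case: (boolP (x \in _)) => xr.
      rewrite mulr1 -mulrBr normrM -mulrA ler_pM//.
      by rewrite (le_trans (lip _ _))// addrAC subrr add0r normrN.
    have {}xr : ~ cube (`|r| + 1 + 1) x by move: xr; rewrite notin_setE.
    have h0 : chi x = 0.
      by rewrite -[x]subr0; apply: (supported_in_shift schi ler01 _ xr); rewrite normr0.
    by rewrite (supported_in_shift schi ler01 s1 xr) h0 !mulr0 subrr normr0.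
rewrite RintZ; last exact: Rintegrable_cube.
rewrite mulrDl mul1r -/V mulrAC lerDl//.
Qed.

Definition local_fun (r : R) b :=
  forall A B, (forall x, enorm x < r -> pts A x <-> pts B x) -> b A = b B.

Lemma supported_enorm r chi : supported_in r chi -> exists2 rho : R, 0 < rho &
  forall x, chi x != 0 -> enorm x < rho.
Proof.
move=> schi; have r0 : 0 < `|r| + 1 by rewrite ltr_wpDl.
exists (d.+1%:R * (`|r| + 1)); first by rewrite mulr_gt0.
move=> x chix; apply: enorm_lt_coord; first by rewrite mulr_gt0.
move=> i; rewrite mulrC mulKf//.
have xr : cube (`|r| + 1) x.
  by apply: contrapT => /(supported_in_cube schi) h; rewrite h eqxx in chix.
exact: xr.
Qed.

Lemma conv_local chi b (r' rho : R) : (forall x, chi x != 0 -> enorm x < rho) ->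
  local_fun r' b -> local_fun (r' + rho) (orbit_conv chi b).
Proof.
move=> srho lb A B AB; apply: eq_Rint => x.
have [->|/srho xrho] := eqVneq (chi x) 0; first by rewrite !mulr0.
congr (_ * _); apply: lb => y yr; rewrite !pts_phi; apply: AB.
by rewrite (le_lt_trans (ler_enormD _ _))// ltrD.
Qed.

(** A pattern close to [A] has a small shift that agrees on a large ball with a small
    shift of [A]. Locality equates the values at the two shifted patterns, and the
    Lipschitz bound along orbits controls the effect of the shifts. *)
Lemma conv_local_continuous chi b (r r' M : R) : smooth_kernel r chi -> measurable_fun setT b ->
  (forall A, `|b A| <= M) -> 0 < r' -> local_fun r' b -> continuous (orbit_conv chi b).
Proof.
move=> k mb bM r'0 lb A.
have [C C0 lip] := conv_lipschitz k mb bM.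
have [rho rho0 srho] := supported_enorm (proj2 k).
have lc := conv_local srho lb.
move=> U /nbhs_ballP[e /= e0 eU]; apply/nbhs_pattern.
have X0 : 0 < r' + rho by rewrite addr_gt0.
pose dl := Num.min (Num.min 1 (e / (2 * C))) (r' + rho)^-1.
have dl0 : 0 < dl by rewrite !lt_min ltr01 invr_gt0 X0 divr_gt0// mulr_gt0.
have h1 : dl <= 1 by rewrite !ge_min lexx.
have h2 : C * dl <= e / 2.
  by rewrite -ler_pdivlMl// mulrA [C^-1 * _]mulrC -mulrA -invfM [C * 2]mulrC !ge_min lexx orbT.
have h3 : r' + rho <= dl^-1.
  by rewrite -[leLHS]invrK lef_pV2 ?posrE ?invr_gt0// !ge_min lexx ?orbT.
exists dl => // B AB0; apply: eU; rewrite -ball_normE /=; move: AB0 => /agreeE[_ [s [s' [se s'e AB]]]].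
have E : orbit_conv chi b (phi s A) = orbit_conv chi b (phi s' B).
  apply: lc => x xr; rewrite !pts_phi; apply: AB; exact: lt_le_trans h3.
have ns : `|s| < dl by rewrite (le_lt_trans (ler_norm_enorm _)).
have ns' : `|s'| < dl by rewrite (le_lt_trans (ler_norm_enorm _)).
have l1 := lip A s (ltW (lt_le_trans ns h1)).
have l2 := lip B s' (ltW (lt_le_trans ns' h1)).
have m1 : C * `|s| < e / 2 by apply: lt_le_trans h2; rewrite ltr_pM2l.
have m2 : C * `|s'| < e / 2 by apply: lt_le_trans h2; rewrite ltr_pM2l.
rewrite E in l1; rewrite (_ : orbit_conv chi b A - orbit_conv chi b B =
  (orbit_conv chi b (phi s' B) - orbit_conv chi b B) - (orbit_conv chi b (phi s' B) - orbit_conv chi b A)); last by ring.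
rewrite (le_lt_trans (ler_normB _ _))//.
clear -l1 l2 m1 m2; lra.
Qed.

(** Differentiation along orbits falls on the kernel. *)
Lemma conv_derive chi (r : R) t : smooth_kernel r chi -> exists2 chi', smooth_kernel r chi' &
  forall b (M : R), measurable_fun setT b -> (forall A, `|b A| <= M) ->
    forall A, diff_quot t (orbit_conv chi b) A h @[h --> 0^'] --> orbit_conv chi' b A.
Proof.
move=> k; have [chi' k' dchi] := kernel_derive (- t) k.
exists chi' => // b M mb bM A.
have [L L0' [chiL lip]] := kernel_lipschitz k; have [_ schi] := k.
have mchi := measurable_kernel k.
have M0 : 0 <= M by rewrite (le_trans _ (bM point)).
have tau0 : 0 <= `|t| by [].
have rho0 : 0 < `|r| + `|t| + 1 by rewrite ltr_wpDl// addr_ge0.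
have mbo := measurable_fun_orbit A mb.
have mchih h : measurable_fun setT (fun x => chi (x - h *: t)).
  by apply: measurableT_comp mchi _; exact: measurable_translate.
have iu (h : R) : `|h| <= 1 -> Rintegrable leb (fun x => b (phi x A) * chi (x - h *: t)).
  move=> h1; apply: (@Rintegrable_supported _ _ _ (`|r| + `|t| + 1) (M * L)) => //.
  - exact: measurable_funM.
  - move=> x xr; rewrite (supported_in_shift schi tau0 _ xr) ?mulr0//.
    by rewrite normrZ ler_piMl.
  - by move=> x; rewrite normrM ler_pM.
have i0 : Rintegrable leb (fun x => b (phi x A) * chi x).
  have := iu 0 ltac:(by rewrite normr0); congr Rintegrable.
  by apply/funext => x; rewrite scale0r subr0.
pose F (h : R) x := b (phi x A) * ((chi (x - h *: t) - chi x) / h).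
have mF h : measurable_fun setT (F h).
  by apply: measurable_funM => //; apply: measurable_funM => //; exact: measurable_funB.
have bF h x : h != 0 -> `|h| <= 1 ->
    `|F h x| <= (M * (L * `|t|)) * \1_(cube (`|r| + `|t| + 1)) x.
  move=> h0 h1; have ht : `|h *: t| <= `|t| by rewrite normrZ ler_piMl.
  rewrite indicE; case: (boolP (x \in _)) => xr.
    rewrite mulr1 /F normrM ler_pM// normrM normfV ler_pdivrMr ?normr_gt0//.
    rewrite (le_trans (lip _ _))// addrAC subrr add0r normrN normrZ.
    by rewrite -mulrA [`|t| * _]mulrC.
  have {}xr : ~ cube (`|r| + `|t| + 1) x by move: xr; rewrite notin_setE.
  have hx : chi x = 0.
    by rewrite -[x]subr0; apply: (supported_in_shift schi tau0 _ xr); rewrite normr0.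
  by rewrite /F (supported_in_shift schi tau0 ht xr) hx subrr mul0r !mulr0 normr0.
have pF x : F h x @[h --> 0^'] --> b (phi x A) * chi' x.
  apply: cvgM; first exact: cvg_cst.
  have [dx <-] := dchi x; apply: cvg_trans dx; apply: near_eq_cvg.
  near=> h; rewrite /= scalerN [- _ + _]addrC.
  by rewrite /GRing.scale /= mulrC.
have [_ cF] := Rint_dnbhs_cvg mF (RintegrableZ _ (Rintegrable_cube rho0)) bF pF.
rewrite -[X in _ --> X]/(\int[leb]_x (b (phi x A) * chi' x)).
apply: cvg_trans cF; apply: near_eq_cvg.
near=> h.
have h0 : h != 0 by near: h; exact: nbhs_dnbhs_neq.
have h1 : `|h| <= 1 by near: h; exact: dnbhs0_le.
rewrite /diff_quot conv_translate// -RintB ?iu//.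
rewrite mulrC -RintZ; last exact: RintegrableB (iu _ h1) i0.
apply: eq_Rint => x; rewrite /F; ring.
Unshelve. all: by end_near.
Qed.

(** The functions that are smoothed below. They need not be continuous, yet their
    convolutions are smooth: kernels take care of the derivatives along the orbits,
    and transversally there is nothing to differentiate. *)
Definition local_bounded b := [/\ measurable_fun setT b,
  exists M : R, forall A, `|b A| <= M & exists2 r : R, 0 < r & local_fun r b].

Lemma conv_smooth chi (r : R) b : smooth_kernel r chi -> local_bounded b ->
  smooth (orbit_conv chi b).
Proof.
move=> k [mb [M bM] [r' r'0 lb]].
apply: (@smooth_class _ _ _
  (fun f => exists2 chi, smooth_kernel r chi & f = orbit_conv chi b)); last by exists chi.
- by move=> _ [chi1 k1 ->]; exact: conv_local_continuous k1 mb bM r'0 lb.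
- move=> _ t [chi1 k1 ->]; have [chi2 k2 d12] := conv_derive t k1.
  exists (orbit_conv chi2 b); first by exists chi2.
  by move=> A; exact: d12 mb bM A.
Qed.

Lemma conv_smooth_tlc chi (r : R) b : smooth_kernel r chi -> local_bounded b ->
  smooth_tlc (orbit_conv chi b).
Proof.
move=> k lb; have sc := conv_smooth k lb; split=> //; split; first exact: smooth_continuous.
have [_ _ [r' r'0 {}lb]] := lb; have [rho rho0 srho] := supported_enorm (proj2 k).
have X0 : 0 < r' + rho by rewrite addr_gt0.
move=> A; exists (r' + rho)^-1; first by rewrite invr_gt0.
rewrite invrK => B /seteqP[BA AB]; apply: (conv_local srho lb) => x xr.
have xb : eball 0 (r' + rho) x by rewrite /eball/= subr0.
by split=> h; [have [] := BA x (conj xb h)|have [] := AB x (conj xb h)].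
Qed.

(** The kernel [chi'] does not depend on [b], so that the identity extends to limits
    of local functions. *)
Lemma conv_Dseq chi (r : R) l : smooth_kernel r chi -> exists2 chi', smooth_kernel r chi' &
  forall b, local_bounded b -> Dseq l (orbit_conv chi b) = orbit_conv chi' b.
Proof.
move=> k; elim: l => [|i l [chi1 k1 d1]]; first by exists chi.
have [chi2 k2 d2] := conv_derive (basis_vec R i) k1; exists chi2 => // b lb /=.
rewrite d1//; apply/funext => A; apply/cvg_lim => //.
by have [mb [M bM] _] := lb; exact: d2 mb bM A.
Qed.

End KernelConvolution.

(** * Density of local functions *)

Section DominatedNorm.
Context {dT : measure_display} {T : measurableType dT} {R : realType}.
Variable m : {measure set T -> \bar R}.

Lemma norm2_dominated_cvg (u : nat -> T -> R) f G :
  (forall n, measurable_fun setT (u n)) -> sq_integrable m G ->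
  (forall n x, `|u n x| <= G x) -> (forall x, u n x @[n --> \oo] --> f x) ->
  sq_integrable m f /\ norm2 m (fun x => u n x - f x) @[n --> \oo] --> (0 : R).
Proof.
move=> mu [mG iG2] uG uf.
have mf : measurable_fun setT f.
  by apply: (measurable_fun_cvg mu) => x _; exact: uf.
have fG x : `|f x| <= G x.
  have c : `|u n x| @[n --> \oo] --> `|f x| by exact: cvg_norm (uf x).
  rewrite -(cvg_lim _ c)//.
  apply: limr_le; first by apply/cvg_ex; exists `|f x|.
  by apply: nearW => n; exact: uG.
have G0 x : 0 <= G x by rewrite (le_trans _ (uG 0%N x)).
split.
  split=> //; apply: Rintegrable_le (measurable_funX2 mf) _ iG2 => x.
  by rewrite !normrX lerXn2r// ?nnegrE// (le_trans (fG x))// ler_norm.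
have bnd n x : `|(u n x - f x) ^+ 2| <= 4 * G x ^+ 2.
  have := ler_normB (u n x) (f x); rewrite normrX => h.
  rewrite (_ : 4 * _ = (G x + G x) ^+ 2); last by ring.
  by rewrite lerXn2r// ?nnegrE ?addr_ge0// (le_trans h)// lerD.
have cv x : (u n x - f x) ^+ 2 @[n --> \oo] --> (0 : R).
  have h : u n x - f x @[n --> \oo] --> (0 : R).
    by rewrite -(subrr (f x)); apply: cvgB (uf x) (cvg_cst _).
  by rewrite -[X in _ --> X](mulr0 (0 : R)); exact: (cvgM h h).
have [_] := @Rint_dominated_cvg _ _ _ m (fun n x => (u n x - f x) ^+ 2) (fun=> 0)
  (fun x => 4 * G x ^+ 2)
  (fun n => measurable_funX2 (measurable_funB (mu n) mf)) (RintegrableZ 4 iG2)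
  bnd cv.
move=> h; rewrite -[X in _ --> X](@sqrtr0 R) -[in Num.sqrt 0](Rint_cst0 m).
by apply: (cvg_comp _ _ h); exact: sqrt_continuous.
Qed.

End DominatedNorm.

Import HBNNSimple.

Section ClosedClass.
Context {R : realType} {d : nat} {L0 : deloneSet R d}.
Local Notation Omega := (pattern_space L0).
Variable mu : probability Omega R.
Implicit Types (A : Omega) (f g : Omega -> R).

Variable P : (Omega -> R) -> Prop.
Hypothesis PD : forall (c : R) f g, sq_integrable mu f -> sq_integrable mu g ->
  P f -> P g -> P (fun A => c * f A + g A).
Hypothesis Pcvg : forall (u : nat -> Omega -> R) f, (forall n, sq_integrable mu (u n)) ->
  sq_integrable mu f -> (forall n, P (u n)) ->
  norm2 mu (fun A => u n A - f A) @[n --> \oo] --> (0 : R) -> P f.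
Hypothesis Popen : forall U : set Omega, open U -> P (\1_U).

Lemma sq_integrable_indic (U : set Omega) : measurable U -> sq_integrable mu (\1_U).
Proof.
move=> mU; apply: (sq_integrable_bounded mu _ (@norm_indic_le1 _ _ R U)).
exact: measurable_indic.
Qed.

Lemma class_measurable (B : set Omega) : measurable B -> P (\1_B).
Proof.
move=> mB; suff [] : [set B : set Omega | measurable B /\ P (\1_B)] B by [].
apply: (@lambda_system_subset _ (@open Omega) _ setT [set B : set Omega | measurable B /\ P (\1_B)]) mB => //.
- by move=> U V oU oV; exact: openI.
- split=> //.
  + by split=> //; apply: Popen; exact: openT.
  + move=> U V VU [mU PU] [mV PV]; split; first exact: measurableD.
    have := PD (-1) (sq_integrable_indic mV) (sq_integrable_indic mU) PV PU.
    congr P; apply/funext => A; rewrite !indicE in_setD.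
    have := VU A; rewrite -[V A]in_setE -[U A]in_setE.
    by case: (A \in V); case: (A \in U) => //= h; rewrite ?mulr1 ?mulr0 ?addNr ?add0r//; have := h erefl.
  + move=> F ndF FP; have mF n : measurable (F n) by case: (FP n).
    split; first exact: bigcupT_measurable.
    have cvF A : \1_(F n) A @[n --> \oo] --> (\1_(\bigcup_n F n) A : R).
      apply: cvg_near_cst; case: (pselect ((\bigcup_n F n) A)) => [FA|nFA].
        have [n _ FnA] := FA; exists n => // k /= nk.
        rewrite !indicE !mem_set//.
        by have /subsetPset := ndF n k nk; exact.
      apply: nearW => n; rewrite !indicE !memNset// => FnA; apply: nFA; by exists n.
    have mI n : measurable_fun setT (\1_(F n) : Omega -> R) by exact: measurable_indic.
    have [sF cF] := @norm2_dominated_cvg _ _ _ mu (fun n => \1_(F n)) (\1_(\bigcup_n F n)) (fun=> 1)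
      mI (sq_integrable_cst mu 1)
      (fun n => @norm_indic_le1 _ _ R (F n))
      cvF.
    apply: Pcvg cF => // n; last by case: (FP n).
    exact: sq_integrable_indic.
- by move=> U oU; split; [exact: open_measurable_pattern|exact: Popen].
Qed.

Lemma class_zero : P (fun=> 0).
Proof. by have := Popen open0; rewrite indic0. Qed.

Lemma class_sum I (s : seq I) (c : I -> R) (B : I -> set Omega) :
  (forall i, measurable (B i)) ->
  sq_integrable mu (fun A => \sum_(i <- s) c i * \1_(B i) A) /\
  P (fun A => \sum_(i <- s) c i * \1_(B i) A).
Proof.
move=> mB; elim: s => [|i s [sIH IH]].
  rewrite (_ : (fun A => _) = fun=> 0); first by split; [exact: sq_integrable0|exact: class_zero].
  by apply/funext => A; rewrite big_nil.
rewrite (_ : (fun A => _) = fun A => c i * \1_(B i) A + \sum_(i <- s) c i * \1_(B i) A); last first.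
  by apply/funext => A; rewrite big_cons.
have sB := sq_integrable_indic (mB i).
split; first by apply: sq_integrableD => //; exact: sq_integrableZ.
by apply: PD => //; exact: class_measurable.
Qed.

Lemma class_nneg f : sq_integrable mu f -> (forall A, 0 <= f A) -> P f.
Proof.
move=> sf f0; have [mf _] := sf.
have mEf : measurable_fun setT (EFin \o f) by exact/measurable_EFinP.
pose u := nnsfun_approx measurableT mEf.
have uf A : u n A @[n --> \oo] --> f A.
  have /(_ A Logic.I) := cvg_nnsfun_approx measurableT mEf (fun A _ => f0 A).
  by move=> /fine_cvgP[].
have ule n A : u n A <= f A.
  have ndu : nondecreasing_seq (u ^~ A).
    by move=> p q pq; have /lefP := nd_nnsfun_approx measurableT mEf pq; exact.
  rewrite -(cvg_lim _ (uf A))//; apply: nondecreasing_cvgn_le => //.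
  by apply/cvg_ex; exists (f A); exact: uf.
have uE n : (u n : Omega -> R) = fun A => \sum_(y <- finmap.enum_fset (fset_set (range (u n))))
    y * \1_(u n @^-1` [set y]) A.
  by apply/funext => A; rewrite fimfunE fsbig_finite.
have [_ cu] := @norm2_dominated_cvg _ _ _ mu u f f (fun n => measurable_funPT (u n)) sf
  (fun n A => ltac:(by rewrite ger0_norm ?ule)) uf.
have su n : sq_integrable mu (u n) /\ P (u n).
  rewrite uE; apply: class_sum => y.
  by rewrite -[X in measurable X]setTI; exact: (measurable_funPT (u n) measurableT _ (measurable_set1 y)).
by apply: (Pcvg _ sf _ cu) => n; case: (su n).
Qed.

(** The pi-lambda theorem reaches the indicators of all Borel sets, simple functions
    the nonnegative functions, and differences the rest. *)
Lemma sq_integrable_class f : sq_integrable mu f -> P f.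
Proof.
move=> sf; have sa := sq_integrable_abs sf.
have s1 := sq_integrableD sa sf; have s2 := sq_integrableB sa sf.
have p1 : P (fun A => `|f A| + f A).
  by apply: class_nneg => // A; have := ler_norm (- f A); rewrite normrN; lra.
have p2 : P (fun A => `|f A| - f A).
  by apply: class_nneg => // A; have := ler_norm (f A); lra.
have := PD (-1) s2 s1 p2 p1.
have s3 := sq_integrableD (sq_integrableZ (-1) s2) s1.
move=> p3; have := PD 2^-1 s3 (sq_integrable0 mu) p3 class_zero.
by congr P; apply/funext => A; field.
Qed.

End ClosedClass.

Section Density.
Context {R : realType} {d : nat} {L0 : deloneSet R d}.
Local Notation Omega := (pattern_space L0).
Local Notation leb := (lebesgue_rV R d).
Variable mu : probability Omega R.
Hypothesis hflc : finite_local_complexity L0.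
Implicit Types (A B : Omega) (x s t : 'rV[R]_d) (f g b : Omega -> R).

Lemma local_bounded_lin (c : R) f g : local_bounded f -> local_bounded g ->
  local_bounded (fun A => c * f A + g A).
Proof.
move=> [mf [M fM] [r r0 lf]] [mg [N gN] [r' r'0 lg]]; split.
- by apply: measurable_funD => //; exact: measurable_funM.
- exists (`|c| * M + N) => A.
  by rewrite (le_trans (ler_normD _ _))// lerD// normrM ler_wpM2l.
- exists (Num.max r r'); first by rewrite lt_max r0.
  move=> A B AB; congr (_ * _ + _); [apply: lf|apply: lg] => x xr; apply: AB;
    by rewrite lt_max xr ?orbT.
Qed.

Lemma local_bounded_indic (r : R) (U : set Omega) : 0 < r -> open U ->
  local_bounded (\1_(local_part r U) : Omega -> R).
Proof.
move=> r0 oU; split.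
- by apply: measurable_indic; apply: open_measurable_pattern; exact: open_local_part.
- by exists 1; exact: norm_indic_le1.
- exists r => // A B AB; rewrite !indicE; congr (_%:R : R); congr nat_of_bool.
  apply/idP/idP; rewrite !in_setE => lA C BC; apply: lA => x xr.
    by rewrite AB// BC.
  by rewrite -AB// BC.
Qed.

Lemma local_bounded_sq_integrable b : local_bounded b -> sq_integrable mu b.
Proof. by move=> [mb [M bM] _]; exact: sq_integrable_bounded bM. Qed.

Lemma norm2_cvgP (F : nat -> Omega -> R) :
  (norm2 mu (F n) @[n --> \oo] --> (0 : R)) <->
  (forall e : R, 0 < e -> \forall n \near \oo, norm2 mu (F n) <= e).
Proof.
split=> [/cvgrPdist_le h e e0|h].
  by near do rewrite -[norm2 _ _]ger0_norm ?norm2_ge0// -normrN -sub0r; exact: h.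
apply/cvgrPdist_le => e e0; near do rewrite sub0r normrN ger0_norm ?norm2_ge0//.
exact: h.
Unshelve. all: by end_near. Qed.

(** It suffices to approximate the indicators of the open sets, and these are
    exhausted by their local parts. *)
Lemma local_bounded_dense f (e : R) : sq_integrable mu f -> 0 < e ->
  exists2 b, local_bounded b & norm2 mu (fun A => b A - f A) <= e.
Proof.
move=> sf; move: e; apply: (sq_integrable_class (mu := mu) (P := fun f => forall e : R, 0 < e ->
  exists2 b, local_bounded b & norm2 mu (fun A => b A - f A) <= e)) sf.
- move=> c {}f g sf sg Pf Pg e e0; have c0 : 0 < `|c| + 1 by rewrite ltr_wpDl.
  have e2 : 0 < e / 2 by rewrite divr_gt0.
  have [b lb bf] := Pf (e / 2 / (`|c| + 1)) (divr_gt0 e2 c0).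
  have [b' lb' bg] := Pg (e / 2) e2.
  exists (fun A => c * b A + b' A); first exact: local_bounded_lin.
  have s1 := sq_integrableB (local_bounded_sq_integrable lb) sf.
  have s2 := sq_integrableB (local_bounded_sq_integrable lb') sg.
  rewrite (_ : (fun A => _) = (fun A => c * (b A - f A) + (b' A - g A))); last first.
    by apply/funext => A; ring.
  rewrite (le_trans (ler_norm2D (sq_integrableZ _ s1) s2))// norm2Z//.
  rewrite [leRHS]splitr lerD// (le_trans (ler_wpM2l (normr_ge0 c) bf))//.
  rewrite mulrCA ger_pMr ?divr_gt0// ler_pdivrMr// mul1r lerDl//.
- move=> u f' su sf' Pu /norm2_cvgP uf e e0.
  have [N _ /(_ N (leqnn N)) uN] := uf (e / 2) (divr_gt0 e0 (ltr0n _ 2)).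
  have [b lb bu] := Pu N (e / 2) (divr_gt0 e0 (ltr0n _ 2)).
  exists b => //; rewrite (le_trans (ler_norm2_add (local_bounded_sq_integrable lb) (su N) sf'))//.
  by rewrite [leRHS]splitr lerD.
- move=> U oU e e0; have lb n := local_bounded_indic (ltr0Sn R n) oU.
  have cU A : \1_(local_part n.+1%:R U) A @[n --> \oo] --> (\1_U A : R).
    apply: cvg_near_cst; case: (pselect (U A)) => [UA|nUA].
      have [N lN] := local_part_cover oU UA; exists N => // n /= Nn.
      rewrite !indicE !mem_set// => B AB; apply: lN => x xN; apply: AB.
      by rewrite (lt_le_trans xN)// ler_nat (leq_trans Nn).
    by apply: nearW => n; rewrite !indicE !memNset// => /local_part_sub.
  have [_ /norm2_cvgP/(_ e e0)[N _ /(_ N (leqnn N))]] :=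
    @norm2_dominated_cvg _ _ _ mu (fun n => \1_(local_part n.+1%:R U)) (\1_U) (fun=> 1)
    (fun n => let: And3 m _ _ := lb n in m)
    (sq_integrable_cst mu 1) (fun n => @norm_indic_le1 _ _ R _) cU.
  by exists (\1_(local_part N.+1%:R U)).
Unshelve. all: by end_near. Qed.

End Density.

(** * Mollifiers *)

Section Mollifiers.
Context {R : realType} {d : nat} {L0 : deloneSet R d}.
Local Notation Omega := (pattern_space L0).
Local Notation leb := (lebesgue_rV R d).
Implicit Types (A B : Omega) (x s t : 'rV[R]_d) (f g b : Omega -> R).

Definition mollifier (e : R) (eta : 'rV[R]_d -> R) :=
  [/\ smooth_kernel e eta, forall x, 0 <= eta x & \int[leb]_x eta x = 1].

Lemma exists_mollifier (e : R) : 0 < e -> exists eta, mollifier e eta.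
Proof.
move=> e0; have k := @kernel_bump R d e; have ib := kernel_integrable k.
have I0 : 0 < \int[leb]_x cube_bump e x.
  rewrite lt_neqAle Rint_ge0 ?andbT; last exact: bump_ge0.
  apply/eqP => /esym /(Rint_eq0_ae ib (bump_ge0 e))[N [mN N0 sN]].
  have : (leb (cube e) <= leb N)%E.
    apply: le_measure; rewrite ?inE//; first exact: measurable_cube.
    by move=> x xe; apply: sN => /= h; have := bump_gt0 xe; rewrite h ltxx.
  rewrite [X in (_ <= X)%E -> _]N0 lebesgue_rV_cube// lee_fin leNgt exprn_gt0//.
  by rewrite mulr_gt0.
exists (fun x => (\int[leb]_x cube_bump e x)^-1 * cube_bump e x); split.
- have [fb sb] := k; split; first by apply: flat_mul => //; exact: flat_cst.
  by move=> x i xi; rewrite (sb x i xi) mulr0.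
- by move=> x; rewrite mulr_ge0 ?bump_ge0// invr_ge0 ltW.
- by rewrite RintZ// mulVf// gt_eqF.
Qed.

Lemma conv_mollifier_near (e : R) eta b (M c dl : R) A : mollifier e eta ->
  measurable_fun setT b -> (forall B, `|b B| <= M) ->
  (forall x, `|x| <= e -> `|b (phi x A) - c| <= dl) -> 0 < e ->
  `|orbit_conv eta b A - c| <= dl.
Proof.
move=> [k eta0 eta1] mb bM bc e0.
have ie := kernel_integrable k; have me := Rintegrable_meas ie; have [_ se] := k.
have ibe : Rintegrable leb (fun x => b (phi x A) * eta x).
  apply: Rintegrable_le (RintegrableZ M ie).
    by apply: measurable_funM => //; exact: measurable_fun_orbit.
  by move=> x; rewrite !normrM ler_wpM2r// (le_trans (bM _))// ler_norm.
rewrite -[c]mulr1 -eta1 -RintZ// -RintB//; last exact: RintegrableZ.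
rewrite (le_trans (Rint_abs (RintegrableB ibe (RintegrableZ _ ie))))//.
rewrite -[dl]mulr1 -[in leRHS]eta1 -RintZ//; apply: Rint_le.
- exact: Rintegrable_abs (RintegrableB ibe (RintegrableZ _ ie)).
- exact: RintegrableZ.
- move=> x; rewrite -mulrBl normrM (ger0_norm (eta0 x)).
  have [->|etax] := eqVneq (eta x) 0; first by rewrite !mulr0.
  by rewrite ler_wpM2r//; apply: bc; exact: supported_in_norm (ltW e0) se etax.
Qed.

End Mollifiers.

Section ApproximateIdentity.
Context {R : realType} {d : nat} {L0 : deloneSet R d}.
Local Notation Omega := (pattern_space L0).
Local Notation leb := (lebesgue_rV R d).
Variable mu : probability Omega R.
Hypothesis inv : translation_invariant mu.
Implicit Types (A B : Omega) (x s t : 'rV[R]_d) (f g b : Omega -> R).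
Variable eta : nat -> 'rV[R]_d -> R.
Hypothesis meta : forall n, mollifier n.+1%:R^-1 (eta n).

Let n1_gt0 n : 0 < n.+1%:R^-1 :> R. Proof. by rewrite invr_gt0. Qed.
Let ieta n : Rintegrable leb (eta n).
Proof. by have [k _ _] := meta n; exact: kernel_integrable k. Qed.

Let eta_abs n : \int[leb]_x `|eta n x| = 1.
Proof.
have [_ e0 <-] := meta n; by apply: eq_Rint => x; rewrite ger0_norm.
Qed.

Lemma conv_eta_contraction n f g : sq_integrable mu f -> sq_integrable mu g ->
  norm2 mu (fun A => orbit_conv (eta n) f A - orbit_conv (eta n) g A) <=
  norm2 mu (fun A => f A - g A).
Proof.
by move=> sf sg; have := norm2_conv_sub inv sf sg (ieta n); rewrite eta_abs mul1r.
Qed.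

Lemma conv_eta_pointwise b (M : R) A : measurable_fun setT b -> (forall B, `|b B| <= M) ->
  (forall e : R, 0 < e -> \forall x \near (0 : 'rV[R]_d), `|b (phi x A) - b A| <= e) ->
  orbit_conv (eta n) b A @[n --> \oo] --> b A.
Proof.
move=> mb bM bA; apply/cvgrPdist_le => e e0.
have /nbhs_ballP[dl /= dl0 bdl] := bA e e0.
have hN n : (Num.truncn dl^-1 <= n)%N -> n.+1%:R^-1 < dl.
  move=> h; rewrite invf_plt ?posrE// (lt_le_trans (truncnS_gt _))//.
  by rewrite ler_nat ltnS.
exists (Num.truncn dl^-1) => // n /= Nn; rewrite distrC; apply: (conv_mollifier_near (meta n) mb bM) => //.
move=> x xn; apply: bdl; rewrite -ball_normE /= sub0r normrN.
exact: le_lt_trans xn (hN n Nn).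
Qed.

(** On an open set [V] the averages of its indicator tend to [1]; as they have
    the same integral as the indicator, they also tend to [0] in mean off [V]. *)
Lemma conv_eta_open (V : set Omega) : open V ->
  norm2 mu (fun A => orbit_conv (eta n) (\1_V) A - \1_V A) @[n --> \oo] --> (0 : R).
Proof.
move=> oV; have mV := open_measurable_pattern oV.
have m1 : measurable_fun setT (\1_V : Omega -> R) by exact: measurable_indic.
have b1 := @norm_indic_le1 _ _ R V.
have i1 : Rintegrable mu (\1_V : Omega -> R) by exact: Rintegrable_bounded b1.
have ic n : Rintegrable mu (orbit_conv (eta n) (\1_V)) by exact: Rintegrable_conv.
have c01 n A : 0 <= orbit_conv (eta n) (\1_V) A <= 1.
  (* the values of an indicator are at distance 1/2 of 1/2, and so are their means *)
  have := @conv_mollifier_near _ _ _ _ _ (\1_V) 1 (2^-1) (2^-1) A (meta n) m1 b1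
    (fun x _ => ltac:(by rewrite indicE; case: (_ \in _); rewrite ler_norml /=; apply/andP; split; lra)) (n1_gt0 n).
  by rewrite ler_norml => /andP[h1 h2]; apply/andP; split; lra.
pose w n A : R := \1_V A * (1 - orbit_conv (eta n) (\1_V) A).
have w01 n A : 0 <= w n A <= 1.
  rewrite /w; have := c01 n A; move: (orbit_conv _ _ _) => c /andP[h1 h2].
  by rewrite indicE; case: (_ \in _); rewrite ?mul1r ?mul0r; apply/andP; split; lra.
have mw n : measurable_fun setT (w n).
  by apply: measurable_funM => //; apply: measurable_funB => //; exact: Rintegrable_meas.
have iw n : Rintegrable mu (w n).
  apply: (@Rintegrable_bounded _ _ _ _ _ 1) => // A; have /andP[h1 h2] := w01 n A.
  by rewrite ger0_norm.
have cw A : w n A @[n --> \oo] --> (0 : R).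
  case: (pselect (V A)) => VA.
    have cA : orbit_conv (eta n) (\1_V) A @[n --> \oo] --> (\1_V A : R).
      apply: conv_eta_pointwise m1 b1 _ => e e0.
      have : \forall x \near (0 : 'rV[R]_d), V (phi x A).
        have := @continuous_orbit _ _ _ A 0 V; rewrite phi0; apply; exact: open_nbhs_nbhs.
      by apply: filterS => x Vx; rewrite !indicE !mem_set// subrr normr0 ltW.
    rewrite /w indicE mem_set// in cA *; under eq_fun do rewrite mul1r.
    by have := cvgB (cvg_cst (1 : R)) cA; rewrite subrr; exact.
  by apply: cvg_near_cst; apply: nearW => n; rewrite /w indicE memNset ?mul0r.
have [_] := @Rint_dominated_cvg _ _ _ mu w (fun=> 0) (fun=> 1) mw
  (sq_integrable_Rintegrable (sq_integrable_cst mu 1))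
  (fun n A => ltac:(by have /andP[h1 h2] := w01 n A; rewrite ger0_norm)) cw.
rewrite Rint_cst0 => /cvgrPdist_le Iw; apply/norm2_cvgP => e e0.
have e20 : 0 < e ^+ 2 / 2 by rewrite divr_gt0// exprn_gt0.
apply: filterS (Iw _ e20) => n; rewrite sub0r normrN ger0_norm; last first.
  by apply: Rint_ge0 => A; case/andP: (w01 n A).
move=> h; rewrite -[e]ger0_norm; last exact: ltW.
rewrite -sqrtr_sqr ler_wsqrtr//.
have sc := sq_integrableB (conv_sq_integrable inv (sq_integrable_bounded mu m1 b1) (ieta n))
  (sq_integrable_bounded mu m1 b1).
(* pointwise, because the convolution has its values in [0, 1] *)
apply: (@le_trans _ _ (\int[mu]_A (2 * w n A - (\1_V A - orbit_conv (eta n) (\1_V) A)))).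
  apply: Rint_le; first by case: sc.
    by apply: RintegrableB; [exact: RintegrableZ|exact: RintegrableB].
  move=> A; rewrite /w; have := c01 n A; move: (orbit_conv _ _ _) => c /andP[h1 h2].
  by rewrite indicE; case: (_ \in _) => /=; rewrite ?mul1r ?mul0r; nra.
rewrite RintB//; [|exact: RintegrableZ|exact: RintegrableB].
have [_ _ e1] := meta n.
rewrite RintZ// RintB// Rint_conv1// e1 mul1r subrr subr0.
by rewrite mulrC -ler_pdivlMr.
Qed.

(** The class of the functions with this property is closed, since the convolutions
    with mollifiers are contractions. *)
Lemma conv_eta_cvg f : sq_integrable mu f ->
  norm2 mu (fun A => orbit_conv (eta n) f A - f A) @[n --> \oo] --> (0 : R).
Proof.
move=> sf; apply: (sq_integrable_class (mu := mu) (P := fun f =>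
  norm2 mu (fun A => orbit_conv (eta n) f A - f A) @[n --> \oo] --> (0 : R))) sf => [c {}f g|u {}f|].
- move=> sf sg Pf Pg.
  have : `|c| * norm2 mu (fun A => orbit_conv (eta n) f A - f A) +
      norm2 mu (fun A => orbit_conv (eta n) g A - g A) @[n --> \oo] --> (0 : R).
    have := cvgD (cvgM (cvg_cst `|c|) Pf) Pg; rewrite mulr0 addr0; exact.
  apply: squeeze_cvgr (cvg_cst 0); apply: nearW => n; rewrite norm2_ge0 /=.
  have cf := conv_sq_integrable inv sf (ieta n); have cg := conv_sq_integrable inv sg (ieta n).
  have scf := sq_integrableB cf sf; have scg := sq_integrableB cg sg.
  have sfg := sq_integrableD (sq_integrableZ c sf) sg.
  rewrite -norm2Z// (le_trans _ (ler_norm2D (sq_integrableZ c scf) scg))//.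
  rewrite (norm2_ae_eq (g := fun A => c * (orbit_conv (eta n) f A - f A) + (orbit_conv (eta n) g A - g A)))//.
  + by case: (sq_integrableB (conv_sq_integrable inv sfg (ieta n)) sfg).
  + by case: (sq_integrableD (sq_integrableZ c scf) scg).
  + apply: filterS (conv_ae_lin inv c (sq_integrable_Rintegrable sf) (sq_integrable_Rintegrable sg) (ieta n)).
    by move=> A ->; ring.
- move=> su sf Pu /norm2_cvgP uf; apply/norm2_cvgP => e e0.
  have e3 : 0 < e / 3 by rewrite divr_gt0.
  have [N _ /(_ N (leqnn N)) uN] := uf _ e3.
  have /norm2_cvgP/(_ _ e3) := Pu N; apply: filterS => n h.
  have cf := conv_sq_integrable inv sf (ieta n); have cu := conv_sq_integrable inv (su N) (ieta n).
  rewrite (le_trans (ler_norm2_add cf cu sf))//.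
  have h1 := ler_norm2_add cu (su N) sf.
  have h2 := conv_eta_contraction n sf (su N).
  have h3 := norm2C mu f (u N).
  lra.
- exact: conv_eta_open.
Qed.

End ApproximateIdentity.

(** * Weak derivatives *)

Section WeakDerivatives.
Context {R : realType} {d : nat} {L0 : deloneSet R d}.
Local Notation Omega := (pattern_space L0).
Local Notation leb := (lebesgue_rV R d).
Variable mu : probability Omega R.
Hypothesis inv : translation_invariant mu.
Hypothesis hflc : finite_local_complexity L0.
Implicit Types (A B : Omega) (x s t : 'rV[R]_d) (f g b psi : Omega -> R) (a : 'I_d -> nat).

Lemma exists_approximate_identity : exists eta : nat -> 'rV[R]_d -> R,
  forall n, mollifier n.+1%:R^-1 (eta n).
Proof.
have h n : exists eta, @mollifier R d n.+1%:R^-1 eta.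
  by apply: exists_mollifier; rewrite invr_gt0.
by have [eta meta] := choice h; exists eta.
Qed.

Lemma smooth_dense f (e : R) : sq_integrable mu f -> 0 < e ->
  exists2 psi, smooth psi & norm2 mu (fun A => psi A - f A) <= e.
Proof.
move=> sf e0; have e2 : 0 < e / 2 by rewrite divr_gt0.
have [b lb bf] := local_bounded_dense hflc sf e2.
have sb := local_bounded_sq_integrable mu lb.
have [eta meta] := exists_approximate_identity.
have /norm2_cvgP/(_ _ e2)[N _ /(_ N (leqnn N)) hN] := conv_eta_cvg inv meta sb.
have [k _ _] := meta N; exists (orbit_conv (eta N) b); first exact: conv_smooth k lb.
have sc := conv_sq_integrable inv sb (kernel_integrable k).
by rewrite (le_trans (ler_norm2_add sc sb sf))// [leRHS]splitr lerD.
Qed.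

(** Smooth functions are dense; this is what makes weak derivatives unique. *)
Lemma smooth_orthogonal g : sq_integrable mu g ->
  (forall psi, smooth psi -> \int[mu]_A (g A * psi A) = 0) -> {ae mu, forall A, g A = 0}.
Proof.
move=> sg g0; apply: norm2_eq0_ae => //; apply/eqP; rewrite eq_le norm2_ge0 andbT.
apply/ler_addgt0Pl => e e0; rewrite addr0.
have [psi spsi pg] := smooth_dense sg e0.
have sp := smooth_sq_integrable mu hflc spsi.
have [->|gn0] := eqVneq (norm2 mu g) 0; first exact: ltW.
have gp : 0 < norm2 mu g by rewrite lt_neqAle eq_sym gn0 norm2_ge0.
rewrite -(ler_pM2l gp) -expr2 norm2_sqr.
rewrite (_ : \int[mu]_A _ = - \int[mu]_A (g A * (psi A - g A))).
  rewrite (le_trans (ler_norm _))// normrN.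
  rewrite (le_trans (norm2_cauchy_schwarz sg (sq_integrableB sp sg)))//.
  by rewrite ler_wpM2l// norm2_ge0.
rewrite -RintN; last exact: sq_integrableM sg (sq_integrableB sp sg).
rewrite -[LHS]subr0 -[in LHS](g0 psi spsi) -RintB; [|by case: sg|exact: sq_integrableM].
by apply: eq_Rint => A; ring.
Qed.

Lemma distr_deriv_unique a f g g' : sq_integrable mu g -> sq_integrable mu g' ->
  distr_deriv mu a f g -> distr_deriv mu a f g' -> {ae mu, forall A, g A = g' A}.
Proof.
move=> sg sg' fg fg'; have : {ae mu, forall A, g A - g' A = 0}.
  apply: smooth_orthogonal; first exact: sq_integrableB.
  move=> psi spsi; have sp := smooth_sq_integrable mu hflc spsi.
  under eq_Rint do rewrite mulrBl.
  by rewrite RintB; [rewrite -fg// -fg'// subrr|exact: sq_integrableM|exact: sq_integrableM].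
by apply: filterS => A /eqP; rewrite subr_eq0 => /eqP.
Qed.

Lemma distr_deriv_ae a f f' g g' : measurable_fun setT f -> measurable_fun setT f' ->
  measurable_fun setT g -> measurable_fun setT g' ->
  {ae mu, forall A, f A = f' A} -> {ae mu, forall A, g A = g' A} ->
  distr_deriv mu a f g -> distr_deriv mu a f' g'.
Proof.
move=> mf mf' mg mg' ff' gg' fg psi spsi.
have mD := smooth_measurable (smooth_D_hull a spsi); have mp := smooth_measurable spsi.
rewrite -(@Rint_ae_eq _ _ _ mu (fun A => f A * D_hull a psi A)); last first.
- by apply: filterS ff' => A ->.
- exact: measurable_funM.
- exact: measurable_funM.
rewrite -(@Rint_ae_eq _ _ _ mu (fun A => g A * psi A) (fun A => g' A * psi A)).
- exact: fg.
- exact: measurable_funM.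
- exact: measurable_funM.
- by apply: filterS gg' => A ->.
Qed.

Lemma distr_deriv_lin a (c : R) f f' g g' : sq_integrable mu f -> sq_integrable mu f' ->
  sq_integrable mu g -> sq_integrable mu g' -> distr_deriv mu a f g -> distr_deriv mu a f' g' ->
  distr_deriv mu a (fun A => c * f A + f' A) (fun A => c * g A + g' A).
Proof.
move=> sf sf' sg sg' fg fg' psi spsi.
have sD := smooth_sq_integrable mu hflc (smooth_D_hull a spsi).
have sp := smooth_sq_integrable mu hflc spsi.
under eq_Rint do rewrite mulrDl -mulrA.
rewrite RintD; [|by apply: RintegrableZ; exact: sq_integrableM|exact: sq_integrableM].
rewrite RintZ; last exact: sq_integrableM.
under [RHS]eq_Rint do rewrite mulrDl -mulrA.
rewrite RintD; [|by apply: RintegrableZ; exact: sq_integrableM|exact: sq_integrableM].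
rewrite RintZ; last exact: sq_integrableM.
by rewrite -fg// -fg'// mulrDr mulrCA.
Qed.

Lemma distr_deriv_closed a f g : sq_integrable mu f -> sq_integrable mu g ->
  (forall e : R, 0 < e -> exists f' g', [/\ sq_integrable mu f', sq_integrable mu g',
     distr_deriv mu a f' g', norm2 mu (fun A => f' A - f A) <= e &
     norm2 mu (fun A => g' A - g A) <= e]) -> distr_deriv mu a f g.
Proof.
move=> sf sg H psi spsi.
have sD := smooth_sq_integrable mu hflc (smooth_D_hull a spsi).
have sp := smooth_sq_integrable mu hflc spsi.
apply/eqP; rewrite -subr_eq0; apply/eqP/normr0_eq0/eqP; rewrite eq_le normr_ge0 andbT.
apply/ler_addgt0Pl => e e0; rewrite addr0.
set K := norm2 mu (D_hull a psi) + norm2 mu psi + 1.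
have K0 : 0 < K by rewrite ltr_wpDl// addr_ge0// norm2_ge0.
have [f' [g' [sf' sg' fg' ff' gg']]] := H (e / K) (divr_gt0 e0 K0).
have /eqP := fg' psi spsi; rewrite -subr_eq0 => /eqP E.
rewrite -normrN -[X in `|X|]add0r -{1}E.
rewrite (_ : _ + - _ = (-1) ^+ mi_size a * \int[mu]_A ((f' A - f A) * D_hull a psi A) -
   \int[mu]_A ((g' A - g A) * psi A)); last first.
  under [in RHS]eq_Rint do rewrite mulrBl.
  under [X in _ = _ - X]eq_Rint do rewrite mulrBl.
  rewrite !RintB; [|exact: sq_integrableM ..].
  by ring.
have h1 := norm2_cauchy_schwarz (sq_integrableB sf' sf) sD.
have h2 := norm2_cauchy_schwarz (sq_integrableB sg' sg) sp.
rewrite (le_trans (ler_normB _ _))// normrM normrX normrN1 expr1n mul1r.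
rewrite (le_trans (lerD h1 h2))//.
rewrite (@le_trans _ _ (e / K * norm2 mu (D_hull a psi) + e / K * norm2 mu psi))//.
  by rewrite lerD// ler_wpM2r// norm2_ge0.
rewrite -mulrDr mulrAC ler_pdivrMr// ler_pM2l// /K lerDl//.
Qed.

(** Averaging along orbits commutes with differentiation, since both commute
    with the translations. *)
Lemma conv_distr_deriv a f g chi : sq_integrable mu f -> sq_integrable mu g ->
  Rintegrable leb chi -> distr_deriv mu a f g ->
  distr_deriv mu a (orbit_conv chi f) (orbit_conv chi g).
Proof.
move=> sf sg ichi fg psi spsi; have sDp := smooth_D_hull a spsi.
have sD := smooth_sq_integrable mu hflc sDp.
have [M M0 pM] := smooth_bounded hflc spsi; have [N N0 DN] := smooth_bounded hflc sDp.
rewrite -RintZ; last exact: sq_integrableM (conv_sq_integrable inv sf ichi) sD.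
under eq_Rint do rewrite mulrCA.
rewrite (Rint_conv inv (G := N) (sq_integrable_Rintegrable sf) ichi); last first.
- by move=> A; rewrite normrM normrX normrN1 expr1n mul1r.
- by apply: measurable_funM => //; exact: smooth_measurable.
rewrite (Rint_conv inv (sq_integrable_Rintegrable sg) ichi (smooth_measurable spsi) pM).
apply: eq_Rint => x; congr (_ * _).
have shift h q : sq_integrable mu h -> measurable_fun setT q ->
    \int[mu]_A (h (phi x A) * q A) = \int[mu]_A (h A * q (phi (- x) A)).
  move=> [mh _] mq; rewrite -(measure_preserving_Rint (invariant_phi x inv)
    (f := fun A => h A * q (phi (- x) A))).
    by apply: eq_Rint => A; rewrite phiD addNr phi0.
  by apply: measurable_funM => //; exact: (measurable_fun_phi (- x) mq).
rewrite (shift g psi)//; last exact: smooth_measurable.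
rewrite -(fg _ (smooth_phi (- x) spsi)).
rewrite -RintZ; last first.
  apply: sq_integrableM => //; apply: smooth_sq_integrable => //.
  by apply: smooth_D_hull; exact: smooth_phi.
rewrite (shift f (fun A => (-1) ^+ mi_size a * D_hull a psi A))//; last first.
  by apply: measurable_funM => //; exact: smooth_measurable.
by apply: eq_Rint => A; rewrite !D_hullE Dseq_phi /= mulrCA.
Qed.

End WeakDerivatives.

(** * Sobolev spaces *)

Section SobolevSpaces.
Context {R : realType} {d : nat} {L0 : deloneSet R d}.
Local Notation Omega := (pattern_space L0).
Local Notation leb := (lebesgue_rV R d).
Variable mu : probability Omega R.
Hypothesis inv : translation_invariant mu.
Hypothesis hflc : finite_local_complexity L0.
Implicit Types (A B : Omega) (x s t : 'rV[R]_d) (f g b psi : Omega -> R) (a : 'I_d -> nat).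

Lemma sq_integrable_weakD a f : sq_integrable mu (weakD mu a f).
Proof.
(* without a weak derivative in [L^2], [weakD] is the zero function *)
rewrite /weakD; case: xgetP => [g _ [/L2P]//|_]; exact: sq_integrable0.
Qed.

Lemma measurable_weakD a f : measurable_fun setT (weakD mu a f).
Proof. by case: (sq_integrable_weakD a f). Qed.

Lemma distr_deriv_weakD a f g : sq_integrable mu g -> distr_deriv mu a f g ->
  distr_deriv mu a f (weakD mu a f).
Proof.
move=> /L2P sg fg; rewrite /weakD; case: xgetP => [h _ []//|h].
by have := h g; case; split.
Qed.

Lemma weakD_ae a f g : sq_integrable mu g -> distr_deriv mu a f g ->
  {ae mu, forall A, weakD mu a f A = g A}.
Proof.
move=> sg fg; apply: (distr_deriv_unique inv hflc (sq_integrable_weakD a f) sg _ fg).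
exact: distr_deriv_weakD sg fg.
Qed.

Lemma sobolevP k f : sobolev mu k f <-> sq_integrable mu f /\
  forall a, (mi_size a <= k)%N -> distr_deriv mu a f (weakD mu a f).
Proof.
split=> [[/L2P sf W]|[sf W]].
  by split=> // a ak; have [g /L2P sg fg] := W a ak; exact: distr_deriv_weakD sg fg.
split; first exact/L2P.
by move=> a ak; exists (weakD mu a f); [exact/L2P/sq_integrable_weakD|exact: W].
Qed.

Lemma sobolev_lin k (c : R) f g : sobolev mu k f -> sobolev mu k g ->
  sobolev mu k (fun A => c * f A + g A).
Proof.
move=> /sobolevP[sf Wf] /sobolevP[sg Wg]; split.
  by apply/L2P; apply: sq_integrableD => //; exact: sq_integrableZ.
move=> a ak; exists (fun A => c * weakD mu a f A + weakD mu a g A).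
  apply/L2P; apply: sq_integrableD; last exact: sq_integrable_weakD.
  exact: (sq_integrableZ _ (sq_integrable_weakD a f)).
apply: distr_deriv_lin => //; try exact: sq_integrable_weakD; [exact: Wf|exact: Wg].
Qed.

Lemma weakD_lin k a (c : R) f g : (mi_size a <= k)%N -> sobolev mu k f -> sobolev mu k g ->
  {ae mu, forall A, weakD mu a (fun B => c * f B + g B) A = c * weakD mu a f A + weakD mu a g A}.
Proof.
move=> ak /sobolevP[sf Wf] /sobolevP[sg Wg].
have sDf := sq_integrable_weakD a f; have sDg := sq_integrable_weakD a g.
apply: weakD_ae; first by apply: sq_integrableD => //; exact: sq_integrableZ.
by apply: distr_deriv_lin => //; [exact: Wf|exact: Wg].
Qed.

Lemma smooth_sobolev k psi : smooth psi -> sobolev mu k psi.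
Proof.
move=> sp; split; first exact/L2P/smooth_sq_integrable.
move=> a _; exists (D_hull a psi); last exact: smooth_distr_deriv.
by apply/L2P; apply: smooth_sq_integrable => //; exact: smooth_D_hull.
Qed.

Lemma weakD_smooth a psi : smooth psi -> {ae mu, forall A, weakD mu a psi A = D_hull a psi A}.
Proof.
move=> sp; apply: weakD_ae; last exact: smooth_distr_deriv.
by apply: smooth_sq_integrable => //; exact: smooth_D_hull.
Qed.

Lemma mi_sizeD a a' : mi_size (fun i => (a i + a' i)%N) = (mi_size a + mi_size a')%N.
Proof. by rewrite /mi_size big_split. Qed.

Lemma distr_derivD k a a' f : (mi_size a + mi_size a' <= k)%N -> sobolev mu k f ->
  distr_deriv mu a' (weakD mu a f) (weakD mu (fun i => (a i + a' i)%N) f).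
Proof.
move=> abk /sobolevP[sf Wf] psi spsi.
have ak : (mi_size a <= k)%N by rewrite (leq_trans _ abk)// leq_addr.
rewrite -(Wf a ak _ (smooth_D_hull a' spsi)) mulrA -exprD D_hullD//.
by rewrite -(Wf _ _ psi spsi) mi_sizeD// addnC.
Qed.

Lemma sobolev_weakD k a f : (mi_size a <= k)%N -> sobolev mu k f ->
  sobolev mu (k - mi_size a) (weakD mu a f).
Proof.
move=> ak Wf; split; first exact/L2P/sq_integrable_weakD.
move=> a' bk; exists (weakD mu (fun i => (a i + a' i)%N) f).
  exact/L2P/sq_integrable_weakD.
by apply: (@distr_derivD k) => //; rewrite -leq_subRL.
Qed.

Lemma sobolev_normE k f : sobolev_norm mu k f = Num.sqrt
  (\sum_(a : {ffun 'I_d -> 'I_k.+1} | (mi_size (mi_of a) <= k)%N)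
     norm2 mu (weakD mu (mi_of a) f) ^+ 2).
Proof.
congr Num.sqrt; apply: eq_bigr => a _.
by rewrite L2normE//; exact: sq_integrable_weakD.
Qed.

Lemma norm2_weakD_le k a f : (mi_size a <= k)%N ->
  norm2 mu (weakD mu a f) <= sobolev_norm mu k f.
Proof.
move=> ak; have ai i : (a i < k.+1)%N.
  by rewrite ltnS (leq_trans _ ak)// /mi_size (bigD1 i)//= leq_addr.
pose al : {ffun 'I_d -> 'I_k.+1} := [ffun i => Ordinal (ai i)].
have alE : mi_of al = a by apply/funext => i; rewrite /mi_of ffunE.
rewrite sobolev_normE -[leLHS]ger0_norm ?norm2_ge0// -sqrtr_sqr ler_wsqrtr//.
rewrite (bigD1 al)/= ?alE// lerDl sumr_ge0// => i _; exact: sqr_ge0.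
Qed.

(** A crude constant, the number of multiindices, is enough to pass from estimates of
    the single derivatives to the Sobolev norm. *)
Lemma sobolev_norm_le k f (e : R) : 0 <= e ->
  (forall al : {ffun 'I_d -> 'I_k.+1}, (mi_size (mi_of al) <= k)%N ->
    norm2 mu (weakD mu (mi_of al) f) <= e) ->
  sobolev_norm mu k f <= #|{ffun 'I_d -> 'I_k.+1}|%:R * e.
Proof.
move=> e0 fe; rewrite sobolev_normE.
set N := #|_|; have N0 : 0 <= N%:R * e by rewrite mulr_ge0.
rewrite -[leRHS]ger0_norm// -sqrtr_sqr ler_wsqrtr//.
apply: (@le_trans _ _ (\sum_(a : {ffun 'I_d -> 'I_k.+1}) e ^+ 2)).
  rewrite [leRHS](bigID (fun a : {ffun 'I_d -> 'I_k.+1} => (mi_size (mi_of a) <= k)%N))/= ler_wpDr//.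
    by apply: sumr_ge0 => *; exact: sqr_ge0.
  by apply: ler_sum => a ak; rewrite lerXn2r ?nnegrE ?norm2_ge0// fe.
rewrite sumr_const -[X in X *+ _]mul1r -mulrnAl exprMn ler_wpM2r ?sqr_ge0//.
by rewrite -natrX ler_nat -/N; case: N {N0} => // n; rewrite -{1}[n.+1]muln1 leq_mul.
Qed.

Lemma weakD_bounded k a f : (mi_size a <= k)%N -> sobolev mu k f ->
  sobolev_norm mu (k - mi_size a) (weakD mu a f) <=
  #|{ffun 'I_d -> 'I_(k - mi_size a).+1}|%:R * sobolev_norm mu k f.
Proof.
move=> ak Wf; apply: sobolev_norm_le; first exact: sqrtr_ge0.
move=> al; set a' := mi_of al => bk.
have abk : (mi_size a + mi_size a' <= k)%N by rewrite -leq_subRL.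
rewrite (@norm2_ae_eq _ _ _ mu _ (weakD mu (fun i => (a i + a' i)%N) f)).
- by apply: norm2_weakD_le; rewrite mi_sizeD.
- exact: measurable_weakD.
- exact: measurable_weakD.
- by apply: weakD_ae; [exact: sq_integrable_weakD|exact: distr_derivD abk Wf].
Qed.

(** For local functions these are classical derivatives; the general case follows by
    density, because weak derivatives are closed in [L^2]. *)
Lemma kernel_weak_deriv a (r : R) chi : smooth_kernel r chi ->
  exists2 chi', smooth_kernel r chi' &
    (forall b, local_bounded b -> D_hull a (orbit_conv chi b) = orbit_conv chi' b) /\
    forall f, sq_integrable mu f -> distr_deriv mu a (orbit_conv chi f) (orbit_conv chi' f).
Proof.
move=> k; have [chi' k' D'] := conv_Dseq (L0 := L0) (mi_seq a) k; exists chi' => //.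
have Db b : local_bounded b -> D_hull a (orbit_conv chi b) = orbit_conv chi' b.
  by move=> lb; rewrite D_hullE D'.
split=> // f sf; have ic := kernel_integrable k; have ic' := kernel_integrable k'.
apply: (distr_deriv_closed hflc); [exact: conv_sq_integrable ..|] => e e0.
pose C := \int[leb]_x `|chi x| + \int[leb]_x `|chi' x| + 1.
have i0 : 0 <= \int[leb]_x `|chi x| by exact: Rint_ge0.
have i0' : 0 <= \int[leb]_x `|chi' x| by exact: Rint_ge0.
have C0 : 0 < C by rewrite ltr_wpDl// addr_ge0.
have [b lb bf] := local_bounded_dense hflc sf (divr_gt0 e0 C0).
have sb := local_bounded_sq_integrable mu lb.
exists (orbit_conv chi b), (orbit_conv chi' b); split.
- exact: conv_sq_integrable.
- exact: conv_sq_integrable.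
- by rewrite -Db//; apply: smooth_distr_deriv => //; exact: conv_smooth k lb.
- rewrite (le_trans (norm2_conv_sub inv sb sf ic))//.
  rewrite (le_trans (ler_wpM2l i0 bf))// mulrCA ger_pMr// ler_pdivrMr// mul1r.
  by rewrite /C -addrA lerDl addr_ge0.
- rewrite (le_trans (norm2_conv_sub inv sb sf ic'))//.
  rewrite (le_trans (ler_wpM2l i0' bf))// mulrCA ger_pMr// ler_pdivrMr// mul1r.
  by rewrite /C [_ + \int[leb]_x `|chi' x|]addrC -addrA lerDl addr_ge0.
Qed.

End SobolevSpaces.

(** * Density, locality and completeness *)

Section SobolevDensity.
Context {R : realType} {d : nat} {L0 : deloneSet R d}.
Local Notation Omega := (pattern_space L0).
Local Notation leb := (lebesgue_rV R d).
Variable mu : probability Omega R.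
Hypothesis inv : translation_invariant mu.
Hypothesis hflc : finite_local_complexity L0.
Implicit Types (A B : Omega) (x s t : 'rV[R]_d) (f g b psi : Omega -> R) (a : 'I_d -> nat).

(** One mollifier serves for [f] and all its weak derivatives; once it is fixed,
    [f] itself may be replaced by a local function, because all derivatives now
    fall on the kernel. *)
Lemma sobolev_dense k f (e : R) : sobolev mu k f -> 0 < e ->
  exists2 psi, smooth_tlc psi & sobolev_norm mu k (fun A => f A - psi A) < e.
Proof.
move=> Wf e0; have [sf dW] := (sobolevP mu k f).1 Wf.
pose F := {ffun 'I_d -> 'I_k.+1}; pose N := #|{: F}|.
(* [N] bounds the number of derivatives, and each of them gets two errors [e1] *)
pose e1 := e / N.+1%:R / 2.
have e10 : 0 < e1 by rewrite !divr_gt0.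
have [eta meta] := @exists_approximate_identity R d.
have hn (al : F) : exists n0, forall n, (n0 <= n)%N -> norm2 mu (fun A =>
    orbit_conv (eta n) (weakD mu (mi_of al) f) A - weakD mu (mi_of al) f A) <= e1.
  have /norm2_cvgP/(_ _ e10)[n0 _ h] := conv_eta_cvg inv meta (sq_integrable_weakD mu (mi_of al) f).
  by exists n0 => n; exact: h.
have [n0 n0P] := choice hn.
pose n := (\max_(al : F) n0 al)%N.
have [keta _ _] := meta n.
have hchi (al : F) := kernel_weak_deriv inv hflc (mi_of al) keta.
have /choice[chi chiP] : forall al : F, exists chi', [/\ smooth_kernel n.+1%:R^-1 chi',
   (forall b, local_bounded b -> D_hull (mi_of al) (orbit_conv (eta n) b) = orbit_conv chi' b) &
    forall f, sq_integrable mu f -> distr_deriv mu (mi_of al) (orbit_conv (eta n) f) (orbit_conv chi' f)].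
  by move=> al; have [chi' k' [h1 h2]] := hchi al; exists chi'.
pose C (al : F) := \int[leb]_x `|chi al x|.
have C0 al : 0 <= C al by exact: Rint_ge0.
pose S := \sum_al C al + 1.
have S0 : 0 < S by rewrite ltr_wpDl// sumr_ge0.
have CS al : C al <= S.
  by rewrite /S (bigD1 al)//= -addrA lerDl addr_ge0// sumr_ge0.
have [b lb bf] := local_bounded_dense hflc sf (divr_gt0 e10 S0).
have sb := local_bounded_sq_integrable mu lb.
exists (orbit_conv (eta n) b); first exact: conv_smooth_tlc keta lb.
have sh := conv_smooth keta lb; have Wh := smooth_sobolev inv hflc k sh.
apply: (@le_lt_trans _ _ (N%:R * (e / N.+1%:R))); last first.
  by rewrite mulrCA gtr_pMr// ltr_pdivrMr// mul1r ltr_nat.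
apply: sobolev_norm_le; first by rewrite divr_ge0// ltW.
move=> al alk; set a := mi_of al in alk *.
have [k' Db Df] := chiP al; have ic' := kernel_integrable k'; have ic := kernel_integrable keta.
have sD := sq_integrable_weakD mu a f.
have s1 := conv_sq_integrable inv sD ic; have s2 := conv_sq_integrable inv sf ic'.
have s3 := conv_sq_integrable inv sb ic'.
have E : {ae mu, forall A, orbit_conv (eta n) (weakD mu a f) A = orbit_conv (chi al) f A}.
  apply: (distr_deriv_unique inv hflc s1 s2 _ (Df f sf)).
  exact: (conv_distr_deriv inv hflc sf sD ic (dW a alk)).
have E' : {ae mu, forall A, weakD mu a (fun B => f B - orbit_conv (eta n) b B) A =
    weakD mu a f A - orbit_conv (chi al) b A}.
  have := weakD_lin inv hflc (-1) alk Wh Wf.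
  apply: filterS2 (weakD_smooth inv hflc a sh) => A hA.
  rewrite hA Db// mulN1r addrC => <-.
  by congr (weakD mu a _ A); apply/funext => B; ring.
have s4 := sq_integrableB s1 sD; have s5 := sq_integrableB sf sb.
rewrite (norm2_ae_eq _ _ E'); [|by case: (sq_integrable_weakD mu a (fun B => f B - orbit_conv (eta n) b B))
  |by case: (sq_integrableB sD s3)].
rewrite (le_trans (ler_norm2_add sD s1 s3))//.
rewrite [leRHS]splitr -/e1 lerD//.
  by rewrite norm2C; apply: n0P; exact: leq_bigmax.
rewrite (@norm2_ae_eq _ _ _ mu _ (fun A => orbit_conv (chi al) f A - orbit_conv (chi al) b A)).
- rewrite (le_trans (norm2_conv_sub inv sf sb ic'))// -/(C al) norm2C.
  rewrite (le_trans (ler_wpM2l (C0 al) bf))// mulrCA ger_pMr// ler_pdivrMr// mul1r.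
  exact: CS.
- by case: (sq_integrableB s1 s3).
- by case: (sq_integrableB s2 s3).
- by apply: filterS E => A ->.
Qed.

(** The mollified derivative is the convolution of [f] with a derivative of the
    mollifier; near a point of [O] it only involves values of [f] on [O]. *)
Lemma weakD_local k a f (O : set Omega) : (mi_size a <= k)%N -> sobolev mu k f -> open O ->
  {ae mu, forall A, O A -> f A = 0} -> {ae mu, forall A, O A -> weakD mu a f A = 0}.
Proof.
move=> ak Wf oO f0; have [sf dW] := (sobolevP mu k f).1 Wf; have [mf _] := sf.
have sg := sq_integrable_weakD mu a f.
have [eta meta] := @exists_approximate_identity R d.
pose Q n A := forall x, `|x| <= n.+1%:R^-1 -> O (phi x A).
have Qg n : {ae mu, forall A, Q n A -> weakD mu a f A = 0}.
  apply: norm2_approx_ae0 => // e e0.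
  have /norm2_cvgP/(_ _ e0)[n1 _ h] := conv_eta_cvg inv meta sg.
  pose m := maxn n1 n; have {}h := h m (leq_maxl _ _).
  have [keta _ _] := meta m; have ic := kernel_integrable keta.
  exists (orbit_conv (eta m) (weakD mu a f)); split=> //; first exact: conv_sq_integrable.
  have [chi k' [_ Df]] := kernel_weak_deriv inv hflc a keta; have ic' := kernel_integrable k'.
  have E : {ae mu, forall A, orbit_conv (eta m) (weakD mu a f) A = orbit_conv chi f A}.
    apply: (distr_deriv_unique inv hflc _ _ _ (Df f sf)); [exact: conv_sq_integrable ..|].
    exact: (conv_distr_deriv inv hflc sf sg ic (dW a ak)).
  have mO := open_measurable_pattern oO.
  have mf1 : measurable_fun setT (fun A => f A * \1_O A).
    by apply: measurable_funM => //; exact: measurable_indic.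
  have f10 : {ae mu, forall A, 0 = f A * \1_O A}.
    apply: filterS f0 => A fA; rewrite indicE; have [/set_mem/fA ->|] := boolP (A \in O).
      by rewrite mul0r.
    by rewrite mulr0.
  have s1 : sq_integrable mu (fun A => f A * \1_O A).
    exact: (sq_integrable_ae_eq mf1 f10 (sq_integrable0 mu)).
  have n10 : norm2 mu (fun A => f A * \1_O A) = 0.
    rewrite -(norm2_ae_eq (measurable_cst (0 : R)) mf1 f10) /norm2.
    by rewrite (@eq_Rint _ _ _ _ _ (fun=> 0)) ?Rint_cst0 ?sqrtr0// => A; rewrite expr0n.
  have [s2] := conv_young inv s1 ic'; rewrite n10 mulr0 => n20.
  have /(norm2_eq0_ae s2) c0 : norm2 mu (orbit_conv chi (fun A => f A * \1_O A)) = 0.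
    by apply/eqP; rewrite eq_le n20 norm2_ge0.
  apply: filterS2 E c0 => A -> c0 QA; rewrite -c0; apply: eq_Rint => x.
  have [->|chix] := eqVneq (chi x) 0; first by rewrite !mulr0.
  rewrite indicE mem_set ?mulr1//; apply: QA.
  have m0 : 0 <= m.+1%:R^-1 :> R by rewrite invr_ge0.
  rewrite (le_trans (supported_in_norm m0 (proj2 k') chix))//.
  by rewrite lef_pV2 ?posrE// ler_nat ltnS leq_maxr.
have /ae_foralln := Qg; apply: filterS => A gA OA.
have /nbhs_ballP[dl /= dl0 dO] : \forall x \near (0 : 'rV[R]_d), O (phi x A).
  by have := @continuous_orbit _ _ _ A 0 O; rewrite phi0; apply; exact: open_nbhs_nbhs.
apply: (gA (Num.truncn dl^-1)) => x xd; apply: dO; rewrite -ball_normE /= sub0r normrN.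
by rewrite (le_lt_trans xd)// invf_plt ?posrE// truncnS_gt.
Qed.

End SobolevDensity.

Section SobolevHilbert.
Context {R : realType} {d : nat} {L0 : deloneSet R d}.
Local Notation Omega := (pattern_space L0).
Variable mu : probability Omega R.
Hypothesis inv : translation_invariant mu.
Hypothesis hflc : finite_local_complexity L0.
Implicit Types (A B : Omega) (f g b psi : Omega -> R) (a : 'I_d -> nat).

Lemma ae_null_sq_integrable f : ae_null mu f -> sq_integrable mu f.
Proof.
move=> [mf f0]; apply: (sq_integrable_ae_eq mf _ (sq_integrable0 mu)).
by apply: filterS f0 => A ->.
Qed.

Lemma ae_null_distr_deriv a f : ae_null mu f -> distr_deriv mu a f (fun=> 0).
Proof.
move=> [mf f0].
apply: (distr_deriv_ae (f := fun=> 0) (g := fun=> 0)) => //; try exact: measurable_cst.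
- by apply: filterS f0 => A ->.
- by apply: nearW.
- by move=> psi _; under eq_Rint do rewrite mul0r; under [RHS]eq_Rint do rewrite mul0r; rewrite Rint_cst0 mulr0.
Qed.

Lemma ae_null_sobolev k f : ae_null mu f -> sobolev mu k f.
Proof.
move=> zf; split; first exact/L2P/ae_null_sq_integrable.
move=> a _; exists (fun=> 0); first exact/L2P/sq_integrable0.
exact: ae_null_distr_deriv.
Qed.

Lemma weakD0 f : sq_integrable mu f -> {ae mu, forall A, weakD mu (fun=> 0%N) f A = f A}.
Proof.
move=> sf; apply: weakD_ae => //.
move=> psi spsi; rewrite mi_size0 expr0 mul1r D_hullE.
have -> : mi_seq (fun _ : 'I_d => 0%N) = [::] by apply: size0nil; rewrite size_mi_seq mi_size0.
by [].
Qed.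

(** A Cauchy sequence converges with all its derivatives in [L^2]; the limits are
    the weak derivatives of the limit, because weak derivatives are closed. *)
Lemma sobolev_complete k : norm_complete (V := Omega -> R^o) (sobolev mu k) (sobolev_norm mu k).
Proof.
move=> u Wu cu.
have su n : sq_integrable mu (u n) by have /sobolevP[] := Wu n.
have cv a : (mi_size a <= k)%N -> exists2 l, sq_integrable mu l & forall e : R, 0 < e ->
    exists n0 : nat, forall n : nat, (n0 <= n)%N ->
      norm2 mu (fun A => weakD mu a (u n) A - l A) <= e.
  move=> ak; apply: sq_integrable_complete => [n|e e0]; first exact: sq_integrable_weakD.
  have [n0 h] := cu e e0; exists n0 => p q pn qn; apply: le_lt_trans (h p q pn qn).
  rewrite (le_trans _ (norm2_weakD_le mu (u p - u q) ak))//.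
  rewrite (@norm2_ae_eq _ _ _ mu _ (weakD mu a (u p - u q)))//.
  - by apply: measurable_funB; exact: measurable_weakD.
  - exact: measurable_weakD.
  - apply: filterS (weakD_lin inv hflc (-1) ak (Wu q) (Wu p)) => A.
    rewrite mulN1r addrC => <-; congr (weakD mu a _ A).
    by apply/funext => B; rewrite mulN1r addrC.
have k0 : (mi_size (fun _ : 'I_d => 0%N) <= k)%N by rewrite mi_size0.
have [l sl ul] := cv _ k0.
have {}ul (e : R) : 0 < e -> exists n0 : nat, forall n, (n0 <= n)%N -> norm2 mu (fun A => u n A - l A) <= e.
  move=> e0; have [n0 h] := ul e e0; exists n0 => n nn; rewrite (le_trans _ (h n nn))//.
  rewrite (@norm2_ae_eq _ _ _ mu _ (fun A => weakD mu (fun=> 0%N) (u n) A - l A))//.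
  - by case: (sq_integrableB (su n) sl).
  - by case: (sq_integrableB (sq_integrable_weakD mu (fun=> 0%N) (u n)) sl).
  - by apply: filterS (weakD0 (su n)) => A ->.
have dl a (ak : (mi_size a <= k)%N) g : sq_integrable mu g ->
    (forall e : R, 0 < e -> exists n0 : nat, forall n : nat, (n0 <= n)%N ->
      norm2 mu (fun A => weakD mu a (u n) A - g A) <= e) -> distr_deriv mu a l g.
  move=> sg ug; apply: (distr_deriv_closed hflc) => // e e0.
  have [n0 h0] := ul e e0; have [n1 h1] := ug e e0.
  exists (u (maxn n0 n1)), (weakD mu a (u (maxn n0 n1))); split=> //.
  - exact: sq_integrable_weakD.
  - by have /sobolevP[_] := Wu (maxn n0 n1); exact.
  - exact: h0 (leq_maxl _ _).
  - exact: h1 (leq_maxr _ _).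
have Wl : sobolev mu k l.
  split; first exact/L2P.
  by move=> a ak; have [g sg ug] := cv a ak; exists g; [exact/L2P|exact: dl ak g sg ug].
exists l => //; apply/cvgrPdist_le => e e0.
pose F := {ffun 'I_d -> 'I_k.+1}; pose N := #|{: F}|.
have e1 : 0 < e / N.+1%:R by rewrite divr_gt0.
have hn (al : F) : exists n0, (mi_size (mi_of al) <= k)%N -> forall n, (n0 <= n)%N ->
    norm2 mu (weakD mu (mi_of al) (u n - l)) <= e / N.+1%:R.
  have [alk|_] := boolP (mi_size (mi_of al) <= k)%N; last by exists 0%N.
  have [g sg ug] := cv _ alk; have [n0 h] := ug _ e1.
  exists n0 => _ n nn; rewrite (le_trans _ (h n nn))//.
  rewrite (@norm2_ae_eq _ _ _ mu _ (fun A => weakD mu (mi_of al) (u n) A - g A))//.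
  - exact: measurable_weakD.
  - by case: (sq_integrableB (sq_integrable_weakD mu (mi_of al) (u n)) sg).
  - have := weakD_lin inv hflc (-1) alk Wl (Wu n).
    apply: filterS2 (weakD_ae inv hflc sg (dl _ alk g sg ug)) => A hA.
    rewrite hA mulN1r addrC => <-; congr (weakD mu _ _ A).
    by apply/funext => B; rewrite mulN1r addrC.
have [n0 n0P] := choice hn.
exists (\max_(al : F) n0 al)%N => // n /= nn; rewrite sub0r normrN ger0_norm; last exact: sqrtr_ge0.
apply: (@le_trans _ _ (N%:R * (e / N.+1%:R))); last first.
  by rewrite mulrCA ger_pMr// ler_pdivrMr// mul1r ler_nat.
apply: sobolev_norm_le; first exact: ltW.
by move=> al alk; apply: n0P => //; apply: leq_trans nn; exact: leq_bigmax.
Qed.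

Lemma sobolev_hilbert k : hilbert_quotient (V := Omega -> R^o)
  (sobolev mu k) (ae_null mu) (sobolev_norm mu k).
Proof.
have Z0 : ae_null mu (fun=> 0) by split; [exact: measurable_cst|apply: nearW].
split; last exact: sobolev_complete.
- by split; [exact: ae_null_sobolev|move=> c f g; exact: sobolev_lin].
- split; last by move=> f; exact: ae_null_sobolev.
  split=> // c f g [mf f0] [mg g0]; split.
    by apply: measurable_funD => //; exact: measurable_funM.
  by apply: filterS2 f0 g0 => A fA gA; rewrite -[LHS]/(c * f A + g A) fA gA mulr0 addr0.
have sD := sq_integrable_weakD mu.
have fE f : sobolev_norm mu k f = Num.sqrt
  (\sum_(a : {ffun 'I_d -> 'I_k.+1} | (mi_size (mi_of a) <= k)%N)
     \int[mu]_A (weakD mu (mi_of a) f A * weakD mu (mi_of a) f A)).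
  by rewrite sobolev_normE; congr Num.sqrt; apply: eq_bigr => a _; rewrite norm2_sqr.
exists (fun f g => \sum_(a : {ffun 'I_d -> 'I_k.+1} | (mi_size (mi_of a) <= k)%N)
     \int[mu]_A (weakD mu (mi_of a) f A * weakD mu (mi_of a) g A)); split.
- by move=> f g _ _; apply: eq_bigr => a _; apply: eq_Rint => A; rewrite mulrC.
- move=> c f g h Wf Wg Wh; rewrite mulr_sumr -big_split /=; apply: eq_bigr => a ak.
  rewrite -RintZ; last exact: sq_integrableM.
  rewrite -RintD; [|by apply: RintegrableZ; exact: sq_integrableM|exact: sq_integrableM].
  apply: Rint_ae_eq.
  + by apply: measurable_funM; exact: measurable_weakD.
  + by apply: measurable_funD; do ?apply: measurable_funM => //; exact: measurable_weakD.
  + by apply: filterS (weakD_lin inv hflc c ak Wf Wg) => A ->; ring.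
- by move=> f _; apply: sumr_ge0 => a _; apply: Rint_ge0 => A; exact: sqr_ge0.
- move=> f Wf; have /sobolevP[sf _] := Wf; split=> [f0|zf].
    split; first by case: sf.
    have k0 : (mi_size (fun _ : 'I_d => 0%N) <= k)%N by rewrite mi_size0.
    have /(norm2_eq0_ae (sD _ _)) : norm2 mu (weakD mu (fun=> 0%N) f) = 0.
      apply/eqP; rewrite eq_le norm2_ge0 andbT (le_trans (norm2_weakD_le mu f k0))//.
      by rewrite fE f0 sqrtr0.
    by apply: filterS2 (weakD0 sf) => A ->.
  rewrite big1// => a _; rewrite -[RHS](Rint_cst0 mu); apply: Rint_ae_eq.
  + by apply: measurable_funM; exact: measurable_weakD.
  + exact: measurable_cst.
  + apply: filterS (weakD_ae inv hflc (sq_integrable0 mu) (ae_null_distr_deriv (mi_of a) zf)) => A ->.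
    by rewrite mul0r.
- by move=> f _; exact: fE.
Qed.

End SobolevHilbert.

(** * Distributional derivatives along orbits *)

Section TestFunctions.
Context {R : realType} {d : nat}.
Implicit Types (psi : 'rV[R]_d -> R) (x t : 'rV[R]_d).

Lemma test_continuous psi : test_function psi -> continuous psi.
Proof. by move=> [/(_ 0%N)[]]. Qed.

Lemma test_derivable psi i x : test_function psi -> derivable psi x (basis_vec R i).
Proof. by move=> [/(_ 1%N)[_ /(_ i)[]]]. Qed.

Lemma test_support psi : test_function psi ->
  exists2 r : R, 0 < r & forall x, ~ cube r x -> psi x = 0.
Proof.
move=> [_ /compact_cube[r r0 sr]]; exists r => // x xr; apply/eqP.
by apply: contrapT => /negP px; apply: xr; apply: sr; exact: subset_closure.
Qed.

Lemma test_bounded psi : test_function psi -> exists2 M : R, 0 < M & forall x, `|psi x| <= M.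
Proof.
move=> tp; have [_ cK] := tp; have cp := test_continuous tp.
have : compact (psi @` closure [set x | psi x != 0]).
  by apply: continuous_compact => //; exact: continuous_subspaceT.
move=> /compact_bounded[M [_ pM]].
exists (`|M| + 1); first by rewrite ltr_wpDl.
move=> x; have [->|px] := eqVneq (psi x) 0; first by rewrite normr0 addr_ge0.
apply: pM; first by rewrite (le_lt_trans (ler_norm M))// ltrDl.
by exists x => //; exact: subset_closure.
Qed.

Lemma test_derive psi i : test_function psi -> test_function (fun x => 'D_(basis_vec R i) psi x).
Proof.
move=> [sp cp]; split; first by move=> k; have [_ /(_ i)[_]] := sp k.+1.
apply: subclosed_compact cp _; first exact: closed_closure.
rewrite [X in _ `<=` X]((closure_id _).1 (@closed_closure _ [set x | psi x != 0])).
apply: closureS => x /= dx; apply: contrapT => nx.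
have near0 : {near x, psi =1 cst 0}.
  have : nbhs x (~` closure [set x | psi x != 0]).
    by apply: open_nbhs_nbhs; split; [exact/closed_openC/closed_closure|exact: nx].
  apply: filterS => y ny /=; apply/eqP; apply: contrapT => /negP py; apply: ny.
  exact: subset_closure.
by rewrite (near_eq_derive _ near0) derive_cst eqxx in dx.
Qed.

Lemma test_lipschitz psi i : test_function psi -> exists2 M : R, 0 < M &
  forall x (h : R), `|psi (x + h *: basis_vec R i) - psi x| <= M * `|h|.
Proof.
move=> tp; have [M M0 dM] := test_bounded (test_derive i tp); exists M => // x h.
have := @bounded_derive_lipschitz R (fun h : R => psi (h *: basis_vec R i + x))
  (fun h => 'D_(basis_vec R i) psi (h *: basis_vec R i + x)) M _ (fun h => dM _) h 0.
rewrite scale0r add0r subr0 [x + _]addrC => H; apply: H => y.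
have E : (fun h : R => h^-1 *: (((fun h : R => psi (h *: basis_vec R i + x)) \o shift y) (h *: 1)
     - psi (y *: basis_vec R i + x))) =
   (fun h => h^-1 *: ((psi \o shift (y *: basis_vec R i + x)) (h *: basis_vec R i) -
     psi (y *: basis_vec R i + x))).
  by apply/funext => z; rewrite /= [z *: 1]mulr1 scalerDl addrA.
have dp := test_derivable (i := i) (x := y *: basis_vec R i + x) tp.
by apply: DeriveDef; [rewrite /derivable E|rewrite /derive E].
Qed.

Definition Drv (l : seq 'I_d) psi : 'rV[R]_d -> R :=
  foldr (fun i g x => 'D_(basis_vec R i) g x) psi l.

Lemma D_rVE a psi : D_rV a psi = Drv (mi_seq a) psi.
Proof. exact: iter_partialE. Qed.

Lemma test_Drv l psi : test_function psi -> test_function (Drv l psi).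
Proof. by move=> tp; elim: l => [//|i l IH] /=; exact: test_derive. Qed.

End TestFunctions.

Section OrbitDerivatives.
Context {R : realType} {d : nat} {L0 : deloneSet R d}.
Local Notation Omega := (pattern_space L0).
Local Notation leb := (lebesgue_rV R d).
Hypothesis hflc : finite_local_complexity L0.
Implicit Types (A B : Omega) (x t : 'rV[R]_d) (f g : Omega -> R) (psi : 'rV[R]_d -> R).

Lemma orbit_by_parts1 f psi A i : smooth f -> test_function psi ->
  \int[leb]_x (dir_deriv (basis_vec R i) f (phi x A) * psi x) =
  - \int[leb]_x (f (phi x A) * 'D_(basis_vec R i) psi x).
Proof.
move=> sf tp; set e := basis_vec R i.
have [Mf Mf0 fM] := smooth_bounded hflc sf.
have [Nf Nf0 fN] := smooth_bounded hflc (smooth_dir_deriv e sf).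
have [Mp Mp0 pM] := test_bounded tp; have [Np Np0 pN] := test_lipschitz i tp.
have [r r0 sp] := test_support tp.
have r1 : 0 < r + 1 by rewrite addr_gt0.
have mf := measurable_fun_orbit A (smooth_measurable sf).
have mp := continuous_measurable_rV (test_continuous tp).
pose K : R := Nf * Mp + Mf * Np.
apply: (@flow_by_parts _ _ _ leb (fun h x => x + h *: e) (fun x => f (phi x A)) psi
  _ _ (fun x => K * \1_(cube (r + 1)) x)).
- by move=> h; exact: lebesgue_rV_preserving.
- by move=> h x; rewrite scaleNr subrK.
- exact: mf.
- exact: mp.
- apply: (@Rintegrable_supported _ _ _ r (Mf * Mp)) => //.
  + exact: measurable_funM.
  + by move=> x /sp ->; rewrite mulr0.
  + by move=> x; rewrite normrM ler_pM.
- by apply: RintegrableZ; exact: Rintegrable_cube.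
- move=> x; have := @smooth_cvg _ _ _ f e (phi x A) sf.
  have -> : diff_quot e f (phi x A) = fun h => (f (phi (x + h *: e) A) - f (phi x A)) / h.
    by apply/funext => h; rewrite /diff_quot phiD [_ + x]addrC.
  exact.
- move=> x; have := test_derivable (i := i) (x := x) tp; rewrite /derivable => /cvg_ex[l dl].
  rewrite (_ : 'D_e psi x = l); last exact/cvg_lim.
  apply: cvg_trans dl; apply: near_eq_cvg; apply: nearW => h /=.
  by rewrite [_ + x]addrC [RHS]mulrC.
- move=> h x h0 h1; rewrite normrM normrM normfV.
  case: (pselect (cube (r + 1) x)) => xr; last first.
    rewrite (sp x); last by move=> xr'; apply: xr; apply: cube_le xr'; rewrite lerDl.
    by rewrite normr0 mulr0 indicE memNset// mulr0.
  rewrite indicE mem_set// mulr1 (@le_trans _ _ (Nf * Mp))//; last by rewrite lerDl mulr_ge0// ltW.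
  rewrite ler_pM// ler_pdivrMr ?normr_gt0//.
  by have := smooth_lipschitz sf fN (phi x A) h; rewrite phiD [_ + x]addrC.
- move=> h x h0 h1; rewrite normrM normrM normfV.
  case: (pselect (cube (r + 1) x)) => xr; last first.
    rewrite (sp x); last by move=> xr'; apply: xr; apply: cube_le xr'; rewrite lerDl.
    rewrite (sp (x + h *: e)) ?subrr ?normr0 ?mul0r ?mulr0 ?indicE ?memNset ?mulr0// => xr'.
    apply: xr => j; have := xr' j; rewrite !mxE eqxx /= => xj.
    have -> : x ord0 j = (x ord0 j + h * (j == i)%:R) - h * (j == i)%:R by rewrite addrK.
    rewrite (le_lt_trans (ler_normB _ _))// ltr_leD// normrM.
    by case: (j == i); rewrite ?normr1 ?mulr1 ?normr0 ?mulr0.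
  rewrite indicE mem_set// mulr1 (@le_trans _ _ (Mf * Np))//; last by rewrite lerDr mulr_ge0// ltW.
  by rewrite ler_pM// ler_pdivrMr ?normr_gt0.
Qed.

(** Derivatives pass to the test function in the reverse order. *)
Lemma orbit_by_parts l f psi A : smooth f -> test_function psi ->
  \int[leb]_x (Dseq (rev l) f (phi x A) * psi x) =
  (-1) ^+ size l * \int[leb]_x (f (phi x A) * Drv l psi x).
Proof.
move=> sf tp; elim: l f sf => [|i l IH] f sf; first by rewrite mul1r.
rewrite rev_cons -cats1 Dseq_cat /= IH; last exact: smooth_dir_deriv.
by rewrite orbit_by_parts1//; [rewrite exprS mulN1r mulNr mulrN|exact: test_Drv].
Qed.

End OrbitDerivatives.

Section Intertwining.
Context {R : realType} {d : nat} {L0 : deloneSet R d}.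
Local Notation Omega := (pattern_space L0).
Local Notation leb := (lebesgue_rV R d).
Implicit Types (A B : Omega) (x t : 'rV[R]_d) (f g : Omega -> R) (psi u v q : 'rV[R]_d -> R).

Lemma locally_integrableP u : measurable_fun setT u ->
  (forall m : nat, Rintegrable leb (fun x => u x * \1_(cube m.+1%:R) x)) ->
  locally_integrable_rV u.
Proof.
move=> mu iu; split=> // K cK; have [r r0 Kr] := compact_cube cK.
pose m := Num.truncn r.
have Km x : K x -> cube m.+1%:R x.
  by move=> /Kr; apply: cube_le; rewrite ltW// truncnS_gt.
have mK : measurable K.
  rewrite -[K]setCK; apply: measurableC; apply: open_measurable_rV.
  by apply: closed_openC; apply: compact_closed cK; exact: norm_hausdorff.
have mau : measurable_fun setT (fun x => `|u x|%:E).
  by apply/measurable_EFinP; exact: measurableT_comp.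
have /integrableP[_] := iu m; apply: le_lt_trans.
rewrite (integral_mkcond K); apply: ge0_le_integral => //.
- by move=> x _; rewrite patchE; case: ifPn => _ //; rewrite lee_fin.
- exact: ((measurable_restrictT _ mK).1 (measurable_funTS mau)).
- by apply: measurableT_comp => //; have /integrableP[] := iu m.
- move=> x _; rewrite patchE; case: ifPn => [/set_mem/Km xm|_]; last exact: abse_ge0.
  by rewrite /= indicE mem_set// mulr1.
Qed.

Lemma local_integral_cvg (r M : R) (u : nat -> 'rV[R]_d -> R) v q : measurable_fun setT q ->
  (forall x, `|q x| <= M) -> (forall x, ~ cube r x -> q x = 0) ->
  (forall n, Rintegrable leb (fun x => u n x * \1_(cube r) x)) ->
  Rintegrable leb (fun x => v x * \1_(cube r) x) ->
  \int[leb]_x (`|u n x - v x| * \1_(cube r) x) @[n --> \oo] --> (0 : R) ->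
  \int[leb]_x (u n x * q x) @[n --> \oo] --> \int[leb]_x (v x * q x).
Proof.
move=> mq qM sq iu iv uv.
have E w : (fun x => w x * q x) = (fun x => q x * (w x * \1_(cube r) x)).
  apply/funext => x; case: (pselect (cube r x)) => xr; first by rewrite indicE mem_set// mulr1 mulrC.
  by rewrite sq// mulr0 mul0r.
have iq w : Rintegrable leb (fun x => w x * \1_(cube r) x) -> Rintegrable leb (fun x => w x * q x).
  move=> iw; rewrite E; apply: Rintegrable_le (RintegrableZ M iw) => [|x].
    by apply: measurable_funM => //; exact: (Rintegrable_meas iw).
  by rewrite !normrM ler_wpM2r// (le_trans (qM x))// ler_norm.
have M0 : 0 <= M by exact: le_trans (qM 0).
have idf n : Rintegrable leb (fun x => `|u n x - v x| * \1_(cube r) x).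
  have := Rintegrable_abs (RintegrableB (iu n) iv); congr Rintegrable.
  apply/funext => x; rewrite -mulrBl normrM [`|\1__ _|]ger0_norm// indicE.
apply/cvgrPdist_le => e e0; have M1 : 0 < M + 1 by rewrite ltr_wpDl.
have /cvgrPdist_le/(_ _ (divr_gt0 e0 M1)) := uv; apply: filterS => n.
rewrite sub0r normrN ger0_norm; last first.
  by apply: Rint_ge0 => x; rewrite mulr_ge0// indicE; case: (_ \in _).
move=> h; rewrite distrC -RintB; [|exact: iq ..].
rewrite (le_trans (Rint_abs (RintegrableB (iq _ (iu n)) (iq _ iv))))//.
apply: (@le_trans _ _ (\int[leb]_x (M * (`|u n x - v x| * \1_(cube r) x)))).
  apply: Rint_le.
  - by apply: Rintegrable_abs; apply: RintegrableB; exact: iq.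
  - exact: RintegrableZ.
  - move=> x; rewrite -mulrBl normrM mulrCA ler_wpM2l//.
    case: (pselect (cube r x)) => xr; first by rewrite indicE mem_set// mulr1.
    by rewrite sq// normr0 mulr_ge0// indicE; case: (_ \in _).
rewrite RintZ// (le_trans (ler_wpM2l M0 h))// mulrCA ger_pMr// ler_pdivrMr// mul1r.
by rewrite lerDl.
Qed.

Variable mu : probability Omega R.
Hypothesis inv : translation_invariant mu.

Lemma Rint_abs_norm2 f : sq_integrable mu f -> \int[mu]_A `|f A| <= norm2 mu f.
Proof.
move=> sf; have sa := sq_integrable_abs sf; have s1 := sq_integrable_cst mu 1.
have n1 : norm2 mu (fun=> 1) = 1.
  rewrite /norm2 expr1n /Rintegral integral_cst// mul1e.
  by rewrite [X in fine X]probability_setT sqrtr1.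
have na : norm2 mu (fun A => `|f A|) = norm2 mu f.
  by congr Num.sqrt; apply: eq_Rint => A; rewrite real_normK ?num_real.
have := norm2_cauchy_schwarz sa s1; rewrite n1 na mulr1; apply: le_trans.
by under eq_Rint do rewrite -[`|f _|]mulr1; exact: ler_norm.
Qed.

(** With [chi] the indicator of a cube, this is convergence in mean on a cube of
    almost every orbit; the rate of convergence spares the choice of a subsequence. *)
Lemma conv_abs_cvg chi (F : nat -> Omega -> R) f : Rintegrable leb chi ->
  (forall x, 0 <= chi x) -> (forall n, sq_integrable mu (F n)) -> sq_integrable mu f ->
  (forall n, norm2 mu (fun A => F n A - f A) <= 2^-1 ^+ n) ->
  {ae mu, forall A, orbit_conv chi (fun B => `|F n B - f B|) A @[n --> \oo] --> (0 : R)}.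
Proof.
move=> ichi chi0 sF sf Ff.
have V0 : 0 <= \int[leb]_x chi x by exact: Rint_ge0.
(* the summand 1 only makes [c] positive *)
pose c : R := \int[leb]_x chi x + 1.
have c0 : 0 < c by rewrite ltr_wpDl.
have ia n : Rintegrable mu (fun B => `|F n B - f B|).
  by apply: Rintegrable_abs; apply: sq_integrable_Rintegrable; exact: sq_integrableB.
have ic n := Rintegrable_conv inv (ia n) ichi.
have : {ae mu, forall A, c^-1 * orbit_conv chi (fun B => `|F n B - f B|) A @[n --> \oo] --> (0 : R)}.
  apply: fast_cvg_ae => [n|n A|n].
  - by apply: measurable_funM => //; exact: Rintegrable_meas (ic n).
  - rewrite mulr_ge0 ?invr_ge0 ?(ltW c0)//; apply: Rint_ge0 => x; exact: mulr_ge0.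
  - rewrite Rint_EFin ?lee_fin; last exact: RintegrableZ.
    rewrite RintZ// (Rint_conv1 inv (ia n) ichi) mulrA.
    rewrite (le_trans _ (Ff n))// (le_trans _ (Rint_abs_norm2 (sq_integrableB (sF n) sf)))//.
    have I0 : 0 <= \int[mu]_A `|F n A - f A| by exact: Rint_ge0.
    by rewrite ler_piMl// mulrC ler_pdivrMr// mul1r lerDl.
apply: filterS => A cA; have := cvgM (cvg_cst c) cA; rewrite mulr0.
rewrite (_ : _ \* _ = fun n => orbit_conv chi (fun B => `|F n B - f B|) A); first exact.
by apply/funext => n /=; rewrite mulrA divff ?mul1r ?gt_eqF.
Qed.

Hypothesis hflc : finite_local_complexity L0.

Lemma smooth_cube_integrable f A (r : R) : smooth f -> 0 < r ->
  Rintegrable leb (fun x => f (phi x A) * \1_(cube r) x).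
Proof.
move=> sf r0; have [M M0 fM] := smooth_bounded hflc sf.
apply: (@Rintegrable_supported _ _ _ r M) => //.
- apply: measurable_funM; last by apply: measurable_indic; exact: measurable_cube.
  exact: measurable_fun_orbit (smooth_measurable sf).
- by move=> x xr; rewrite indicE memNset ?mulr0.
- move=> x; rewrite normrM indicE; case: (_ \in _); rewrite ?normr1 ?normr0 ?mulr1 ?mulr0//.
  exact: ltW.
Qed.

(** For smooth functions this is integration by parts along an orbit. A fast sequence
    of smooth functions converges, with its derivatives, in mean on each cube of
    almost every orbit, and the identity passes to the limit. *)
Lemma orbit_distr_deriv a k f : (mi_size a <= k)%N -> sobolev mu k f ->
  {ae mu, forall A, distr_deriv_rV a (fun x => f (phi x A)) (fun x => weakD mu a f (phi x A))}.
Proof.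
move=> ak Wf; have [sf _] := (sobolevP mu k f).1 Wf; have [mf _] := sf.
have sg := sq_integrable_weakD mu a f; have [mg _] := sg.
have hF n : exists psi : Omega -> R, [/\ smooth psi, norm2 mu (fun A => psi A - f A) <= 2^-1 ^+ n &
    norm2 mu (fun A => D_hull a psi A - weakD mu a f A) <= 2^-1 ^+ n].
  have e0 : 0 < 2^-1 ^+ n :> R by rewrite exprn_gt0// invr_gt0.
  have [psi [sp _] pf] := sobolev_dense inv hflc Wf e0.
  have spsi := smooth_sq_integrable mu hflc sp.
  have sD := smooth_sq_integrable mu hflc (smooth_D_hull a sp).
  have Wp := smooth_sobolev inv hflc k sp.
  have Wd : sobolev mu k (fun A => f A - psi A).
    have := sobolev_lin hflc (-1) Wp Wf; congr sobolev.
    by apply/funext => A; ring.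
  have sW := sq_integrableB sf spsi.
  exists psi; split=> //.
    rewrite norm2C (le_trans _ (ltW pf))//.
    have k0 : (mi_size (fun _ : 'I_d => 0%N) <= k)%N by rewrite mi_size0.
    rewrite (le_trans _ (norm2_weakD_le mu _ k0))//.
    rewrite (norm2_ae_eq (proj1 (sq_integrable_weakD mu _ _)) _ (weakD0 inv hflc sW))//.
    by case: sW.
  rewrite norm2C (le_trans _ (ltW pf))// (le_trans _ (norm2_weakD_le mu _ ak))//.
  rewrite (@norm2_ae_eq _ _ _ mu _ (weakD mu a (fun A => f A - psi A)))//.
  - by case: (sq_integrableB sg sD).
  - exact: measurable_weakD.
  - have := weakD_lin inv hflc (-1) ak Wp Wf.
    apply: filterS2 (weakD_smooth inv hflc a sp) => A hA.
    rewrite hA mulN1r addrC => <-; congr (weakD mu a _ A).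
    by apply/funext => B; ring.
have [F FP] := choice hF.
have sF n : smooth (F n) by case: (FP n).
have sF2 n := smooth_sq_integrable mu hflc (sF n).
have sDF2 n := smooth_sq_integrable mu hflc (smooth_D_hull a (sF n)).
have ichi (m : nat) : Rintegrable leb (\1_(@cube R d m.+1%:R)) by exact: Rintegrable_cube.
have chi0 (m : nat) x : 0 <= \1_(@cube R d m.+1%:R) x :> R by rewrite indicE; case: (_ \in _).
have c1 : {ae mu, forall A (m : nat), Rintegrable leb (fun x => f (phi x A) * \1_(cube m.+1%:R) x)}.
  by apply: ae_foralln => m; exact: (conv_ae_integrable inv (sq_integrable_Rintegrable sf) (ichi m)).
have c2 : {ae mu, forall A (m : nat), Rintegrable leb (fun x => weakD mu a f (phi x A) * \1_(cube m.+1%:R) x)}.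
  by apply: ae_foralln => m; exact: (conv_ae_integrable inv (sq_integrable_Rintegrable sg) (ichi m)).
have c3 : {ae mu, forall A (m : nat),
    orbit_conv (\1_(cube m.+1%:R)) (fun B => `|F n B - f B|) A @[n --> \oo] --> (0 : R)}.
  by apply: ae_foralln => m; apply: conv_abs_cvg => // n; case: (FP n).
have c4 : {ae mu, forall A (m : nat), orbit_conv (\1_(cube m.+1%:R))
    (fun B => `|D_hull a (F n) B - weakD mu a f B|) A @[n --> \oo] --> (0 : R)}.
  by apply: ae_foralln => m; apply: conv_abs_cvg => // n; case: (FP n).
apply: filterS2 (filterI c1 c2) (filterI c3 c4) => A [i1 i2] [l1 l2]; split.
- by apply: locally_integrableP => //; exact: measurable_fun_orbit.
- by apply: locally_integrableP => //; exact: measurable_fun_orbit.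
move=> psi tp; have tD : test_function (D_rV a psi) by rewrite D_rVE; exact: test_Drv.
have [M _ pM] := test_bounded tp; have [N _ DN] := test_bounded tD.
have [r r0 sp] := test_support tp; have [r' r'0 sD] := test_support tD.
pose m := Num.truncn (Num.max r r').
have rm : Num.max r r' <= m.+1%:R by rewrite ltW// truncnS_gt.
have h1 : \int[leb]_x (F n (phi x A) * D_rV a psi x) @[n --> \oo] -->
    \int[leb]_x (f (phi x A) * D_rV a psi x).
  apply: (@local_integral_cvg m.+1%:R N (fun n x => F n (phi x A))) => //.
  - exact: continuous_measurable_rV (test_continuous tD).
  - by move=> x xm; apply: sD => xr; apply: xm; apply: cube_le xr; rewrite (le_trans _ rm)// le_max lexx orbT.
  - by move=> n; exact: smooth_cube_integrable.
  - exact: l1 m.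
have h2 : \int[leb]_x (D_hull a (F n) (phi x A) * psi x) @[n --> \oo] -->
    \int[leb]_x (weakD mu a f (phi x A) * psi x).
  apply: (@local_integral_cvg m.+1%:R M (fun n x => D_hull a (F n) (phi x A))) => //.
  - exact: continuous_measurable_rV (test_continuous tp).
  - by move=> x xm; apply: sp => xr; apply: xm; apply: cube_le xr; rewrite (le_trans _ rm)// le_max lexx.
  - by move=> n; apply: smooth_cube_integrable => //; exact: smooth_D_hull.
  - exact: l2 m.
have E n : \int[leb]_x (D_hull a (F n) (phi x A) * psi x) =
    (-1) ^+ mi_size a * \int[leb]_x (F n (phi x A) * D_rV a psi x).
  rewrite D_rVE -size_mi_seq -orbit_by_parts// D_hullE.
  by rewrite (Dseq_perm (sF n) (_ : perm_eq (mi_seq a) (rev (mi_seq a))))// perm_sym perm_rev.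
have h3 : (fun n => (-1) ^+ mi_size a * \int[leb]_x (F n (phi x A) * D_rV a psi x)) @ \oo -->
    (-1) ^+ mi_size a * \int[leb]_x (f (phi x A) * D_rV a psi x).
  exact: cvgM (cvg_cst _) h1.
rewrite -(cvg_lim _ h2)// -(cvg_lim _ h3)//; congr (lim (_ @ \oo)).
by apply/funext => n; rewrite E.
Qed.

End Intertwining.

Theorem theorem3 (R : realType) (d : nat) (L0 : deloneSet R d)
    (hap : aperiodic L0) (hrep : repetitive L0)
    (hflc : finite_local_complexity L0)
    (mu : probability (pattern_space L0) R) (hue : uniquely_ergodic mu)
    (k : nat) :
  [/\ (* (1) *)
      hilbert_quotient (V := pattern_space L0 -> R^o)
        (sobolev mu k) (ae_null mu) (sobolev_norm mu k),
      (* (2) *)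
      forall a : 'I_d -> nat, (mi_size a <= k)%N ->
      [/\ (* the operator maps W^k to W^(k-|a|) *)
          forall f, sobolev mu k f ->
            sobolev mu (k - mi_size a) (weakD mu a f),
          (* linear *)
          forall (c : R) f g, sobolev mu k f -> sobolev mu k g ->
            {ae mu, forall L, weakD mu a (fun M => c * f M + g M) L =
                              c * weakD mu a f L + weakD mu a g L},
          (* bounded *)
          exists C : R, forall f, sobolev mu k f ->
            sobolev_norm mu (k - mi_size a) (weakD mu a f) <=
            C * sobolev_norm mu k f,
          (* local *)
          forall (O : set (pattern_space L0)) f g, open O ->
            sobolev mu k f -> sobolev mu k g ->
            {ae mu, forall L, O L -> f L = g L} ->
            {ae mu, forall L, O L -> weakD mu a f L = weakD mu a g L} &
          (* intertwined with the orbit maps *)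
          forall f, sobolev mu k f ->
            {ae mu, forall L : pattern_space L0,
              exists2 v : 'rV[R]_d -> R,
                distr_deriv_rV a (fun t => f (phi t L)) v &
                {ae lebesgue_rV R d, forall t, weakD mu a f (phi t L) = v t}}] &
      (* (3) *)
      @smooth_tlc R d L0 `<=` sobolev mu k /\
      forall f, sobolev mu k f -> forall e : R, 0 < e ->
        exists2 g, smooth_tlc g & sobolev_norm mu k (fun L => f L - g L) < e].
Proof.
have [inv _] := hue; split.
- exact: sobolev_hilbert.
- move=> a ak; split.
  + by move=> f; exact: sobolev_weakD.
  + by move=> c f g; exact: weakD_lin.
  + exists #|{ffun 'I_d -> 'I_(k - mi_size a).+1}|%:R => f.
    exact: weakD_bounded.
  + move=> O f g oO Wf Wg fg.
    have W := sobolev_lin hflc (-1) Wg Wf.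
    have fg0 : {ae mu, forall A, O A -> -1 * g A + f A = 0}.
      by apply: filterS fg => A fgA OA; rewrite fgA// mulN1r addNr.
    have := weakD_local inv hflc ak W oO fg0.
    apply: filterS2 (weakD_lin inv hflc (-1) ak Wg Wf) => A -> h OA.
    by apply/eqP; rewrite -subr_eq0 addrC -mulN1r; apply/eqP; exact: h.
  + move=> f Wf; apply: filterS (orbit_distr_deriv inv hflc ak Wf) => A dA.
    by exists (fun t => weakD mu a f (phi t A)) => //; apply: nearW.
- split; first by move=> f [sf _]; exact: smooth_sobolev.
  by move=> f Wf e e0; exact: sobolev_dense.
Qed.
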